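(* Let $R_0>0$. There exist constants $\varepsilon_*>0$ and $C>0$ (depending only on $R_0$) such that the following holds. Let $\mathbf u_0\in C_0^\infty(\mathbb R^3;\mathbb R^3)$ and $\rho_0\in C_0^\infty(\mathbb R^3)$ have supports contained in $\{x:|x|\le R_0\}$, with $1+\rho_0>0$, and let $(\rho,\mathbf u)$ be a classical solution for $0<t<T$ of the compressible Euler system $$\rho_t+\mathrm{div}(\rho\mathbf u)=0,\qquad (\rho\mathbf u)_t+\mathrm{div}(\rho\mathbf u\otimes\mathbf u)+\nabla p=0,\qquad p=\tfrac12\rho^2,\qquad x\in\mathbb R^3,$$ with initial data $\mathbf u=\mathbf u_0(x)$, $\rho=1+\rho_0(x)$ at $t=0$. Suppose that $$\varepsilon:=\int_{\mathbb R^3}\int_{S^2}e^{\omega\cdot x}\rho_0(x)\,d\omega\,dx+\int_{\mathbb R^3}\int_{S^2}e^{\omega\cdot x}(1+\rho_0(x))(\mathbf u_0(x)\cdot\omega)\,d\omega\,dx>0$$ and $\varepsilon\le\varepsilon_*$ (small data). Then $T<e^{C\varepsilon^{-1}}$.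
   Context: Here $\rho=\rho(t,x)$ is the density (positive), $\mathbf u=\mathbf u(t,x)\in\mathbb R^3$ is the velocity and $p$ is the pressure, with the pressure law $p(\rho)=\frac12\rho^2$ throughout. $S^2$ is the unit sphere in $\mathbb R^3$ and $d\omega$ its surface measure. *)

(* Defs.v *)
From HB Require Import structures.
From mathcomp Require Import all_boot all_order all_algebra.
From mathcomp Require Import all_classical all_reals all_analysis.

Set Implicit Arguments.
Unset Strict Implicit.
Unset Printing Implicit Defensive.

Import Order.TTheory GRing.Theory Num.Theory.
Import numFieldNormedType.Exports.

Local Open Scope classical_set_scope.
Local Open Scope ring_scope.

Section EuclideanSpace.
Context {R : realType}.
Implicit Types (x y : 'rV[R]_3) (f : 'rV[R]_3 -> R).

Definition dot x y : R := \sum_(i < 3) x 0 i * y 0 i.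

(* The library's norm `|x| on 'rV[R]_3 is the sup norm. *)
Definition euclid x : R := Num.sqrt (dot x x).

Definition supp {V : zmodType} (f : 'rV[R]_3 -> V) : set 'rV[R]_3 :=
  closure [set x | f x != 0].

Definition partial (j : 'I_3) f : 'rV[R]_3 -> R :=
  fun x => 'D_(delta_mx 0 j) f x.

Definition smooth f : Prop :=
  forall s : seq 'I_3,
    continuous (foldr partial f s) /\
    forall j x, derivable (foldr partial f s) x (delta_mx 0 j).

Definition Cc_infty f : Prop := smooth f /\ compact (supp f).

Definition Cc_infty_vect (u : 'rV[R]_3 -> 'rV[R]_3) : Prop :=
  (forall i, smooth (fun x => u x 0 i)) /\ compact (supp u).

Definition row3 (a b c : R) : 'rV[R]_3 := \row_(i < 3) [:: a; b; c]`_i.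

(* The library has no Lebesgue measure on 'rV[R]_3: integrate in coordinates. *)
Definition int_R3 f : R :=
  \int[((@lebesgue_measure R \x @lebesgue_measure R) \x @lebesgue_measure R)%E]_z
    f (row3 z.1.1 z.1.2 z.2).

Definition sph (a : R * R) : 'rV[R]_3 :=
  row3 (sin a.1 * cos a.2) (sin a.1 * sin a.2) (cos a.1).

(* Surface integral over the unit sphere in spherical coordinates,
   where the surface element is sin(theta) dtheta dphi. *)
Definition int_S2 f : R :=
  \int[(@lebesgue_measure R \x @lebesgue_measure R)%E]_(a in `[0, pi] `*` `[0, pi *+ 2])
    (f (sph a) * sin a.1).

End EuclideanSpace.

Section Euler.
Context {R : realType}.
Implicit Types (T : \bar R) (f : R -> 'rV[R]_3 -> R).

Definition dt f : R -> 'rV[R]_3 -> R := fun t x => derive1 (f ^~ x) t.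

Definition dx (j : 'I_3) f : R -> 'rV[R]_3 -> R := fun t x => partial j (f t) x.

(* C^1 on the open slab ]0, T[ x R^3 and continuous on [0, T[ x R^3. *)
Definition classical_regular T f : Prop :=
  [/\ {within [set z : R * 'rV[R]_3 | 0 <= z.1 /\ (z.1%:E < T)%E],
         continuous (fun z => f z.1 z.2)},
      forall t x, 0 < t -> (t%:E < T)%E ->
        derivable (f ^~ x) t 1 /\
        {for (t, x), continuous (fun z : R * 'rV[R]_3 => dt f z.1 z.2)}
    & forall j t x, 0 < t -> (t%:E < T)%E ->
        derivable (f t) x (delta_mx 0 j) /\
        {for (t, x), continuous (fun z : R * 'rV[R]_3 => dx j f z.1 z.2)}].

Definition pressure (r : R) : R := 2^-1 * r ^+ 2.

Record classical_solution T (rho : R -> 'rV[R]_3 -> R)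
    (u : R -> 'rV[R]_3 -> 'rV[R]_3) : Prop := {
  rho_regular : classical_regular T rho;
  u_regular : forall i, classical_regular T (fun t x => u t x 0 i);
  rho_gt0 : forall t x, 0 <= t -> (t%:E < T)%E -> 0 < rho t x;
  mass_eq : forall t x, 0 < t -> (t%:E < T)%E ->
    dt rho t x + \sum_(j < 3) dx j (fun s y => rho s y * u s y 0 j) t x = 0;
  momentum_eq : forall i t x, 0 < t -> (t%:E < T)%E ->
    dt (fun s y => rho s y * u s y 0 i) t x +
    \sum_(j < 3) dx j (fun s y => rho s y * u s y 0 i * u s y 0 j) t x +
    dx i (fun s y => pressure (rho s y)) t x = 0 }.

End Euler.

(* Main.v *)
Require Import Defs.
From HB Require Import structures.
From mathcomp Require Import all_boot all_order all_algebra.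
From mathcomp Require Import all_classical all_reals all_analysis.
From mathcomp Require Import measurable_realfun ring lra.
Import Order.TTheory GRing.Theory Num.Theory.
Import numFieldNormedType.Exports.
Local Open Scope classical_set_scope.
Local Open Scope ring_scope.

(** The proof follows one plane wave.  The integral defining epsilon is an
    integral over the sphere of the numbers eps(w) = int e^{w.x} (rho0 +
    (1 + rho0) (u0.w)) dx, so some unit vector w has eps(w) >= eps/64
    ([exists_growing_direction]).  Put F(t) = int e^{w.x} (rho - 1) dx and
    M(t) = int e^{w.x} rho (u.w) dx, so that F(0) + M(0) = eps(w).

    The conservation of mass gives F' = M.  As |w| = 1 and p(rho) - p(1) =
    (rho - 1) + (rho - 1)^2/2, the conservation of momentum gives M' = F +
    S with S = int e^{w.x} (rho (u.w)^2 + (rho - 1)^2/2) dx >= 0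
    ([wmass_deriv], [wmom_deriv]).  The linear part alone gives growth
    like e^t; the quadratic term S turns it into blow-up.  Signals
    propagate with speed at most 1, the sound speed of the state rho = 1,
    u = 0, so that rho - 1 lives in the ball of radius R0 + t
    ([finite_speed]), and Cauchy's inequality yields S >= F^2 / (2 V)
    where V bounds the integral of e^{w.x} over that ball.  The
    exponential concentrates near the pole x = (R0 + t) w in a paraboloid
    of width (R0 + t)^{1/2} and height of order 1, so that V may be taken
    of the form const (R0 + t) e^{R0 + t} ([int_ball_wave_bound],
    [wsource_ge]).  The factor R0 + t, and no higher power of it, is what
    makes the lifespan exponential.

    In the variables H = e^{-t} F and A = e^{-t} (F + M) one has H' = A -
    2 H and A' >= kappa H^2 / (R0 + t).  Here A is nondecreasing and A(0)
    >= eps/64, hence H exceeds a multiple of eps after a time t1 of order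
    1/eps.  From then on H stays above the subsolution delta theta^{-2},
    where theta(t) = 1 - mu delta (ln (R0 + t) - ln (R0 + t1)) and delta
    is a multiple of eps ([sub_h_lt]).  The subsolution blows up when ln
    ((R0 + t) / (R0 + t1)) = 1 / (mu delta), that is, before e^{C / eps}
    ([lifespan_le], [system_lifespan], [exponent_bound]).

    Finite speed of propagation is proved by the relative energy rho
    |u|^2/2 + (rho - 1)^2/2, weighted by the square of the positive part
    of c^2 (t1 - t)^2 - |x - y|^2.  Where the solution is close to rest
    the energy flux is at most c > 1 times the energy, hence the weighted
    energy does not increase ([cone_step]); a solution at rest on a slice
    of the cone stays close to rest for a time that is uniform in the
    cone, so the cone is exhausted by finitely many steps
    ([at_rest_cone]). *)

Set Implicit Arguments.
Unset Strict Implicit.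
Unset Printing Implicit Defensive.

(** * Measurability of continuous functions on product spaces *)

Section Measurability.
Context {R : realType}.

(** Rounding the second variable down to a multiple of 1/n turns [f] into a
    function that is measurable on countably many slabs, and by continuity in
    that variable the rounded functions converge to [f]. *)
Lemma caratheodory_measurable d (T : measurableType d) (f : T * R -> R) :
  (forall s, measurable_fun setT (fun x => f (x, s))) ->
  (forall x, continuous (fun s => f (x, s))) ->
  measurable_fun setT f.
Proof.
move=> mf cf.
pose r (n : nat) (s : R) : R := (Num.floor (n.+1%:R * s))%:~R / n.+1%:R.
have rcvg s : r n s @[n --> \oo] --> s.
  apply/cvgrPdist_le => e e0.
  near=> n.
  have n0 : 0 < (n.+1%:R : R) by rewrite ltr0n.
  have /andP[h1 h2] := floor_itv (n.+1%:R * s).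
  have -> : s - r n s = (n.+1%:R * s - (Num.floor (n.+1%:R * s))%:~R) / n.+1%:R.
    by rewrite /r; field; rewrite gt_eqF.
  rewrite normrM normfV (gtr0_norm n0) ler_pdivrMr//.
  rewrite ger0_norm ?subr_ge0//.
  apply: (@le_trans _ _ 1); first by rewrite lerBlDl (le_trans (ltW h2))// intrD lexx.
  rewrite -ler_pdivrMl// mulr1.
  near: n.
  exists (Num.trunc e^-1).+1 => // n /= hn.
  apply: (le_trans (ltW (truncnS_gt _))).
  by rewrite ler_nat ltnW.
apply: (measurable_fun_cvg (h := fun n x => f (x.1, r n x.2))); last first.
  move=> [x s] _ /=.
  by apply: (@cvg_comp _ _ _ (r ^~ s) (fun s => f (x, s)) _ (nbhs s)); [exact: rcvg|exact: cf].
move=> n.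
(* on [A k] the rounded second variable is the constant k / (n + 1) *)
pose A (k : int) : set (T * R) :=
  [set z | Num.floor (n.+1%:R * z.2) = k].
have mA k : measurable (A k).
  have -> : A k = snd @^-1` [set s : R | k%:~R <= n.+1%:R * s < (k + 1)%:~R].
    by apply/seteqP; split => z /=; rewrite /A/=; [move=> <-; exact: floor_itv|exact: floor_def].
  rewrite -[X in measurable X]setTI.
  apply: measurable_snd => //.
  have -> : [set s : R | k%:~R <= n.+1%:R * s < (k + 1)%:~R] =
    `[k%:~R / n.+1%:R, (k + 1)%:~R / n.+1%:R[%classic.
    apply/seteqP; split => s /=; rewrite in_itv/=;
    by rewrite ler_pdivrMr ?ltr0n// ltr_pdivlMr ?ltr0n// (mulrC s).
  exact: measurable_itv.
have -> : setT = \bigcup_i (A (odflt 0 (unpickle i))).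
  apply/esym/seteqP; split => // z _.
  by exists (pickle (Num.floor (n.+1%:R * z.2))) => //; rewrite pickleK.
apply/measurable_fun_bigcup => // i.
set k := odflt _ _.
apply: (@eq_measurable_fun _ _ _ _ _ (fun z => f (z.1, k%:~R / n.+1%:R))).
  by move=> z; rewrite inE /A/= /r => ->.
apply: measurable_funTS.
by apply: (measurableT_comp (mf _)); exact: measurable_fst.
Unshelve. all: end_near. Qed.

Lemma continuous_measurable2 (f : R * R -> R) :
  continuous f -> measurable_fun setT f.
Proof.
move=> cf; apply: caratheodory_measurable => [s|x].
  apply: continuous_measurable_fun => x.
  by apply: (@cvg_comp _ _ _ (fun x => (x, s)) f _ (nbhs (x, s))); [exact: (cvg_pair cvg_id (cvg_cst s))|exact: cf].
move=> s.
by apply: (@cvg_comp _ _ _ (fun s => (x, s)) f _ (nbhs (x, s))); [exact: (cvg_pair (cvg_cst x) cvg_id)|exact: cf].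
Qed.

Lemma continuous_measurable3 (f : R * R * R -> R) :
  continuous f -> measurable_fun setT f.
Proof.
move=> cf; apply: caratheodory_measurable => [s|x].
  apply: continuous_measurable2 => x.
  by apply: (@cvg_comp _ _ _ (fun x => (x, s)) f _ (nbhs (x, s))); [exact: (cvg_pair cvg_id (cvg_cst s))|exact: cf].
move=> s.
by apply: (@cvg_comp _ _ _ (fun s => (x, s)) f _ (nbhs (x, s))); [exact: (cvg_pair (cvg_cst x) cvg_id)|exact: cf].
Qed.

End Measurability.

(** * Integration over products of the real line *)

Section Integration.
Context {R : realType}.
Local Notation leb := (@lebesgue_measure R).
Local Notation mu2 := (leb \x leb)%E.
Local Notation mu3 := ((leb \x leb) \x leb)%E.
Implicit Types (f g q Q : R * R * R -> R) (L : R).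

Definition swap01 (z : R * R * R) : R * R * R := (z.1.2, z.1.1, z.2).
Definition swap12 (z : R * R * R) : R * R * R := (z.1.1, z.2, z.1.2).

Lemma measurable_swap01 : measurable_fun setT swap01.
Proof.
apply: measurable_fun_pair; last exact: measurable_snd.
by apply: measurable_fun_pair; [apply: (measurableT_comp measurable_snd)|
  apply: (measurableT_comp measurable_fst)]; exact: measurable_fst.
Qed.

Lemma measurable_swap12 : measurable_fun setT swap12.
Proof.
apply: measurable_fun_pair.
  by apply: measurable_fun_pair; [apply: (measurableT_comp measurable_fst);
    exact: measurable_fst|exact: measurable_snd].
by apply: (measurableT_comp measurable_snd); exact: measurable_fst.
Qed.

(** Alias of the planar Lebesgue measure on which sigma-finiteness is recorded,
    as Tonelli's theorem for the third variable asks for it. *)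
Definition leb2 : set (measurableTypeR R * measurableTypeR R)%type -> \bar R := mu2.
HB.instance Definition _ := Measure.on leb2.
Let leb2_sigma_finite : sigma_finite setT leb2.
Proof.
exists (fun n => `[- n%:R, n%:R] `*` `[- n%:R, n%:R]) => [|n].
  apply/esym/seteqP; split => // -[x y] _.
  exists (Num.truncn (Num.max `|x| `|y|)).+1 => //=.
  have [h1 h2] : `|x| < (Num.truncn (Num.max `|x| `|y|)).+1%:R /\ `|y| < (Num.truncn (Num.max `|x| `|y|)).+1%:R.
    have := truncnS_gt (Num.max `|x| `|y|); rewrite gt_max => /andP[]; by split.
  by split; rewrite /= in_itv/= -ler_norml ltW.
have m : measurable (`[- n%:R, n%:R]%classic : set R) by exact: measurable_itv.
split; first exact: measurableX.
have e : leb `[- n%:R, n%:R]%classic = (2 * n%:R)%:E.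
  have n0 : 0 <= n%:R :> R by rewrite ler0n.
  rewrite lebesgue_measure_itv/= lte_fin; case: ltP => h.
    by rewrite -EFinB; congr EFin; lra.
  by congr EFin; lra.
pose I : set R := `[- n%:R, n%:R]%classic.
have -> : leb2 (I `*` I) = (leb I * leb I)%E.
  exact: product_measure1E.
by rewrite e -EFinM ltry.
Qed.
HB.instance Definition _ := Measure_isSigmaFinite.Build _ _ _ leb2 leb2_sigma_finite.

Local Open Scope ereal_scope.

Lemma tonelli2_F (f : R * R -> \bar R) :
  measurable_fun setT f -> (forall z, 0 <= f z) ->
  \int[mu2]_z f z = \int[leb]_x \int[leb]_y f (x, y).
Proof. by move=> mf f0; exact: (@fubini_tonelli1 _ _ _ _ R leb leb f mf f0). Qed.

Lemma tonelli2_G (f : R * R -> \bar R) :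
  measurable_fun setT f -> (forall z, 0 <= f z) ->
  \int[mu2]_z f z = \int[leb]_y \int[leb]_x f (x, y).
Proof. by move=> mf f0; exact: (@fubini_tonelli2 _ _ _ _ R leb leb f mf f0). Qed.

Lemma tonelli3_F (f : R * R * R -> \bar R) :
  measurable_fun setT f -> (forall z, 0 <= f z) ->
  \int[mu3]_z f z = \int[mu2]_p \int[leb]_s f (p, s).
Proof. by move=> mf f0; exact: (@fubini_tonelli1 _ _ _ _ R leb2 leb f mf f0). Qed.

Lemma tonelli3_G (f : R * R * R -> \bar R) :
  measurable_fun setT f -> (forall z, 0 <= f z) ->
  \int[mu3]_z f z = \int[leb]_s \int[mu2]_p f (p, s).
Proof. by move=> mf f0; exact: (@fubini_tonelli2 _ _ _ _ R leb2 leb f mf f0). Qed.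

Lemma measurable_integral_last (f : R * R * R -> \bar R) :
  measurable_fun setT f -> (forall z, 0 <= f z) ->
  measurable_fun setT (fun p : R * R => \int[leb]_s f (p, s)).
Proof. by move=> mf f0; exact: (@measurable_fun_fubini_tonelli_F _ _ _ _ R leb f mf f0). Qed.

Lemma tonelli3 (f : R * R * R -> \bar R) :
  measurable_fun setT f -> (forall z, 0 <= f z) ->
  \int[mu3]_z f z = \int[leb]_x \int[leb]_y \int[leb]_z f (x, y, z).
Proof.
move=> mf f0; rewrite tonelli3_F// (@tonelli2_F (fun p => \int[leb]_s f (p, s)))//.
  exact: measurable_integral_last.
by move=> p; apply: integral_ge0.
Qed.

Let swap01_ge0 (f : R * R * R -> \bar R) :
  measurable_fun setT f -> (forall z, 0 <= f z) ->
  \int[mu3]_z f (swap01 z) = \int[mu3]_z f z.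
Proof.
move=> mf f0.
have mfs : measurable_fun setT (fun z => f (swap01 z)).
  exact: measurableT_comp mf measurable_swap01.
have -> := tonelli3_G mf f0.
have -> := tonelli3_G mfs (fun z => f0 _).
apply: eq_integral => z _.
have mz : measurable_fun setT (fun p : R * R => f (p, z)).
  by apply: (measurableT_comp mf); exact: measurable_fun_pair.
have mz' : measurable_fun setT (fun p : R * R => f (swap01 (p, z))).
  by apply: (measurableT_comp mfs); exact: measurable_fun_pair.
have -> := tonelli2_G mz (fun z => f0 _).
by have -> := tonelli2_F mz' (fun z => f0 _).
Qed.

Let swap12_ge0 (f : R * R * R -> \bar R) :
  measurable_fun setT f -> (forall z, 0 <= f z) ->
  \int[mu3]_z f (swap12 z) = \int[mu3]_z f z.
Proof.
move=> mf f0.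
have mfs : measurable_fun setT (fun z => f (swap12 z)).
  exact: measurableT_comp mf measurable_swap12.
have -> := tonelli3 mf f0.
have -> := tonelli3 mfs (fun z => f0 _).
apply: eq_integral => x _.
have mx : measurable_fun setT (fun p : R * R => f (x, p.1, p.2)).
  apply: (measurableT_comp mf); apply: measurable_fun_pair => //.
  by apply: measurable_fun_pair.
have <- := tonelli2_F mx (fun z => f0 _).
by have -> := tonelli2_G mx (fun z => f0 _).
Qed.

(** Iterating the integrals in either order handles nonnegative functions; the
    general case follows from positive and negative parts. *)
Lemma integral_swap01 (f : R * R * R -> \bar R) : measurable_fun setT f ->
  \int[mu3]_z f (swap01 z) = \int[mu3]_z f z.
Proof.
move=> mf; rewrite integralE [RHS]integralE.
have -> : (fun z => f (swap01 z))^\+ = fun z => f^\+ (swap01 z) by exact: funepos_comp.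
have -> : (fun z => f (swap01 z))^\- = fun z => f^\- (swap01 z) by exact: funeneg_comp.
have -> := swap01_ge0 (measurable_funepos mf) (funepos_ge0 f).
by have -> := swap01_ge0 (measurable_funeneg mf) (funeneg_ge0 f).
Qed.

Lemma integral_swap12 (f : R * R * R -> \bar R) : measurable_fun setT f ->
  \int[mu3]_z f (swap12 z) = \int[mu3]_z f z.
Proof.
move=> mf; rewrite integralE [RHS]integralE.
have -> : (fun z => f (swap12 z))^\+ = fun z => f^\+ (swap12 z) by exact: funepos_comp.
have -> : (fun z => f (swap12 z))^\- = fun z => f^\- (swap12 z) by exact: funeneg_comp.
have -> := swap12_ge0 (measurable_funepos mf) (funepos_ge0 f).
by have -> := swap12_ge0 (measurable_funeneg mf) (funeneg_ge0 f).
Qed.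

Local Close Scope ereal_scope.

Definition box L : set (R * R * R) :=
  (`[- L, L] `*` `[- L, L]) `*` `[- L, L].

Lemma measurable_box L : measurable (box L).
Proof. by do 2 (apply: measurableX; last exact: measurable_itv); exact: measurable_itv. Qed.

Lemma compact_box L : compact (box L).
Proof. by do 2 (apply: compact_setX; last exact: segment_compact); exact: segment_compact. Qed.

Lemma cuboid_measure (a1 a2 a3 r : R) : 0 <= r ->
  mu3 (`[a1, a1 + r] `*` `[a2, a2 + r] `*` `[a3, a3 + r]) = (r * r * r)%:E.
Proof.
move=> r0; pose I a : set R := `[a, a + r]%classic.
have e a : leb (I a) = r%:E.
  rewrite /I lebesgue_measure_itv/= lte_fin; case: ltP => h.
    by rewrite -EFinB; congr EFin; lra.
  by congr EFin; lra.
have m a : measurable (I a : set R) by exact: measurable_itv.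
have -> : mu3 (I a1 `*` I a2 `*` I a3) = (mu2 (I a1 `*` I a2) * leb (I a3))%E.
  by apply: (@product_measure1E _ _ _ _ R leb2 leb); [exact: (measurableX (m _) (m _))|exact: m].
have -> : mu2 (I a1 `*` I a2) = (leb (I a1) * leb (I a2))%E.
  by apply: product_measure1E; exact: m.
by rewrite !e -!EFinM.
Qed.

Lemma box_measure_lty L : (mu3 (box L) < +oo)%E.
Proof.
have [L0|L0] := leP 0 L.
  have := @cuboid_measure (- L) (- L) (- L) (2 * L).
  rewrite (_ : - L + 2 * L = L); last by ring.
  by rewrite mulr_ge0// => /(_ isT) e; rewrite [X in (X < _)%E]e ltry.
have -> : box L = set0.
  apply/seteqP; split => // z [_ /=]; rewrite in_itv/= => /andP[h1 h2].
  by lra.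
by rewrite measure0 ltry.
Qed.

Lemma integrable_box f L M : measurable_fun setT f ->
  (forall z, `|f z| <= M) -> (forall z, ~ box L z -> f z = 0) ->
  mu3.-integrable setT (EFin \o f).
Proof.
move=> mf fM f0.
have -> : EFin \o f = (EFin \o f) \_ (box L).
  apply/funext => z; rewrite patchE; case: ifPn => //.
  by rewrite notin_setE => /f0 /= ->.
rewrite -integrable_mkcond; last exact: measurable_box.
apply: measurable_bounded_integrable.
- exact: measurable_box.
- exact: box_measure_lty.
- exact: measurable_funTS.
- exists M; split; rewrite ?num_real// => x Mx z _.
  by apply: le_trans (ltW Mx).
Qed.

Lemma continuous_box_bounded f L : {within box L, continuous f} ->
  exists2 M, 0 <= M & forall z, box L z -> `|f z| <= M.
Proof.
move=> cf; have /compact_bounded[M [_ hM]] := continuous_compact cf (@compact_box L).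
exists (`|M| + 1); first by rewrite addr_ge0.
by move=> z bz; apply: hM; [rewrite ltr_pwDr// ler_norm|exists z].
Qed.

Lemma integrable_cont_box f L : continuous f ->
  (forall z, ~ box L z -> f z = 0) -> mu3.-integrable setT (EFin \o f).
Proof.
move=> cf f0; have [M M0 hM] := continuous_box_bounded (L := L) (continuous_subspaceT cf).
apply: (@integrable_box f L M _ _ f0); first exact: continuous_measurable3.
move=> z; have [/hM//|/f0 ->] := pselect (box L z).
by rewrite normr0.
Qed.

(** By the fundamental theorem of calculus the inner integral is a difference
    of two values of [Q] outside the box, hence zero. *)
Lemma int_last_deriv0 Q q L : 0 < L -> mu3.-integrable setT (EFin \o q) ->
  (forall p, continuous (fun s => q (p, s))) ->
  (forall z, ~ box L z -> q z = 0) -> (forall z, ~ box L z -> Q z = 0) ->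
  (forall (p : R * R) (s : R), is_derive s 1 (fun s => Q (p, s)) (q (p, s))) ->
  \int[mu3]_z q z = 0.
Proof.
move=> L0 iq cq q0 Q0 dQ; rewrite /Rintegral.
suff inner0 (p : R * R) : (\int[leb]_s (q (p, s))%:E)%E = 0.
  have := @integral12_prod_meas1 _ _ _ _ R leb2 leb _ iq.
  by rewrite /fubini_F/= => <-; rewrite integral0_eq.
have L1 : - (L + 1) < L + 1 by lra.
have [nb1 nb2] : ~ box L (p, L + 1) /\ ~ box L (p, - (L + 1)).
  by split => -[_ /=]; rewrite in_itv/= => /andP[]; lra.
have sub (s : R) : s \in `[- L, L] -> s \in `[- (L + 1), L + 1].
  by rewrite !in_itv/= => /andP[h1 h2]; apply/andP; split; lra.
pose I : set R := `[- (L + 1), L + 1]%classic.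
rewrite (_ : (\int[leb]_y (q (p, y))%:E)%E =
  (\int[leb]_(y in I) (q (p, y))%:E)%E); last first.
  rewrite [RHS]integral_mkcond; apply: eq_integral => s _.
  rewrite patchE; case: ifPn => //; rewrite notin_setE /= => ns.
  by rewrite q0// => -[_ /=] h; apply: ns; exact: sub.
have cQ (s : R) : {for s, continuous (fun s => Q (p, s))}.
  by apply: differentiable_continuous; apply/derivable1_diffP; have [] := dQ p s.
rewrite (@continuous_FTC2 _ _ (fun s => Q (p, s)))//.
- by rewrite !Q0// subee.
- exact: continuous_subspaceT.
- split.
  + by move=> s _; have [] := dQ p s.
  + by apply: cvg_at_right_filter; exact: cQ.
  + by apply: cvg_at_left_filter; exact: cQ.
- by move=> s _; rewrite derive1E; have [_ ->] := dQ p s.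
Qed.

End Integration.

(** * Regular functions on a time slab *)

Section Slab.
Context {R : realType}.
Local Notation V := 'rV[R]_3.
Implicit Types (b t : R) (f g : R -> V -> R).

(** Reduces a directional derivative to a derivative on the real line. *)
Lemma is_derive_line (W : normedModType R) (f : W -> R) x v df :
  is_derive x v f df <-> is_derive (0 : R) 1 (fun h : R => f (h *: v + x)) df.
Proof.
have e : (fun h : R => h^-1 *: ((f \o shift x) (h *: v) - f x)) =
  (fun h : R => h^-1 *: (((fun h : R => f (h *: v + x)) \o shift 0) (h *: 1)
     - f (0 *: v + x))).
  by apply/funext => h /=; rewrite scale0r add0r addr0 [h *: 1]mulr1.
by split => -[]; rewrite /derivable /derive ?e => d1 d2; split;
  rewrite /derivable /derive ?e// -?e.
Qed.

Lemma is_derive_comp_line (W : normedModType R) (g : R -> R) (f : W -> R) x v dg df :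
  is_derive x v f df -> is_derive (f x) 1 g dg ->
  is_derive x v (fun y => g (f y)) (dg * df).
Proof.
move=> /is_derive_line hf hg; apply/is_derive_line.
apply: (@is_derive1_comp R g (fun h : R => f (h *: v + x))).
by rewrite scale0r add0r.
Qed.

Lemma max0_continuous : continuous (fun s : R => Num.max 0 s).
Proof.
by move=> s; apply: (@continuous_max _ _ (cst 0) id s); [exact: cvg_cst|exact: cvg_id].
Qed.

(** C^1 on the open slab 0 < t < b with explicit derivatives [ft] and [fx], and
    continuous up to t = 0.  The latter is continuity of [f] with the time clipped
    at 0, a statement at interior points of a larger slab, so that no one-sided
    limits appear later. *)
Record reg b f (ft : R -> V -> R) (fx : 'I_3 -> R -> V -> R) : Prop := {
  reg_c : forall t x, t < b ->
    {for (t, x), continuous (fun z : R * V => f (Num.max 0 z.1) z.2)} ;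
  reg_t : forall t x, 0 < t < b -> is_derive t 1 (f ^~ x) (ft t x) ;
  reg_x : forall j t x, 0 < t < b -> is_derive x (delta_mx 0 j) (f t) (fx j t x) ;
  reg_ct : forall t x, 0 < t < b ->
    {for (t, x), continuous (fun z : R * V => ft z.1 z.2)} ;
  reg_cx : forall j t x, 0 < t < b ->
    {for (t, x), continuous (fun z : R * V => fx j z.1 z.2)} }.

Lemma near_max0 t (x : V) : 0 < t -> \forall z \near (t, x), Num.max 0 z.1 = z.1.
Proof.
move=> t0.
have h : \forall s \near t, 0 < s by exact: lt_nbhsr.
have : \forall z \near (t, x), 0 < z.1.
  exact: (cvg_fst (F := nbhs t) (G := nbhs x) h).
by apply: filterS => z /ltW /max_r.
Qed.

Lemma reg_cc b f ft fx t x : reg b f ft fx -> 0 < t < b ->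
  {for (t, x), continuous (fun z : R * V => f z.1 z.2)}.
Proof.
move=> rf /andP[t0 tb]; have := reg_c rf (x:=x) tb.
rewrite /prop_for /continuous_at /= max_r ?ltW// => h.
apply: cvg_trans h; apply: near_eq_cvg.
have := near_max0 x t0.
by apply: filterS => z ->.
Qed.

Lemma reg_cst b c : reg b (fun _ _ => c) (fun _ _ => 0) (fun _ _ _ => 0).
Proof.
split=> *; by [exact: cvg_cst|exact: is_derive_cst].
Qed.

Lemma reg_time b : reg b (fun t _ => t) (fun _ _ => 1) (fun _ _ _ => 0).
Proof.
split; try by move=> *; exact: cvg_cst.
- move=> t x _; apply: (@cvg_comp _ _ _ fst (fun s : R => Num.max 0 s) _ (nbhs t)).
    exact: cvg_fst.
  exact: max0_continuous.
- by move=> t x _; exact: is_derive_id.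
- by move=> j t x _; exact: is_derive_cst.
Qed.

Lemma reg_coord b i : reg b (fun _ x => x 0 i) (fun _ _ => 0)
  (fun j _ _ => (i == j)%:R).
Proof.
split.
- move=> t x _; apply: (@cvg_comp _ _ _ snd (fun x : V => x 0 i) _ (nbhs x)).
    exact: cvg_snd.
  exact: coord_continuous.
- by move=> *; exact: is_derive_cst.
- move=> j t x _; apply/is_derive_line.
  have -> : (fun h : R => (h *: delta_mx 0 j + x) 0 i) = (fun h : R => h * (i == j)%:R + x 0 i).
    by apply/funext => h; rewrite !mxE eqxx.
  apply: is_derive_eq.
  by rewrite scaler0 /GRing.scale /= mulr1 addr0 add0r.
- by move=> *; exact: cvg_cst.
- by move=> *; exact: cvg_cst.
Qed.

Lemma reg_add b f ft fx g gt gx : reg b f ft fx -> reg b g gt gx ->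
  reg b (fun t x => f t x + g t x) (fun t x => ft t x + gt t x)
    (fun j t x => fx j t x + gx j t x).
Proof.
move=> hf hg; split.
- by move=> t x tb; apply: cvgD; [exact: (reg_c hf)|exact: (reg_c hg)].
- by move=> t x tb; apply: is_deriveD; [exact: (reg_t hf)|exact: (reg_t hg)].
- by move=> j t x tb; apply: is_deriveD; [exact: (reg_x hf)|exact: (reg_x hg)].
- by move=> t x tb; apply: cvgD; [exact: (reg_ct hf)|exact: (reg_ct hg)].
- by move=> j t x tb; apply: cvgD; [exact: (reg_cx hf)|exact: (reg_cx hg)].
Qed.

Lemma reg_mul b f ft fx g gt gx : reg b f ft fx -> reg b g gt gx ->
  reg b (fun t x => f t x * g t x) (fun t x => ft t x * g t x + f t x * gt t x)
    (fun j t x => fx j t x * g t x + f t x * gx j t x).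
Proof.
move=> hf hg; split.
- by move=> t x tb; apply: cvgM; [exact: (reg_c hf)|exact: (reg_c hg)].
- move=> t x tb; have hf1 := reg_t hf x tb; have hg1 := reg_t hg x tb.
  have h := is_deriveM hf1 hg1.
  by rewrite addrC [X in _ + X]mulrC; exact: h.
- move=> j t x tb; have hf1 := reg_x hf j x tb; have hg1 := reg_x hg j x tb.
  have h := is_deriveM hf1 hg1.
  by rewrite addrC [X in _ + X]mulrC; exact: h.
- move=> t x tb; apply: cvgD; apply: cvgM.
  + exact: (reg_ct hf).
  + exact: (reg_cc hg).
  + exact: (reg_cc hf).
  + exact: (reg_ct hg).
- move=> j t x tb; apply: cvgD; apply: cvgM.
  + exact: (reg_cx hf).
  + exact: (reg_cc hg).
  + exact: (reg_cc hf).
  + exact: (reg_cx hg).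
Qed.

Lemma reg_comp b f ft fx (phi dphi : R -> R) : reg b f ft fx ->
  (forall p : R, is_derive p 1 phi (dphi p)) -> continuous dphi ->
  reg b (fun t x => phi (f t x)) (fun t x => dphi (f t x) * ft t x)
    (fun j t x => dphi (f t x) * fx j t x).
Proof.
move=> hf dp cdp.
have cp (p : R) : {for p, continuous phi}.
  by apply: differentiable_continuous; apply/derivable1_diffP; have [] := dp p.
split.
- move=> t x tb.
  apply: (@cvg_comp _ _ _ (fun z : R * V => f (Num.max 0 z.1) z.2) phi _
    (nbhs (f (Num.max 0 t) x))); [exact: (reg_c hf)|exact: cp].
- by move=> t x tb; apply: (is_derive_comp_line (reg_t hf x tb)).
- by move=> j t x tb; apply: (is_derive_comp_line (reg_x hf j x tb)).
- move=> t x tb; apply: cvgM; last exact: (reg_ct hf).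
  apply: (@cvg_comp _ _ _ (fun z : R * V => f z.1 z.2) dphi _
    (nbhs (f t x))); [exact: (reg_cc hf)|exact: cdp].
- move=> j t x tb; apply: cvgM; last exact: (reg_cx hf).
  apply: (@cvg_comp _ _ _ (fun z : R * V => f z.1 z.2) dphi _
    (nbhs (f t x))); [exact: (reg_cc hf)|exact: cdp].
Qed.

(** Clipping the time maps a full neighbourhood into the slab, so continuity within
    the slab becomes continuity. *)
Lemma classical_regular_reg b (T : \bar R) f : 0 < b -> (b%:E <= T)%E ->
  classical_regular T f -> reg b f (dt f) (fun j => dx j f).
Proof.
move=> b0 bT [cf hdt hdx].
have lt t : t < b -> (t%:E < T)%E by move=> tb; apply: lt_le_trans bT; rewrite lte_fin.
split.
- move=> t x tb.
  pose A := [set z : R * V | 0 <= z.1 /\ (z.1%:E < T)%E].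
  pose clip := fun z : R * V => (Num.max 0 z.1, z.2).
  have Aclip z : z.1 < b -> A (clip z).
    move=> zb; split; first by rewrite /clip /= le_max lexx.
    by apply: lt; rewrite /clip /= gt_max b0.
  have cclip : clip z @[z --> (t, x)] --> clip (t, x).
    have c1 : Num.max 0 z.1 @[z --> (t, x)] --> Num.max 0 t.
      apply: (@cvg_comp _ _ _ fst (fun s : R => Num.max 0 s) _ (nbhs t)).
        exact: cvg_fst.
      exact: max0_continuous.
    exact: (cvg_pair c1 cvg_snd).
  have /subspace_continuousP/(_ (clip (t, x)) (Aclip (t, x) tb)) := cf.
  move=> h P /h hP.
  have hb : \forall z \near (t, x), z.1 < b.
    exact: (cvg_fst (F := nbhs t) (G := nbhs x) (lt_nbhsl tb)).
  have := cclip _ hP.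
  by apply: filterS2 hb => z zb /=; apply; exact: Aclip.
- move=> t x /andP[t0 tb]; have [h _] := hdt t x t0 (lt _ tb).
  by split=> //; rewrite -derive1E.
- move=> j t x /andP[t0 tb]; have [h _] := hdx j t x t0 (lt _ tb).
  by split.
- by move=> t x /andP[t0 tb]; have [_ h] := hdt t x t0 (lt _ tb).
- by move=> j t x /andP[t0 tb]; have [_ h] := hdx j t x t0 (lt _ tb).
Qed.

End Slab.

(** * Integrals of derivatives over space *)

Section Divergence.
Context {R : realType}.
Local Notation leb := (@lebesgue_measure R).
Local Notation mu3 := ((leb \x leb) \x leb)%E.
Local Notation V := 'rV[R]_3.
Implicit Types (b t L : R) (f g q Q : V -> R).

Definition r3 (z : R * R * R) : V := row3 z.1.1 z.1.2 z.2.

Lemma row3E (x y z : R) : row3 x y z =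
  x *: delta_mx 0 ord0 + y *: delta_mx 0 (lift ord0 ord0) + z *: delta_mx 0 ord_max.
Proof.
apply/rowP => i; rewrite !mxE /=.
case: i => -[|[|[|]]]//= _; rewrite -?val_eqE/= ?mulr1 ?mulr0 ?addr0 ?add0r//.
Qed.

Lemma row30 (x y z : R) : (row3 x y z) 0 ord0 = x.
Proof. by rewrite mxE. Qed.

Lemma row31 (x y z : R) : (row3 x y z) 0 (lift ord0 ord0) = y.
Proof. by rewrite mxE. Qed.

Lemma row32 (x y z : R) : (row3 x y z) 0 ord_max = z.
Proof. by rewrite mxE. Qed.

Lemma continuous_r3 : continuous r3.
Proof.
move=> z; have -> : r3 = (fun z : R * R * R => z.1.1 *: delta_mx 0 ord0 +
  z.1.2 *: delta_mx 0 (lift ord0 ord0) + z.2 *: (delta_mx 0 ord_max : V)).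
  by apply/funext => y; rewrite /r3 row3E.
have c1 : (fun z : R * R * R => z.1) z @[z --> z] --> z.1 by exact: cvg_fst.
apply: cvgD; [apply: cvgD|]; apply: cvgZl.
- by apply: (@cvg_comp _ _ _ _ (@fst R R) _ _ _ c1); exact: cvg_fst.
- by apply: (@cvg_comp _ _ _ _ (@snd R R) _ _ _ c1); exact: cvg_snd.
- exact: cvg_snd.
Qed.

(** Vanishing outside a cube; the sup norm fits integration in coordinates. *)
Definition vanish L f := forall (x : V) i, L < `|x 0 i| -> f x = 0.

Lemma continuous_swap01 : continuous (@swap01 R).
Proof.
move=> z; have c1 : (fun z : R * R * R => z.1) z @[z --> z] --> z.1 by exact: cvg_fst.
have c11 : (fun z : R * R * R => z.1.1) z @[z --> z] --> z.1.1.
  by apply: (@cvg_comp _ _ _ _ (@fst R R) _ _ _ c1); exact: cvg_fst.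
have c12 : (fun z : R * R * R => z.1.2) z @[z --> z] --> z.1.2.
  by apply: (@cvg_comp _ _ _ _ (@snd R R) _ _ _ c1); exact: cvg_snd.
exact: (cvg_pair (cvg_pair c12 c11) cvg_snd).
Qed.

Lemma continuous_swap12 : continuous (@swap12 R).
Proof.
move=> z; have c1 : (fun z : R * R * R => z.1) z @[z --> z] --> z.1 by exact: cvg_fst.
have c11 : (fun z : R * R * R => z.1.1) z @[z --> z] --> z.1.1.
  by apply: (@cvg_comp _ _ _ _ (@fst R R) _ _ _ c1); exact: cvg_fst.
have c12 : (fun z : R * R * R => z.1.2) z @[z --> z] --> z.1.2.
  by apply: (@cvg_comp _ _ _ _ (@snd R R) _ _ _ c1); exact: cvg_snd.
exact: (cvg_pair (cvg_pair c11 cvg_snd) c12).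
Qed.

Lemma vanish_box L f z : vanish L f -> ~ box L z -> f (r3 z) = 0.
Proof.
move=> vf nb; apply: contrapT => fz; apply: nb.
have h i : `|r3 z 0 i| <= L by rewrite leNgt; apply/negP => /vf.
move: (h ord0) (h (lift ord0 ord0)) (h ord_max).
rewrite /r3 row30 row31 row32 !ler_norml => h0 h1 h2.
by split; [split|]; rewrite /= in_itv.
Qed.

Lemma continuous_comp_r3 f : continuous f -> continuous (fun z => f (r3 z)).
Proof.
by move=> cf z; apply: (@cvg_comp _ _ _ r3 f _ (nbhs (r3 z))); [exact: continuous_r3|exact: cf].
Qed.

Lemma int_R3_integrable f L : continuous f -> vanish L f ->
  mu3.-integrable setT (EFin \o (f \o r3)).
Proof.
move=> cf vf; apply: (@integrable_cont_box _ _ L).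
  exact: continuous_comp_r3.
by move=> z /(vanish_box vf).
Qed.

(** A permutation of the coordinates brings the direction of differentiation
    to the last place, where the one-dimensional argument applies. *)
Lemma int_R3_deriv0 (j : 'I_3) Q q L : 0 < L -> continuous q ->
  vanish L Q -> vanish L q ->
  (forall x, is_derive x (delta_mx 0 j) Q (q x)) -> int_R3 q = 0.
Proof.
move=> L0 cq vQ vq dQ.
have mq : measurable_fun setT (fun z : R * R * R => (q (r3 z))%:E).
  by apply/measurable_EFinP; apply: continuous_measurable3; exact: continuous_comp_r3.
have boxswap01 z : ~ box L z -> ~ box L (swap01 z).
  by move=> nb [[h1 h2] h3]; apply: nb; split.
have boxswap12 z : ~ box L z -> ~ box L (swap12 z).
  by move=> nb [[h1 h2] h3]; apply: nb; split; first split.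
have line (p : R -> R * R * R) (s : R) :
    (forall h, r3 (p (h + s)) = h *: delta_mx 0 j + r3 (p s)) ->
    is_derive s 1 (fun s => Q (r3 (p s))) (q (r3 (p s))).
  move=> e; apply/is_derive_line.
  have := dQ (r3 (p s)); move/is_derive_line; congr (is_derive _ _ _ _).
  by apply/funext => h; rewrite -e [h *: 1]mulr1.
(* [sg] permutes the coordinates so that the last one becomes coordinate [j] *)
have [sg [csg bsg isg lsg]] : exists sg : R * R * R -> R * R * R,
  [/\ continuous sg, forall z, ~ box L z -> ~ box L (sg z),
    (\int[mu3]_z (q (r3 (sg z)))%:E = \int[mu3]_z (q (r3 z))%:E)%E &
    forall p s h, r3 (sg (p, h + s)) = h *: delta_mx 0 j + r3 (sg (p, s))].
  have mq12 : measurable_fun setT (fun z => (q (r3 (swap01 z)))%:E).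
    exact: (measurableT_comp mq (@measurable_swap01 R)).
  have delta h a1 a2 a3 b1 b2 b3 : a1 = h * (0 == j :> nat)%:R + b1 ->
      a2 = h * (1 == j :> nat)%:R + b2 -> a3 = h * (2 == j :> nat)%:R + b3 ->
      row3 a1 a2 a3 = h *: delta_mx 0 j + row3 b1 b2 b3.
    move=> -> -> ->; apply/rowP => i; rewrite !mxE.
    by rewrite -(inj_eq val_inj); case: i => -[|[|[|]]].
  case: j delta {dQ line} => -[|[|[|//]]] /= j3 delta.
  - exists (swap01 \o swap12); split.
    + move=> z; apply: (@cvg_comp _ _ _ (@swap12 R) (@swap01 R) _ (nbhs (swap12 z))).
        exact: continuous_swap12.
      exact: continuous_swap01.
    + by move=> z /boxswap12 /boxswap01.
    + by rewrite -(integral_swap01 mq) -(integral_swap12 mq12).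
    + by move=> p s h; apply: (delta h (h + s) p.1 p.2 s p.1 p.2); rewrite ?mulr1 ?mulr0 ?add0r.
  - exists swap12; split => //.
    + exact: continuous_swap12.
    + exact: integral_swap12.
    + by move=> p s h; apply: (delta h p.1 (h + s) p.2 p.1 s p.2); rewrite ?mulr1 ?mulr0 ?add0r.
  - exists id; split => //; first by move=> z; exact: cvg_id.
    by move=> p s h; apply: (delta h p.1 p.2 (h + s) p.1 p.2 s); rewrite ?mulr1 ?mulr0 ?add0r.
have cqs : continuous (fun z => q (r3 (sg z))).
  move=> z; apply: (@cvg_comp _ _ _ sg (q \o r3) _ (nbhs (sg z))); first exact: csg.
  exact: continuous_comp_r3.
have bqs z : ~ box L z -> q (r3 (sg z)) = 0 by move=> /bsg; exact: vanish_box.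
rewrite /int_R3 /Rintegral -[X in fine X]isg.
apply: (@int_last_deriv0 _ (fun z => Q (r3 (sg z))) _ L) => //.
- exact: integrable_cont_box bqs.
- move=> p s; apply: (@cvg_comp _ _ _ (fun s => (p, s)) (fun z => q (r3 (sg z))) _ (nbhs (p, s))).
    exact: (cvg_pair (cvg_cst p) cvg_id).
  exact: cqs.
- by move=> z /bsg; exact: vanish_box.
- by move=> p s; apply: (line (fun s => sg (p, s))) => h; rewrite lsg.
Qed.

End Divergence.

(** * Conservation laws in integrated form *)

Section ConservationLaw.
Context {R : realType}.
Local Notation leb := (@lebesgue_measure R).
Local Notation mu3 := ((leb \x leb) \x leb)%E.
Local Notation V := 'rV[R]_3.
Implicit Types (b t L : R) (f g q : R -> V -> R).

Lemma pair_cvgr (U W : topologicalType) (t : U) (x : W) : (t, y) @[y --> x] --> (t, x).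
Proof. exact: (cvg_pair (cvg_cst t) cvg_id). Qed.

Lemma pair_cvgl (U W : topologicalType) (t : U) (x : W) : (s, x) @[s --> t] --> (t, x).
Proof. exact: (cvg_pair cvg_id (cvg_cst x)). Qed.

Lemma continuous_slice (W : topologicalType) (f : R -> V -> W) t x :
  {for (t, x), continuous (fun z : R * V => f z.1 z.2)} -> {for x, continuous (f t)}.
Proof.
move=> h.
apply: (@cvg_comp _ _ _ (fun y => (t, y)) (fun z : R * V => f z.1 z.2) _ (nbhs (t, x))).
  exact: pair_cvgr.
exact: h.
Qed.

Lemma continuous_slice_time (W : topologicalType) (f : R -> V -> W) t x :
  {for (t, x), continuous (fun z : R * V => f z.1 z.2)} -> {for t, continuous (f ^~ x)}.
Proof.
move=> h.
apply: (@cvg_comp _ _ _ (fun s => (s, x)) (fun z : R * V => f z.1 z.2) _ (nbhs (t, x))).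
  exact: pair_cvgl.
exact: h.
Qed.

Lemma slab_bounded (f : R * V -> R) u v L :
  (forall s x, u <= s <= v -> {for (s, x), continuous f}) ->
  exists2 M, 0 <= M & forall s z, u <= s <= v -> box L z -> `|f (s, r3 z)| <= M.
Proof.
move=> cf; pose K : set (R * (R * R * R)) := `[u, v] `*` box L.
have cK : compact K by apply: compact_setX; [exact: segment_compact|exact: compact_box].
have cF : {within K, continuous (fun y : R * (R * R * R) => f (y.1, r3 y.2))}.
  apply: continuous_in_subspaceT => -[s z]; rewrite inE => -[/= h _].
  apply: (@cvg_comp _ _ _ (fun y : R * (R * R * R) => (y.1, r3 y.2)) f _ (nbhs (s, r3 z))).
    have c2 : (fun y : R * (R * R * R) => r3 y.2) y @[y --> (s, z)] --> r3 z.
      by apply: (@cvg_comp _ _ _ snd r3 _ (nbhs z)); [exact: cvg_snd|exact: continuous_r3].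
    exact: (cvg_pair cvg_fst c2).
  by apply: cf; move: h; rewrite in_itv.
have /compact_bounded[M [_ hM]] := continuous_compact cF cK.
exists (`|M| + 1); first by rewrite addr_ge0.
move=> s z sI zL; apply: (hM (`|M| + 1)); first by rewrite ltr_pwDr// ler_norm.
by exists (s, z) => //; split => //=; rewrite in_itv.
Qed.

Lemma vanish_time_deriv g gt b L t : (forall s, 0 < s < b -> vanish L (g s)) ->
  0 < t < b -> (forall x, is_derive t 1 (g ^~ x) (gt t x)) -> vanish L (gt t).
Proof.
move=> v0 tb dg x i xL.
have h0 : is_derive t 1 (g ^~ x) 0.
  apply: (near_eq_is_derive _ (is_derive_cst (0 : R) t 1)).
  have tI : t \in `]0, b[ by rewrite in_itv.
  near=> s; apply/esym/(v0 s _ x i xL).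
  by near: s; have := near_in_itvoo tI; apply: filterS => s; rewrite in_itv.
by have [_ <-] := dg x; have [_ ->] := h0.
Unshelve. all: end_near. Qed.

Lemma vanish_space_deriv (Q q : V -> R) L j : vanish L Q ->
  (forall x, is_derive x (delta_mx 0 j) Q (q x)) -> vanish L q.
Proof.
move=> vQ dq x i xL.
have h0 : is_derive x (delta_mx 0 j) Q 0.
  apply: (near_eq_is_derive _ (is_derive_cst (0 : R) x (delta_mx 0 j))).
  have cx : {for x, continuous (fun y : V => `|y 0 i|)}.
    apply: (@cvg_comp _ _ _ (fun y : V => y 0 i) Num.norm _ (nbhs (x 0 i))).
      exact: coord_continuous.
    exact: norm_continuous.
  have hn : \forall y \near x, L < `|(y : V) 0 i| by exact: (cx _ (lt_nbhsr xL)).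
  by near=> y; apply/esym/(vQ y i); near: y; exact: hn.
by have [_ <-] := dq x; have [_ ->] := h0.
Unshelve. all: end_near. Qed.

(** On a compact time interval around [t] the time derivative is bounded by a
    constant on the cube and zero outside, which gives the domination needed to
    differentiate under the integral sign. *)
Lemma int_R3_time_deriv b L t g gt gx : reg b g gt gx ->
  (forall s, 0 < s < b -> vanish L (g s)) -> 0 < t < b ->
  is_derive t 1 (fun s => int_R3 (g s)) (int_R3 (gt t)).
Proof.
move=> rg vg tb; have /andP[t0 tb'] := tb.
pose u := t / 2; pose v := (t + b) / 2.
have uvb s : u <= s <= v -> 0 < s < b.
  by rewrite /u /v => /andP[h1 h2]; apply/andP; split; lra.
have utv : t \in `]u, v[ by rewrite in_itv /u /v /=; apply/andP; split; lra.
have [M M0 hM] : exists2 M, 0 <= M & forall s z, u <= s <= v -> box L z -> `|gt s (r3 z)| <= M.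
  apply: (@slab_bounded (fun z => gt z.1 z.2)) => s x /uvb sb; exact: (reg_ct rg).
pose F := fun (s : R) (z : R * R * R) => g s (r3 z).
pose G := fun z : R * R * R => M * \1_(box L) z.
have dF s z : 0 < s < b -> is_derive s 1 (F ^~ z) (gt s (r3 z)).
  by move=> sb; exact: (reg_t rg).
have intF s : (`]u, v[)%classic s -> mu3.-integrable setT (EFin \o F s).
  rewrite /= in_itv/= => /andP[h1 h2].
  have sb : 0 < s < b by apply: uvb; rewrite !ltW.
  apply: (@int_R3_integrable _ _ L); last exact: vg.
  by move=> x; apply: continuous_slice; exact: (reg_cc rg).
have dF' s z : (`]u, v[)%classic s -> setT z -> derivable (F ^~ z) s 1.
  rewrite /= in_itv/= => /andP[h1 h2] _.
  by have [] := dF s z _; first by apply: uvb; rewrite !ltW.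
have G0 z : 0 <= G z by rewrite mulr_ge0.
have intG : mu3.-integrable setT (EFin \o G).
  apply: (@integrable_box _ _ L M).
  - apply: measurable_funM; first exact: measurable_cst.
    by apply: measurable_indic; exact: measurable_box.
  - move=> z; rewrite /G normrM ger0_norm// indicE; case: (_ \in _).
      by rewrite normr1 mulr1.
    by rewrite normr0 mulr0.
  - by move=> z nz; rewrite /G indicE memNset ?mulr0.
have G_ub s z : (`]u, v[)%classic s -> setT z -> `|partial1of2 F s z| <= G z.
  rewrite /= in_itv/= => /andP[h1 h2] _.
  have sI : u <= s <= v by rewrite !ltW.
  have sb := uvb _ sI.
  rewrite partial1of2E; have [_ ->] := dF s z sb.
  rewrite /G indicE; have [bz|nb] := pselect (box L z).
    by rewrite mem_set// mulr1; exact: hM.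
  rewrite memNset// mulr0 (@vanish_box _ L (gt s))// ?normr0//.
  by apply: (vanish_time_deriv vg sb) => x; exact: (reg_t rg).
have := @derivable_under_integral R _ _ mu3 F setT measurableT t u v utv intF dF' G G0 intG G_ub.
have := @differentiation_under_integral R _ _ mu3 F setT measurableT t u v utv intF dF' G G0 intG G_ub.
move=> e d; split; first exact: d.
rewrite -derive1E.
rewrite /int_R3 e; apply: eq_Rintegral => z _.
by rewrite partial1of2E; have [_ ->] := dF t z tb.
Qed.

(** Same domination as for the time derivative.  The clipped time gives
    continuity at t = 0 as well. *)
Lemma int_R3_continuous b L t g : 0 < b -> t < b ->
  (forall (s : R) (x : V), s < b -> {for (s, x), continuous (fun z : R * V => g (Num.max 0 z.1) z.2)}) ->
  (forall s, 0 <= s < b -> vanish L (g s)) ->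
  {for t, continuous (fun s : R => int_R3 (g (Num.max 0 s)))}.
Proof.
move=> b0 tb cg vg.
pose u := t - 1; pose v := (t + b) / 2.
have [ut tv vb] : [/\ u < t, t < v & v < b] by rewrite /u /v; split; lra.
have utv : t \in (`]u, v[)%classic by rewrite inE /= in_itv /= ut.
have [M M0 hM] : exists2 M, 0 <= M & forall s z, u <= s <= v -> box L z ->
    `|g (Num.max 0 s) (r3 z)| <= M.
  apply: (@slab_bounded (fun z => g (Num.max 0 z.1) z.2)) => s x /andP[_ sv].
  by apply: cg; exact: le_lt_trans vb.
have vg' s : s < v -> vanish L (g (Num.max 0 s)).
  by move=> sv; apply: vg; rewrite le_max lexx gt_max b0 (lt_trans sv).
pose F := fun (s : R) (z : R * R * R) => g (Num.max 0 s) (r3 z).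
pose G := fun z : R * R * R => M * \1_(box L) z.
have intF s : (`]u, v[)%classic s -> mu3.-integrable setT (EFin \o F s).
  rewrite /= in_itv/= => /andP[h1 h2].
  apply: (@int_R3_integrable _ (g (Num.max 0 s)) L); last exact: vg'.
  move=> x; apply: (@continuous_slice _ (fun s x => g (Num.max 0 s) x)).
  by apply: cg; exact: lt_trans vb.
have cF : {ae mu3, forall y, setT y -> {in (`]u, v[)%classic, continuous (F ^~ y)}}.
  apply: aeW => y _ s; rewrite inE /= in_itv/= => /andP[h1 h2].
  apply: (@continuous_slice_time _ (fun s x => g (Num.max 0 s) x)).
  by apply: cg; exact: lt_trans vb.
have intG : mu3.-integrable setT (EFin \o G).
  apply: (@integrable_box _ _ L M).
  - apply: measurable_funM; first exact: measurable_cst.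
    by apply: measurable_indic; exact: measurable_box.
  - move=> z; rewrite /G normrM ger0_norm// indicE; case: (_ \in _).
      by rewrite normr1 mulr1.
    by rewrite normr0 mulr0.
  - by move=> z nz; rewrite /G indicE memNset ?mulr0.
have G_ub s : (`]u, v[)%classic s -> {ae mu3, forall y, setT y -> `|F s y| <= G y}.
  rewrite /= in_itv/= => /andP[h1 h2]; apply: aeW => z _.
  rewrite /G indicE; have [bz|nb] := pselect (box L z).
    by rewrite mem_set// mulr1; apply: hM => //; rewrite !ltW.
  rewrite memNset// mulr0 /F (@vanish_box _ L (g (Num.max 0 s)))// ?normr0//.
  exact: vg'.
exact: (continuity_under_integral measurableT intF cF intG G_ub).
Qed.

(** The flux terms integrate to zero.  They are kept under the integral because
    the local conservation laws make the whole integrand simplify. *)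
Lemma conservation_law b L t g gt gx (q : 'I_3 -> R -> V -> R) qt qx :
  0 < L -> reg b g gt gx -> (forall j, reg b (q j) (qt j) (qx j)) ->
  (forall s, 0 < s < b -> vanish L (g s)) ->
  (forall j s, 0 < s < b -> vanish L (q j s)) -> 0 < t < b ->
  is_derive t 1 (fun s => int_R3 (g s))
    (int_R3 (fun x => gt t x + \sum_(j < 3) qx j j t x)).
Proof.
move=> L0 rg rq vg vq tb.
have cgt : continuous (gt t) by move=> x; apply: continuous_slice; exact: (reg_ct rg).
have cqx j : continuous (qx j j t).
  by move=> x; apply: continuous_slice; exact: (reg_cx (rq j)).
have vgt : vanish L (gt t).
  by apply: (vanish_time_deriv vg tb) => x; exact: (reg_t rg).
have dq j x : is_derive x (delta_mx 0 j) (q j t) (qx j j t x) by exact: (reg_x (rq j)).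
have vqx j : vanish L (qx j j t) by apply: (vanish_space_deriv (vq j t tb)) => x.
suff -> : int_R3 (fun x => gt t x + \sum_(j < 3) qx j j t x) = int_R3 (gt t).
  exact: (int_R3_time_deriv rg vg tb).
have i0 j : int_R3 (qx j j t) = 0.
  by apply: (@int_R3_deriv0 _ j (q j t) _ L) => //; exact: vq.
have iD (f1 f2 : V -> R) : continuous f1 -> continuous f2 -> vanish L f1 -> vanish L f2 ->
    int_R3 (fun x => f1 x + f2 x) = int_R3 f1 + int_R3 f2.
  move=> c1 c2 v1 v2; rewrite /int_R3 RintegralD//.
  - exact: (int_R3_integrable c1 v1).
  - exact: (int_R3_integrable c2 v2).
have e : (fun x => gt t x + \sum_(j < 3) qx j j t x) =
  (fun x => (gt t x + qx ord0 ord0 t x) + qx (lift ord0 ord0) (lift ord0 ord0) t x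
     + qx ord_max ord_max t x).
  apply/funext => x; rewrite big_ord_recr /= big_ord_recr /= big_ord_recr /= big_ord0 add0r !addrA.
  by congr (_ + _ + _ + _); congr (qx _ _ t x); apply/val_inj.
have vD (f1 f2 : V -> R) : vanish L f1 -> vanish L f2 -> vanish L (fun x => f1 x + f2 x).
  by move=> v1 v2 x i xi; rewrite (v1 x i xi) (v2 x i xi) addr0.
have contD (f1 f2 : V -> R) : continuous f1 -> continuous f2 -> continuous (fun x => f1 x + f2 x).
  by move=> c1 c2 x; exact: (continuousD (c1 x) (c2 x)).
have c1 := contD _ _ cgt (cqx ord0); have v1 := vD _ _ vgt (vqx ord0).
have c2 := contD _ _ c1 (cqx (lift ord0 ord0)).
have v2 := vD _ _ v1 (vqx (lift ord0 ord0)).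
rewrite e (iD _ _ c2 (cqx _) v2 (vqx _)) (iD _ _ c1 (cqx _) v1 (vqx _)).
by rewrite (iD _ _ cgt (cqx _) vgt (vqx _)) !i0 !addr0.
Qed.

End ConservationLaw.

(** * Consequences of continuity on compact sets *)

Section Positivity.
Context {R : realType}.
Local Notation leb := (@lebesgue_measure R).
Local Notation mu2 := (leb \x leb)%E.
Local Notation mu3 := ((leb \x leb) \x leb)%E.
Local Notation V := 'rV[R]_3.
Implicit Types (b t L : R) (f g : V -> R).

Lemma r3_surj (x : V) : exists z, x = r3 z.
Proof.
exists (x 0 ord0, x 0 (lift ord0 ord0), x 0 ord_max).
apply/rowP => i; rewrite /r3 !mxE /=.
by case: i => -[|[|[|//]]] /= h; congr (x _ _); apply: val_inj.
Qed.

(** A continuous function that is positive at a point exceeds a positive constant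
    on a cuboid of positive volume. *)
Lemma int_R3_eq0 f L : continuous f -> vanish L f -> (forall x, 0 <= f x) ->
  int_R3 f = 0 -> forall x, f x = 0.
Proof.
move=> cf vf f0 if0 x; apply: contrapT => /eqP fx; move: if0; apply/eqP.
rewrite gt_eqF//.
have [z0 xz] := r3_surj x.
have fx0 : 0 < f (r3 z0) by rewrite -xz lt_neqAle eq_sym fx f0.
pose eta := f (r3 z0) / 2.
have eta0 : 0 < eta by rewrite divr_gt0.
have cfr := @continuous_comp_r3 R f cf.
have hn : nbhs z0 [set z | eta < f (r3 z)].
  by apply: (cfr z0 [set y | eta < y]); apply: lt_nbhsr; rewrite /eta; lra.
move/nbhs_ballP : hn => [r /= r0 hr].
pose s := r / 2; have s0 : 0 < s by rewrite divr_gt0.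
pose B : set (R * R * R) :=
  `[z0.1.1, z0.1.1 + s] `*` `[z0.1.2, z0.1.2 + s] `*` `[z0.2, z0.2 + s].
have mB : measurable B by do 2 (apply: measurableX; last exact: measurable_itv); exact: measurable_itv.
have muB : mu3 B = (s * s * s)%:E by apply: cuboid_measure; exact: ltW.
have bB z : B z -> eta < f (r3 z).
  move=> [[h1 h2] h3]; apply: hr.
  have h (a y : R) : y \in `[a, a + s] -> `|a - y| < r.
    rewrite in_itv/= => /andP[ay ya]; rewrite ltr_norml; apply/andP; split; rewrite /s in s0 ya; lra.
  by split; [split|]; exact: h.
pose G := fun z => eta * \1_B z.
have i1 : (\int[mu3]_z (\1_B z)%:E)%E = (s * s * s)%:E.
  by rewrite integral_indic// setIT; exact: muB.
have iG : mu3.-integrable setT (EFin \o G).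
  apply/integrableP; split.
    apply/measurable_EFinP; apply: measurable_funM; first exact: measurable_cst.
    exact: measurable_indic.
  rewrite (_ : (\int[mu3]_z _)%E = (\int[mu3]_z (eta%:E * (\1_B z)%:E))%E).
    rewrite ge0_integralZl//; last by rewrite lee_fin ltW.
      by rewrite i1 -EFinM ltry.
    by apply/measurable_EFinP; exact: measurable_indic.
  by apply: eq_integral => z _; rewrite /= ger0_norm ?EFinM// mulr_ge0 ?(ltW eta0)// indicE ler0n.
have h1 : 0 < \int[mu3]_z G z.
  rewrite /G /Rintegral.
  under eq_integral do rewrite EFinM.
  rewrite ge0_integralZl//; last by rewrite lee_fin ltW.
    by rewrite i1 -EFinM /= !mulr_gt0.
  by apply/measurable_EFinP; exact: measurable_indic.
apply: (lt_le_trans h1).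
apply: le_Rintegral => //; first exact: (int_R3_integrable cf vf).
move=> z _; rewrite /G indicE; have [bz|nb] := pselect (B z).
  by rewrite mem_set// mulr1 ltW//; exact: bB.
by rewrite memNset// mulr0.
Qed.

(** Uniform continuity in time on a compact set of space-time points, by a finite
    covering argument; the step [eta] does not depend on the point. *)
Lemma equicontinuous_time (f : R * V -> R) b t1 L dl : t1 < b -> 0 < dl ->
  (forall s x, s < b -> {for (s, x), continuous f}) ->
  exists2 eta, 0 < eta & forall s h z, 0 <= s <= t1 -> 0 <= h < eta -> box L z ->
    `|f (s + h, r3 z) - f (s, r3 z)| <= dl.
Proof.
move=> t1b dl0 cf.
pose K : set (R * (R * R * R)) := `[0, t1] `*` box L.
have cK : compact K by apply: compact_setX; [exact: segment_compact|exact: compact_box].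
have [] := (compact_near_coveringP K).1 cK _ (nbhs (0 : R))
  (fun h y => `|f (y.1 + h, r3 y.2) - f (y.1, r3 y.2)| <= dl) _.
  move=> [s z] [/= sI zL].
  have sb : s < b by move: sI; rewrite in_itv/= => /andP[_ /le_lt_trans]; apply.
  pose D := fun p : (R * (R * R * R)) * R =>
     `|f (p.1.1 + p.2, r3 p.1.2) - f (p.1.1, r3 p.1.2)|.
  have c1 : (fun p : (R * (R * R * R)) * R => p.1.1) @ nbhs ((s, z), 0 : R) --> s.
    apply: (@cvg_comp _ _ _ fst fst _ (nbhs (s, z))); exact: cvg_fst.
  have c2 : (fun p : (R * (R * R * R)) * R => r3 p.1.2) @ nbhs ((s, z), 0 : R) --> r3 z.
    apply: (@cvg_comp _ _ _ (fun p : (R * (R * R * R)) * R => p.1.2) r3 _ (nbhs z)); last exact: continuous_r3.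
    by apply: (@cvg_comp _ _ _ fst snd _ (nbhs (s, z))); [exact: cvg_fst|exact: cvg_snd].
  have c3 : (fun p : (R * (R * R * R)) * R => p.1.1 + p.2) @ nbhs ((s, z), 0 : R) --> s + 0.
    by apply: cvgD; [exact: c1|exact: cvg_snd].
  rewrite addr0 in c3.
  have cD : {for ((s, z), 0), continuous D}.
    apply: cvg_norm; rewrite /= addr0; apply: cvgB.
      apply: (@cvg_comp _ _ _ (fun p : (R * (R * R * R)) * R => (p.1.1 + p.2, r3 p.1.2)) f _ (nbhs (s, r3 z))).
        exact: (cvg_pair c3 c2).
      exact: cf.
    apply: (@cvg_comp _ _ _ (fun p : (R * (R * R * R)) * R => (p.1.1, r3 p.1.2)) f _ (nbhs (s, r3 z))).
      exact: (cvg_pair c1 c2).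
    exact: cf.
  have : nbhs ((s, z), 0 : R) [set p | D p < dl].
    apply: (cD [set y | y < dl]); apply: lt_nbhsl.
    by rewrite /D /= addr0 subrr normr0.
  by apply: filterS => p /ltW.
move=> e /= e0 he; exists e => // s h z sI /andP[h0 he'] zL.
apply: (he h _ (s, z)); first by rewrite /= sub0r normrN ger0_norm.
by split => //=; rewrite in_itv.
Qed.

End Positivity.

(** * The relative energy and the cone weight *)

Section Flow.
Context {R : realType}.
Local Notation V := 'rV[R]_3.
Local Notation i0 := (ord0 : 'I_3).
Local Notation i1 := (lift ord0 ord0 : 'I_3).
Local Notation i2 := (ord_max : 'I_3).
Implicit Types (b t c : R) (rho rt : R -> V -> R) (rx : 'I_3 -> R -> V -> R)
  (U Ut : 'I_3 -> R -> V -> R) (Ux : 'I_3 -> 'I_3 -> R -> V -> R).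

Lemma sum3E (W : zmodType) (F : 'I_3 -> W) : \sum_(i < 3) F i = F i0 + F i1 + F i2.
Proof.
rewrite big_ord_recr /= big_ord_recr /= big_ord_recr /= big_ord0 add0r.
by congr (_ + _ + _); congr (F _); apply/val_inj.
Qed.

Lemma ord3P (j : 'I_3) : [\/ j = i0, j = i1 | j = i2].
Proof.
by case: j => -[|[|[|//]]] jl; [constructor 1|constructor 2|constructor 3]; exact/val_inj.
Qed.

(** The Euler system with the derivatives of all products expanded, so that the
    equations become polynomial identities in the values of the unknowns and their
    derivatives.  For p = rho^2/2 the pressure gradient is rho times the gradient of
    rho. *)
Record flow b rho rt rx U Ut Ux : Prop := {
  flow_rho : reg b rho rt rx ;
  flow_U : forall i, reg b (U i) (Ut i) (Ux i) ;
  flow_pos : forall t x, 0 <= t < b -> 0 < rho t x ;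
  flow_mass : forall t x, 0 < t < b ->
    rt t x + \sum_(j < 3) (rx j t x * U j t x + rho t x * Ux j j t x) = 0 ;
  flow_mom : forall i t x, 0 < t < b ->
    (rt t x * U i t x + rho t x * Ut i t x) +
    \sum_(j < 3) ((rx j t x * U i t x + rho t x * Ux i j t x) * U j t x +
       rho t x * U i t x * Ux j j t x) + rho t x * rx i t x = 0 }.

Definition ksq U t x := U i0 t x * U i0 t x + U i1 t x * U i1 t x + U i2 t x * U i2 t x.

(** Kinetic energy plus p(rho) - p(1) - p'(1) (rho - 1): the energy relative to
    the state at rest, which is quadratic near that state. *)
Definition energy rho U t x : R :=
  2^-1 * (rho t x * ksq U t x) + 2^-1 * ((rho t x + -1) * (rho t x + -1)).

Definition eflux rho U (j : 'I_3) t x : R :=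
  U j t x * (2^-1 * (rho t x * ksq U t x) + rho t x * (rho t x + -1)).

(** The momentum equations multiplied by the velocity, plus the mass equation
    multiplied by rho - 1 - |u|^2/2. *)
Lemma energy_law b rho rt rx U Ut Ux : flow b rho rt rx U Ut Ux ->
  exists et ex Qt Qx, [/\ reg b (energy rho U) et ex,
    forall j, reg b (eflux rho U j) (Qt j) (Qx j) &
    forall t x, 0 < t < b -> et t x + \sum_(j < 3) Qx j j t x = 0].
Proof.
move=> F.
have hr := flow_rho F; have hU := flow_U F.
have hk := reg_add (reg_add (reg_mul (hU i0) (hU i0)) (reg_mul (hU i1) (hU i1)))
  (reg_mul (hU i2) (hU i2)).
have hkin := reg_mul (reg_cst b (2^-1)) (reg_mul hr hk).
have hn := reg_add hr (reg_cst b (-1)).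
have he := reg_add hkin (reg_mul (reg_cst b (2^-1)) (reg_mul hn hn)).
have hQ j := reg_mul (hU j) (reg_add hkin (reg_mul hr hn)).
do 4 eexists; split; first exact: he.
  by move=> j; exact: (hQ j).
move=> t x tb /=.
have := flow_mass F x tb; have := flow_mom F i0 x tb; have := flow_mom F i1 x tb.
have := flow_mom F i2 x tb.
rewrite !sum3E => m2 m1 m0 ms.
have lin (a0 a1 a2 a3 M0 M1 M2 M3 : R) : M0 = 0 -> M1 = 0 -> M2 = 0 -> M3 = 0 ->
  a0 * M0 + a1 * M1 + a2 * M2 + a3 * M3 = 0.
  by move=> -> -> -> ->; rewrite !mulr0 !addr0.
apply: etrans (lin (U i0 t x) (U i1 t x) (U i2 t x)
  (rho t x - 1 - 2^-1 * ksq U t x) _ _ _ _ m0 m1 m2 ms).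
by rewrite /ksq; field.
Qed.

(** The square of the positive part, which is of class C^1 where the positive part
    itself is not. *)
Definition sqpos (p : R) : R := Num.max 0 p * Num.max 0 p.

(** The Taylor remainder is at most h^2 on either side of the origin. *)
Lemma is_derive_sqpos (p : R) : is_derive p 1 sqpos (2 * Num.max 0 p).
Proof.
have key (h : R) : `|sqpos (h + p) - sqpos p - 2 * Num.max 0 p * h| <= h ^+ 2.
  rewrite /sqpos; case: (leP 0 (h + p)) => hp; case: (leP 0 p) => p0;
    rewrite ler_norml; apply/andP; split; nra.
have cv : (fun h => h^-1 *: ((sqpos \o shift p) (h *: (1 : R)) - sqpos p)) @ 0^' --> 2 * Num.max 0 p.
  apply/cvgrPdist_le => e e0.
  near=> h.
  have h0 : h != 0 by near: h; exact: nbhs_dnbhs_neq.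
  have -> : 2 * Num.max 0 p - h^-1 *: ((sqpos \o shift p) (h *: 1) - sqpos p) =
    - (h^-1 * (sqpos (h + p) - sqpos p - 2 * Num.max 0 p * h)).
    rewrite /= [h *: 1]mulr1 /GRing.scale /=; field; exact: h0.
  rewrite normrN normrM normfV ler_pdivrMl ?normr_gt0//.
  apply: (le_trans (key h)).
  rewrite -[h ^+ 2]ger0_norm ?sqr_ge0// normrX expr2 ler_pM2l ?normr_gt0//.
  near: h; apply: (dnbhs0_le e0).
split; last by apply/cvg_lim.
by apply/cvg_ex; exists (2 * Num.max 0 p).
Unshelve. all: end_near. Qed.

(** Positive exactly inside the light cone of slope [c] with apex ([t1], [y]); the
    part t < t1 is the backward cone on which the energy is tested. *)
Definition cone c t1 (y : V) t (x : V) : R :=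
  c * c * ((t1 + -1 * t) * (t1 + -1 * t)) +
  -1 * ((x 0 i0 + - y 0 i0) * (x 0 i0 + - y 0 i0) +
        (x 0 i1 + - y 0 i1) * (x 0 i1 + - y 0 i1) +
        (x 0 i2 + - y 0 i2) * (x 0 i2 + - y 0 i2)).

(** Both derivatives carry the factor max 0 (cone), so that the sign of the
    energy balance is decided by the remaining factors inside the cone. *)
Lemma cone_weight b c t1 y : exists Wt Wx,
  [/\ reg b (fun t x => sqpos (cone c t1 y t x)) Wt Wx,
    forall t x, Wt t x = - (4 * (c * c) * (t1 - t)) * Num.max 0 (cone c t1 y t x) &
    forall j t x, Wx j t x = - (4 * (x 0 j - y 0 j)) * Num.max 0 (cone c t1 y t x)].
Proof.
have ht := reg_add (reg_cst b t1) (reg_mul (reg_cst b (-1)) (reg_time b)).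
have hx i := reg_add (reg_coord b i) (reg_cst b (- y 0 i)).
have hs := reg_add (reg_add (reg_mul (hx i0) (hx i0)) (reg_mul (hx i1) (hx i1)))
  (reg_mul (hx i2) (hx i2)).
have hc := reg_add (reg_mul (reg_cst b (c * c)) (reg_mul ht ht))
  (reg_mul (reg_cst b (-1)) hs).
have cd : continuous (fun p : R => 2 * Num.max 0 p).
  move=> p; apply: cvgM; first exact: cvg_cst.
  exact: max0_continuous.
have := reg_comp hc is_derive_sqpos cd => h.
do 2 eexists; split; first exact: h.
  by move=> t x /=; rewrite -/(cone c t1 y t x); ring.
move=> j t x /=; rewrite -/(cone c t1 y t x).
by case: (ord3P j) => ->; rewrite -!val_eqE /=; ring.
Qed.

End Flow.

(** * Monotonicity and the bound on the energy flux *)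

Section FinitePropagation.
Context {R : realType}.
Local Notation V := 'rV[R]_3.
Local Notation i0 := (ord0 : 'I_3).
Local Notation i1 := (lift ord0 ord0 : 'I_3).
Local Notation i2 := (ord_max : 'I_3).
Implicit Types (b t c : R) (rho rt : R -> V -> R) (rx : 'I_3 -> R -> V -> R)
  (U Ut : 'I_3 -> R -> V -> R) (Ux : 'I_3 -> 'I_3 -> R -> V -> R).

Lemma int_R3_le0 (f : V -> R) : (forall x, f x <= 0) -> int_R3 f <= 0.
Proof.
move=> f0; rewrite /int_R3 /Rintegral fine_le0//.
rewrite integralE integral0_eq; last first.
  by move=> z _; rewrite funeposE; apply/max_idPr; rewrite lee_fin.
by rewrite sub0e oppe_le0; apply: integral_ge0 => z _; exact: funeneg_ge0.
Qed.

(** The clipped time changes nothing near a positive time, and makes the same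
    function continuous at t = 0. *)
Lemma conservation_law_max b L t g gt gx (q : 'I_3 -> R -> V -> R) qt qx :
  0 < L -> reg b g gt gx -> (forall j, reg b (q j) (qt j) (qx j)) ->
  (forall s, 0 < s < b -> vanish L (g s)) ->
  (forall j s, 0 < s < b -> vanish L (q j s)) -> 0 < t < b ->
  is_derive t 1 (fun s : R => int_R3 (g (Num.max 0 s)))
    (int_R3 (fun x => gt t x + \sum_(j < 3) qx j j t x)).
Proof.
move=> L0 rg rq vg vq tb; have /andP[t0 _] := tb.
have h := conservation_law L0 rg rq vg vq tb.
apply: near_eq_is_derive h.
have : \forall s \near t, 0 < s by exact: lt_nbhsr.
by apply: filterS => s /ltW s0; rewrite max_r.
Qed.

Lemma derive_ge0_le (f df : R -> R) (a c : R) : a <= c ->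
  (forall s, a <= s <= c -> {for s, continuous f}) ->
  (forall s, a < s < c -> is_derive s 1 f (df s)) ->
  (forall s, a < s < c -> 0 <= df s) -> f a <= f c.
Proof.
move=> ac cf dfs df0.
apply: (@ger0_derive1_le_cc _ f a c) => //.
- by move=> s; rewrite in_itv/= => /dfs[].
- by move=> s; rewrite in_itv/= => sI; have [_ e] := dfs s sI; rewrite derive1E e df0.
- by apply: continuous_in_subspaceT => s; rewrite inE/= in_itv/=; exact: cf.
- by rewrite in_itv/= lexx.
- by rewrite in_itv/= lexx andbT.
Qed.

(** Lagrange's identity. *)
Lemma cauchy3 (p0 p1 p2 q0 q1 q2 A B : R) : 0 <= A -> 0 <= B ->
  p0 * p0 + p1 * p1 + p2 * p2 <= A * A -> q0 * q0 + q1 * q1 + q2 * q2 <= B * B ->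
  `|p0 * q0 + p1 * q1 + p2 * q2| <= A * B.
Proof.
move=> A0 B0 hp hq; have AB0 : 0 <= A * B by rewrite mulr_ge0.
rewrite -(ger0_norm AB0) -ler_sqr ?nnegrE// !real_normK ?num_real//.
have sq (x : R) : 0 <= x * x by rewrite -expr2 sqr_ge0.
have h1 : (p0 * p0 + p1 * p1 + p2 * p2) * (q0 * q0 + q1 * q1 + q2 * q2) <= (A * A) * (B * B).
  by apply: ler_pM => //; rewrite !addr_ge0.
have e1 := sq (p0 * q1 - p1 * q0); have e2 := sq (p0 * q2 - p2 * q0).
have e3 := sq (p1 * q2 - p2 * q1).
by rewrite !expr2; lra.
Qed.

(** With z = x - y and tau = t1 - t this compares the outward energy flux with
    c^2 tau times the energy.  Near rest, rho is at most 1 + dl and |u| at most 2 dl;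
    the leading term rho |u| |rho - 1| of the flux is at most rho times half of
    |u|^2 + (rho - 1)^2, that is, the energy up to a factor 1 + O(dl).  This is where
    the sound speed 1 of the state at rest enters. *)
Lemma flux_bound (rho u0 u1 u2 z0 z1 z2 dl c tau k B : R) :
  k = u0 * u0 + u1 * u1 + u2 * u2 ->
  B = 2^-1 * (rho * k) + rho * (rho - 1) ->
  0 < rho -> `|rho - 1| <= dl -> `|u0| <= dl -> `|u1| <= dl -> `|u2| <= dl ->
  1 + 4 * dl <= c -> 0 <= tau ->
  z0 * z0 + z1 * z1 + z2 * z2 <= (c * tau) * (c * tau) ->
  - (z0 * u0 + z1 * u1 + z2 * u2) * B <=
  (c * tau) * (c * (2^-1 * (rho * k) + 2^-1 * ((rho - 1) * (rho - 1)))).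
Proof.
move=> kE BE r0 hn h0 h1 h2 hc t0 hz.
have dl0 : 0 <= dl by apply: le_trans h0.
have sq (x : R) : 0 <= x * x by rewrite -expr2 sqr_ge0.
have k0 : 0 <= k by rewrite kE !addr_ge0.
pose s := Num.sqrt k.
have s0 : 0 <= s by exact: sqrtr_ge0.
have ss : s * s = k by rewrite -expr2 sqr_sqrtr.
have ct0 : 0 <= c * tau by rewrite mulr_ge0//; lra.
have hzu : `|z0 * u0 + z1 * u1 + z2 * u2| <= c * tau * s by apply: cauchy3 => //; rewrite ss kE.
have hu (v : R) : `|v| <= dl -> v * v <= dl * dl.
  by move=> hv; rewrite -[v * v]ger0_norm ?sq// normrM ler_pM.
have s2 : s <= 2 * dl.
  rewrite -ler_sqr ?nnegrE//; last by lra.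
  by rewrite !expr2 ss kE; have := hu _ h0; have := hu _ h1; have := hu _ h2; have := sq dl; lra.
have hB : s * `|B| <= c * (2^-1 * (rho * k) + 2^-1 * ((rho - 1) * (rho - 1))).
  have hB1 : `|B| <= 2^-1 * (rho * k) + rho * `|rho - 1|.
    rewrite BE; apply: (le_trans (ler_normD _ _)); rewrite (normrM rho) (gtr0_norm r0).
    have x0 : 0 <= 2^-1 * (rho * k) by rewrite !mulr_ge0// ?invr_ge0 ?ler0n// ltW.
    by rewrite (ger0_norm x0).
  set n := `|rho - 1| in hB1 hn *.
  have n0 : 0 <= n by rewrite normr_ge0.
  have -> : (rho - 1) * (rho - 1) = n * n by rewrite -normrM ger0_norm// sq.
  have rk0 : 0 <= rho * k by rewrite mulr_ge0// ltW.
  apply: (le_trans (ler_wpM2l s0 hB1)).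
  have a1 : s * (rho * k) <= 2 * dl * (rho * k) by rewrite ler_wpM2r.
  have a2 : rho * (2 * (s * n)) <= rho * (k + n * n).
    apply: ler_wpM2l; first exact: ltW.
    by rewrite -ss; have := sq (s - n); lra.
  have a3 : rho * (n * n) <= (1 + dl) * (n * n).
    by rewrite ler_wpM2r//; move: hn; rewrite /n ler_norml => /andP[]; lra.
  have a4 : (1 + 4 * dl) * (rho * k) <= c * (rho * k) by rewrite ler_wpM2r.
  have a5 : (1 + 4 * dl) * (n * n) <= c * (n * n) by rewrite ler_wpM2r.
  have a6 : 0 <= dl * (rho * k) by rewrite mulr_ge0.
  have a7 : 0 <= dl * (n * n) by rewrite mulr_ge0.
  by nra.
apply: (le_trans (ler_norm _)); rewrite normrM normrN.
apply: (@le_trans _ _ (c * tau * s * `|B|)); first by rewrite ler_wpM2r.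
by rewrite -mulrA ler_wpM2l.
Qed.

End FinitePropagation.

(** * Decrease of the energy on a cone *)

Section Cone.
Context {R : realType}.
Local Notation V := 'rV[R]_3.
Local Notation i0 := (ord0 : 'I_3).
Local Notation i1 := (lift ord0 ord0 : 'I_3).
Local Notation i2 := (ord_max : 'I_3).
Variables (b : R) (rho rt : R -> V -> R) (rx : 'I_3 -> R -> V -> R)
  (U Ut : 'I_3 -> R -> V -> R) (Ux : 'I_3 -> 'I_3 -> R -> V -> R).
Hypothesis F : flow b rho rt rx U Ut Ux.

Definition at_rest t x := rho t x = 1 /\ forall j, U j t x = 0.

Lemma cone_anti (c t1 : R) (y : V) s s' x : s <= s' -> s' <= t1 ->
  cone c t1 y s' x <= cone c t1 y s x.
Proof.
move=> ss st; rewrite /cone lerD2r; apply: ler_wpM2l; first by rewrite -expr2 sqr_ge0.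
by apply: ler_pM; lra.
Qed.

Lemma cone_vanish (c t1 : R) (y : V) s (x : V) L i : 0 <= c -> 0 <= s < b -> 0 < t1 < b ->
  L = c * b + `|y 0 i0| + `|y 0 i1| + `|y 0 i2| -> L < `|x 0 i| ->
  cone c t1 y s x <= 0.
Proof.
move=> c0 /andP[s0 sb] /andP[t0 tb] -> xi.
have sq (z : R) : 0 <= z * z by rewrite -expr2 sqr_ge0.
have yi j : `|y 0 j| <= `|y 0 i0| + `|y 0 i1| + `|y 0 i2|.
  have h (k : 'I_3) : 0 <= `|y 0 k| by rewrite normr_ge0.
  by have := h i0; have := h i1; have := h i2; case: (ord3P j) => ->; lra.
have d : c * b <= `|x 0 i - y 0 i|.
  by have := lerB_dist (x 0 i) (y 0 i); have := yi i; lra.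
have d2 : (c * b) * (c * b) <= (x 0 i - y 0 i) * (x 0 i - y 0 i).
  have cb0 : 0 <= c * b by rewrite mulr_ge0// ltW// (lt_trans t0).
  by rewrite -[leRHS]ger0_norm ?sq// normrM; exact: ler_pM.
have d3 : (x 0 i - y 0 i) * (x 0 i - y 0 i) <= 
    (x 0 i0 + - y 0 i0) * (x 0 i0 + - y 0 i0) +
        (x 0 i1 + - y 0 i1) * (x 0 i1 + - y 0 i1) +
        (x 0 i2 + - y 0 i2) * (x 0 i2 + - y 0 i2).
  have h0 := sq (x 0 i0 + - y 0 i0); have h1 := sq (x 0 i1 + - y 0 i1).
  have h2 := sq (x 0 i2 + - y 0 i2).
  by case: (ord3P i) => ->; lra.
have d4 : (t1 + -1 * s) * (t1 + -1 * s) <= b * b.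
  rewrite -[leLHS]ger0_norm ?sq// normrM.
  by apply: ler_pM => //; rewrite ler_norml; apply/andP; split; lra.
have d5 : c * c * ((t1 + -1 * s) * (t1 + -1 * s)) <= c * c * (b * b).
  by apply: ler_wpM2l.
by rewrite /cone; lra.
Qed.

Lemma energy_ge0 t x : 0 <= t < b -> 0 <= energy rho U t x.
Proof.
move=> tb; have r0 := flow_pos F x tb.
have sq (z : R) : 0 <= z * z by rewrite -expr2 sqr_ge0.
rewrite /energy addr_ge0// mulr_ge0// mulr_ge0// ?(ltW r0)//.
by rewrite /ksq !addr_ge0.
Qed.

Lemma energy_eq0 t x : 0 <= t < b -> energy rho U t x = 0 -> at_rest t x.
Proof.
move=> tb; have r0 := flow_pos F x tb.
have sq (z : R) : 0 <= z * z by rewrite -expr2 sqr_ge0.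
have h0 := sq (U i0 t x); have h1 := sq (U i1 t x); have h2 := sq (U i2 t x).
have k0 : 0 <= ksq U t x by rewrite /ksq !addr_ge0.
have rk : 0 <= rho t x * ksq U t x by rewrite mulr_ge0// ltW.
have n0 := sq (rho t x + -1).
rewrite /energy => e0.
have /eqP : (rho t x + -1) * (rho t x + -1) = 0 by lra.
rewrite mulf_eq0 orbb => /eqP nE.
have /eqP : rho t x * ksq U t x = 0 by lra.
rewrite mulf_eq0 gt_eqF//= => /eqP kE.
have z (v : R) : v * v = 0 -> v = 0 by move/eqP; rewrite mulf_eq0 orbb => /eqP.
split; first by lra.
move=> j; apply: z.
by move: kE; rewrite /ksq; case: (ord3P j) => ->; lra.
Qed.

(** The energy weighted by the squared positive part of [cone] is zero at time s0
    and cannot increase as long as the solution is close to rest in the cone; being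
    nonnegative it is zero at time s, and the energy vanishes only at rest. *)
Lemma cone_step (c dl t1 s0 s : R) (y : V) : 0 <= dl -> 1 + 4 * dl <= c -> 0 < t1 < b ->
  0 <= s0 -> s0 <= s -> s < t1 ->
  (forall t x, s0 <= t <= s -> 0 < cone c t1 y t x ->
    `|rho t x - 1| <= dl /\ forall j, `|U j t x| <= dl) ->
  (forall x, 0 < cone c t1 y s0 x -> at_rest s0 x) ->
  forall x, 0 < cone c t1 y s x -> at_rest s x.
Proof.
move=> dl0 cdl t1b s00 s0s st1 small Z0.
have [t10 t1b'] : 0 < t1 /\ t1 < b by apply/andP.
have c0 : 0 < c by lra.
have [Wt [Wx [hW WtE WxE]]] := cone_weight b c t1 y.
have [et [ex [Qt [Qx [he hQ law]]]]] := energy_law F.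
have hg := reg_mul hW he; have hq j := reg_mul hW (hQ j).
set W := (fun t x => sqpos _) in hW hg hq.
set g := (fun t x => W t x * energy rho U t x) in hg.
pose L := c * b + `|y 0 i0| + `|y 0 i1| + `|y 0 i2|.
have L0 : 0 < L by rewrite /L !ltr_wpDr// mulr_gt0//; lra.
have vW t : 0 <= t < b -> vanish L (W t).
  move=> tb x i xi; have := cone_vanish (ltW c0) tb t1b erefl xi.
  by rewrite /W /sqpos => /max_idPl ->; rewrite mul0r.
have vg t : 0 <= t < b -> vanish L (g t).
  by move=> tb x i xi; rewrite /g (vW t tb x i xi) mul0r.
pose E (t : R) := int_R3 (g (Num.max 0 t)).
have cE t : t < b -> {for t, continuous E}.
  by move=> tb; apply: (int_R3_continuous _ tb (reg_c hg) vg); exact: lt_trans t1b'.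
have sb : s < b by exact: lt_trans t1b'.
have E0 : E s0 = 0.
  have -> : 0 = int_R3 (fun _ : V => 0) :> R.
    by rewrite /int_R3 /Rintegral integral0_eq.
  rewrite /E max_r//; congr int_R3; apply/funext => x; rewrite /g /W.
  have [P0|P0] := leP (cone c t1 y s0 x) 0.
    by rewrite /sqpos (max_idPl P0) mul0r mul0r.
  have [rE uE] := Z0 x P0.
  by rewrite /energy /ksq rE !uE; ring.
have Es : E s <= 0.
  rewrite -E0 -lerN2.
  pose dE := fun t => - int_R3 (fun x => (Wt t x * energy rho U t x + W t x * et t x) +
    \sum_(j < 3) (Wx j t x * eflux rho U j t x + W t x * Qx j j t x)).
  apply: (@derive_ge0_le _ (fun t => - E t) dE s0 s s0s).
  - move=> t /andP[_ ts]; apply: continuousN; apply: cE; exact: le_lt_trans ts sb.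
  - move=> t /andP[s0t ts].
    have tb : 0 < t < b by apply/andP; split; lra.
    apply: is_deriveN.
    apply: (conservation_law_max L0 hg hq _ _ tb).
      by move=> r /andP[/ltW r0 rb]; apply: vg; rewrite r0.
    move=> j r /andP[/ltW r0 rb] x i xi.
    have rI : 0 <= r < b by rewrite r0.
    change (W r x * eflux rho U j r x = 0).
    by rewrite (vW r rI x i xi) mul0r.
  move=> t /andP[s0t ts].
  have tb : 0 < t < b by apply/andP; split; lra.
  have tb' : 0 <= t < b by apply/andP; split; lra.
  rewrite oppr_ge0; apply: int_R3_le0 => x.
  (* the terms carrying [W] itself cancel by the local energy law *)
  have -> : (Wt t x * energy rho U t x + W t x * et t x) +
    \sum_(j < 3) (Wx j t x * eflux rho U j t x + W t x * Qx j j t x) =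
    Wt t x * energy rho U t x + \sum_(j < 3) (Wx j t x * eflux rho U j t x).
    have := law t x tb; rewrite !sum3E => l.
    transitivity (Wt t x * energy rho U t x +
      (Wx i0 t x * eflux rho U i0 t x + Wx i1 t x * eflux rho U i1 t x +
       Wx i2 t x * eflux rho U i2 t x) + W t x * (et t x + (Qx i0 i0 t x + Qx i1 i1 t x + Qx i2 i2 t x))).
      by ring.
    by rewrite l mulr0 addr0.
  rewrite sum3E WtE !WxE.
  have [P0|P0] := leP (cone c t1 y t x) 0.
    by lra.
  have tI : s0 <= t <= s by rewrite !ltW.
  have [hn hU] := small t x tI P0.
  have r0 := flow_pos F x tb'.
  have hz : (x 0 i0 - y 0 i0) * (x 0 i0 - y 0 i0) + (x 0 i1 - y 0 i1) * (x 0 i1 - y 0 i1) +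
     (x 0 i2 - y 0 i2) * (x 0 i2 - y 0 i2) <= (c * (t1 - t)) * (c * (t1 - t)).
    by move: P0; rewrite /cone; lra.
  have tau0 : 0 <= t1 - t by lra.
  have fb := @flux_bound R (rho t x) (U i0 t x) (U i1 t x) (U i2 t x) _ _ _ dl c (t1 - t)
    _ _ erefl erefl r0 hn (hU _) (hU _) (hU _) cdl tau0 hz.
  have P4 : 0 <= 4 * cone c t1 y t x by rewrite mulr_ge0// ltW.
  rewrite -subr_ge0 in fb; have := mulr_ge0 P4 fb.
  rewrite /energy /eflux /ksq; lra.
have W0 t x : 0 <= W t x by rewrite /W /sqpos -expr2 sqr_ge0.
have sb' : 0 <= s < b by rewrite sb (le_trans s00).
have gs0 x : 0 <= g s x by rewrite /g mulr_ge0//; exact: energy_ge0.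
have s0' : 0 <= s by exact: le_trans s0s.
have cgs : continuous (g s).
  move=> x; have := @continuous_slice R _ (fun t x => g (Num.max 0 t) x) s x (reg_c hg sb).
  by rewrite max_r.
have gE : forall x, g s x = 0.
  apply: (int_R3_eq0 cgs (vg s sb') gs0).
  apply/eqP; rewrite eq_le; apply/andP; split.
    by move: Es; rewrite /E max_r.
  by apply: Rintegral_ge0 => z _; exact: gs0.
move=> x P0; apply: energy_eq0 => //.
have /eqP := gE x; rewrite /g mulf_eq0 => /orP[/eqP|/eqP//].
rewrite /W /sqpos (_ : Num.max _ _ = cone c t1 y s x); last by apply/max_idPr; exact: ltW.
by move/eqP; rewrite mulf_eq0 orbb gt_eqF.
Qed.

End Cone.

(** * Finite speed of propagation *)

Section FiniteSpeed.
Context {R : realType}.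
Local Notation V := 'rV[R]_3.
Local Notation i0 := (ord0 : 'I_3).
Local Notation i1 := (lift ord0 ord0 : 'I_3).
Local Notation i2 := (ord_max : 'I_3).
Variables (b : R) (rho rt : R -> V -> R) (rx : 'I_3 -> R -> V -> R)
  (U Ut : 'I_3 -> R -> V -> R) (Ux : 'I_3 -> 'I_3 -> R -> V -> R).
Hypothesis F : flow b rho rt rx U Ut Ux.
Local Notation rest := (at_rest rho U).

Definition sqn (x : V) : R := x 0 i0 * x 0 i0 + x 0 i1 * x 0 i1 + x 0 i2 * x 0 i2.

(** Closeness to rest on a time step follows from rest at its beginning, as the
    sections of the cone shrink and the solution moves by at most [dl] during a step
    of uniform length [e].  Induction on the number of steps. *)
Lemma at_rest_cone (c t1 : R) (y : V) : 1 < c -> 0 < t1 < b ->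
  (forall x, 0 < cone c t1 y 0 x -> rest 0 x) ->
  forall s x, 0 <= s < t1 -> 0 < cone c t1 y s x -> rest s x.
Proof.
move=> c1 t1b Z0; have [t10 t1b'] : 0 < t1 /\ t1 < b by apply/andP.
pose dl := (c - 1) / 4; have dl0 : 0 < dl by rewrite /dl; lra.
have cdl : 1 + 4 * dl <= c by rewrite /dl; lra.
pose L := c * b + `|y 0 i0| + `|y 0 i1| + `|y 0 i2|.
have eq (f ft : R -> V -> R) fx : reg b f ft fx -> exists2 eta, 0 < eta &
    forall s h z, 0 <= s <= t1 -> 0 <= h < eta -> box L z ->
    `|f (s + h) (r3 z) - f s (r3 z)| <= dl.
  move=> rf; have [eta e0 he] := equicontinuous_time L t1b' dl0 (@reg_c _ _ _ _ _ rf).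
  exists eta => // s h z sI hI zL; have := he s h z sI hI zL.
  have /andP[s0 _] := sI; have /andP[h0 _] := hI.
  by rewrite /= !max_r// addr_ge0.
have [er er0 hr] := eq _ _ _ (flow_rho F).
have [e0 e00 h0] := eq _ _ _ (flow_U F i0).
have [e1 e10 h1] := eq _ _ _ (flow_U F i1).
have [e2 e20 h2] := eq _ _ _ (flow_U F i2).
(* half of the smallest modulus keeps the bounds [h < eta] strict *)
pose e := Num.min (Num.min er e0) (Num.min e1 e2) / 2.
have [ee er' e0' e1' e2'] : [/\ 0 < e, e < er, e < e0, e < e1 & e < e2].
  set m := Num.min _ _ in e *.
  have m0 : 0 < m by rewrite /m !lt_min er0 e00 e10 e20.
  have em : e < m by rewrite /e; lra.
  have : e < m by []. rewrite {1}/m !lt_min => /andP[/andP[-> ->] /andP[-> ->]].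
  by split => //; rewrite /e divr_gt0.
suff step (n : nat) : forall s x, 0 <= s < t1 -> s <= n%:R * e -> 0 < cone c t1 y s x -> rest s x.
  move=> s x sI; apply: (step (Num.truncn (s / e)).+1) => //.
  by rewrite -ler_pdivrMr//; exact/ltW/truncnS_gt.
elim: n => [|n ih] s x sI.
  have /andP[s0 st] := sI.
  rewrite mul0r => s0'; have -> : s = 0 by lra.
  exact: Z0.
rewrite -natr1 mulrDl mul1r => sn.
have /andP[s0 st] := sI.
pose s' := Num.max 0 (s - e).
have [s'0 s's s'e] : [/\ 0 <= s', s' <= s & s - s' <= e].
  by rewrite /s'; clear -ee s0; case: (leP 0 (s - e)) => h; split; lra.
have Zs' x' : 0 < cone c t1 y s' x' -> rest s' x'.
  apply: ih; first by rewrite s'0 (le_lt_trans s's).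
  have ne : 0 <= n%:R * e by rewrite mulr_ge0// ltW.
  by rewrite /s'; clear -ne sn; case: (leP 0 (s - e)) => h; lra.
apply: (cone_step F (ltW dl0) cdl t1b s'0 s's st _ Zs').
move=> t x' /andP[s't ts] P0.
have tI : 0 <= t < b by rewrite (le_trans s'0)// (le_lt_trans ts)// (lt_trans st).
have [z xz] := r3_surj x'.
have zL : box L z.
  apply: contrapT => nb.
  suff : cone c t1 y t x' <= 0 by rewrite leNgt P0.
  have c0 : 0 <= c by lra.
  have [i xi] : exists i, L < `|x' 0 i|.
    apply: contrapT => ni; apply: nb.
    have h i : `|x' 0 i| <= L by rewrite leNgt; apply/negP => hi; apply: ni; exists i.
    move: (h i0) (h i1) (h i2); rewrite xz /r3 row30 row31 row32 !ler_norml => g0 g1 g2.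
    by split; [split|]; rewrite /= in_itv.
  exact: (cone_vanish c0 tI t1b erefl xi).
have P0' : 0 < cone c t1 y s' x'.
  apply: (lt_le_trans P0); apply: cone_anti => //; lra.
have [rE uE] := Zs' x' P0'.
have s'I : 0 <= s' <= t1 by rewrite s'0 (le_trans s's)// ltW.
have hI : 0 <= t - s' <= e by clear -s't ts s'e; apply/andP; split; lra.
have tE : s' + (t - s') = t by lra.
have small (f : R -> V -> R) eta : e < eta -> (forall s h z, 0 <= s <= t1 -> 0 <= h < eta -> box L z ->
    `|f (s + h) (r3 z) - f s (r3 z)| <= dl) -> `|f t x' - f s' x'| <= dl.
  move=> he /(_ s' (t - s') z s'I); rewrite tE -xz; apply => //.
  by have /andP[-> /le_lt_trans ->] := hI.
split; first by have := small rho er er' hr; rewrite rE.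
move=> j; have := small (U j).
rewrite uE subr0; case: (ord3P j) => -> sm.
- exact: (sm e0).
- exact: (sm e1).
- exact: (sm e2).
Qed.

(** A point at distance more than r0 + t from the origin leaves room for a cone
    of slope slightly above 1, with apex slightly later than t, whose base avoids
    the ball of radius r0. *)
Lemma finite_speed (r0 : R) : 0 < b -> 0 <= r0 ->
  (forall x, r0 * r0 < sqn x -> rest 0 x) ->
  forall t x, 0 <= t < b -> (r0 + t) * (r0 + t) < sqn x -> rest t x.
Proof.
move=> b0 r00 Z0 t x /andP[t0 tb] xt.
have sq (z : R) : 0 <= z * z by rewrite -expr2 sqr_ge0.
have q0 : 0 <= sqn x by rewrite /sqn !addr_ge0.
pose r := Num.sqrt (sqn x).
have rr : r * r = sqn x by rewrite -expr2 sqr_sqrtr.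
have rge0 : 0 <= r by exact: sqrtr_ge0.
have rlt : r0 + t < r.
  by rewrite -ltr_sqr ?nnegrE ?addr_ge0// !expr2 rr.
pose d := r - r0 - t; have d0 : 0 < d by rewrite /d; lra.
(* the apex is at time t + m; with c t1 = t1 + d/3 the base of the cone has
   radius less than |x| - r0 *)
pose m := Num.min (d / 3) ((b - t) / 2).
have [m0 md mb] : [/\ 0 < m, m <= d / 3 & m <= (b - t) / 2].
  by rewrite /m; clear -d0 tb; case: (leP (d / 3) ((b - t) / 2)) => h; split; lra.
pose t1 := t + m.
have t10 : 0 < t1 by rewrite /t1; lra.
have t1b : 0 < t1 < b by rewrite t10 /t1; lra.
pose c := 1 + d / (3 * t1).
have dt1 : 0 < d / (3 * t1) by rewrite divr_gt0// mulr_gt0.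
have c1 : 1 < c by rewrite /c; lra.
have ct : c * t1 = t1 + d / 3 by rewrite /c; field; rewrite gt_eqF.
apply: (@at_rest_cone c t1 x c1 t1b).
- move=> x' P0; apply: Z0; rewrite ltNge; apply/negP => hx'.
  have ct0 : 0 <= c * t1 by rewrite ct; lra.
  have hd : (x 0 i0 - x' 0 i0) * (x 0 i0 - x' 0 i0) + (x 0 i1 - x' 0 i1) * (x 0 i1 - x' 0 i1) +
     (x 0 i2 - x' 0 i2) * (x 0 i2 - x' 0 i2) <= (c * t1) * (c * t1).
    by move: P0; rewrite /cone; lra.
  have := cauchy3 r00 ct0 hx' hd; rewrite ler_norml => /andP[_ cs].
  have : sqn x <= (r0 + c * t1) * (r0 + c * t1).
    by move: hx' hd cs; rewrite /sqn; lra.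
  apply/negP; rewrite -ltNge -rr -!expr2 ltr_sqr ?nnegrE ?addr_ge0//.
  by rewrite ct /t1; rewrite /d in md *; lra.
- by rewrite t0 /t1; lra.
- rewrite /cone /t1.
  have -> : c * c * ((t + m + -1 * t) * (t + m + -1 * t)) + -1 *
    ((x 0 i0 + - x 0 i0) * (x 0 i0 + - x 0 i0) + (x 0 i1 + - x 0 i1) * (x 0 i1 + - x 0 i1) +
     (x 0 i2 + - x 0 i2) * (x 0 i2 + - x 0 i2)) = (c * m) * (c * m) by ring.
  by rewrite !mulr_gt0//; lra.
Qed.

End FiniteSpeed.

(** * The integral of a plane wave over a ball *)

Section BallBound.
Context {R : realType}.
Local Notation leb := (@lebesgue_measure R).
Local Notation mu2 := (leb \x leb)%E.
Local Notation mu3 := ((leb \x leb) \x leb)%E.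
Local Notation V := 'rV[R]_3.
Local Notation i0 := (ord0 : 'I_3).
Local Notation i1 := (lift ord0 ord0 : 'I_3).
Local Notation i2 := (ord_max : 'I_3).
Implicit Types (r a b s : R) (x w : V).

(** The Lorentzian: it decays fast enough to be integrable on the line and has an
    elementary primitive. *)
Definition lor s : R := (1 + s * s)^-1.

Lemma lor_den s : 0 < 1 + s * s.
Proof. by rewrite -expr2 ltr_pwDl// sqr_ge0. Qed.

Lemma lor_gt0 s : 0 < lor s.
Proof. by rewrite invr_gt0 lor_den. Qed.

Lemma continuous_lor : continuous lor.
Proof.
move=> s; apply: cvgV; first by rewrite gt_eqF// lor_den.
apply: cvgD; first exact: cvg_cst.
by apply: cvgM; exact: cvg_id.
Qed.

(** The truncation to [-r, r] lets integrals be computed on a compact interval;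
    the bounds do not depend on it. *)
Definition lorI r a b s : R := lor (a * s + b) * \1_(`[- r, r]%classic) s.

Lemma lorI_ge0 r a b s : 0 <= lorI r a b s.
Proof. by rewrite /lorI mulr_ge0 ?(ltW (lor_gt0 _))// indicE ler0n. Qed.

Lemma continuous_lor_affine a b : continuous (fun s => lor (a * s + b)).
Proof.
move=> s; apply: (@cvg_comp _ _ _ (fun s => a * s + b) lor _ (nbhs (a * s + b))).
  by apply: cvgD; [apply: cvgM; [exact: cvg_cst|exact: cvg_id]|exact: cvg_cst].
exact: continuous_lor.
Qed.

Lemma measurable_lorI r a b : measurable_fun setT (lorI r a b).
Proof.
apply: measurable_funM; first exact: continuous_measurable_fun (@continuous_lor_affine a b).
by apply: measurable_indic; exact: measurable_itv.
Qed.

(** The primitive is the arctangent divided by [a]. *)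
Lemma lorI_int r a b : 0 < r -> a != 0 ->
  exists2 J, 0 <= J <= pi / `|a| & (\int[leb]_s (lorI r a b s)%:E)%E = J%:E.
Proof.
move=> r0 a0; pose P s := a^-1 * atan (a * s + b).
have dP s : is_derive s 1 P (lor (a * s + b)).
  have da : is_derive s 1 (fun s => a * s + b) a.
    have h1 : is_derive s 1 (fun s => a * s) (a * 1).
      exact: (is_deriveZ a (is_derive_id s 1)).
    have := is_deriveD h1 (is_derive_cst b s 1).
    by rewrite mulr1 addr0.
  have dat := is_derive1_atan (a * s + b).
  have h := is_derive_comp_line da dat.
  have := is_deriveZ a^-1 h.
  congr (is_derive _ _ _ _).
  by rewrite /GRing.scale /= mulrCA mulVf// mulr1 /lor expr2.
have e : (\int[leb]_s (lorI r a b s)%:E)%E = (P r - P (- r))%:E.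
  pose I : set R := `[- r, r]%classic.
  rewrite (_ : (\int[leb]_s (lorI r a b s)%:E)%E =
    (\int[leb]_(s in I) (lor (a * s + b))%:E)%E); last first.
    rewrite [RHS]integral_mkcond; apply: eq_integral => s _.
    rewrite patchE /lorI indicE; case: ifPn => _; by rewrite ?mulr1 ?mulr0.
  have cP s : {for s, continuous P}.
    by apply: differentiable_continuous; apply/derivable1_diffP; have [] := dP s.
  rewrite (@continuous_FTC2 _ _ P) ?EFinB//.
  - lra.
  - exact: continuous_subspaceT (@continuous_lor_affine a b).
  - split.
    + by move=> s _; have [] := dP s.
    + by apply: cvg_at_right_filter; exact: cP.
    + by apply: cvg_at_left_filter; exact: cP.
  - by move=> s _; rewrite derive1E; have [_ ->] := dP s.
exists (P r - P (- r)) => //; apply/andP; split.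
  by rewrite -lee_fin -e; apply: integral_ge0 => s _; rewrite lee_fin lorI_ge0.
apply: (le_trans (ler_norm _)); rewrite /P -mulrBr normrM normfV mulrC.
rewrite ler_pM2r ?invr_gt0 ?normr_gt0//.
have := atan_gtNpi2 (a * r + b); have := atan_ltpi2 (a * r + b).
have := atan_gtNpi2 (a * - r + b); have := atan_ltpi2 (a * - r + b).
by move=> h1 h2 h3 h4; rewrite ler_norml; apply/andP; split; lra.
Qed.

(** The last factor may be centred at a point that depends on the first two
    variables, since the bound of its integral does not depend on the centre;
    integrating it first leaves a product. *)
Lemma lorI3_int (h : R * R * R -> R) (r D w2 a0 c0 a1 c1 : R) (m : R * R -> R) :
  0 < r -> 0 <= D -> a0 != 0 -> a1 != 0 -> w2 != 0 -> continuous m ->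
  measurable_fun setT h -> (forall z, 0 <= h z) ->
  (forall z, h z <= D * lorI r a0 c0 z.1.1 * lorI r a1 c1 z.1.2 * lorI r w2 (m z.1) z.2) ->
  (\int[mu3]_z (h z)%:E <=
   (D * (pi / `|a0|) * (pi / `|a1|) * (pi / `|w2|))%:E)%E.
Proof.
move=> r0 D0 a00 a10 w20 cm mh h0 hle.
pose f z : R := D * lorI r a0 c0 z.1.1 * lorI r a1 c1 z.1.2 * lorI r w2 (m z.1) z.2.
have m1 : measurable_fun setT (fun z : R * R * R => z.1.1).
  by apply: (measurableT_comp measurable_fst); exact: measurable_fst.
have m2 : measurable_fun setT (fun z : R * R * R => z.1.2).
  by apply: (measurableT_comp measurable_snd); exact: measurable_fst.
have mf : measurable_fun setT (fun z => (f z)%:E).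
  apply/measurable_EFinP; apply: measurable_funM; first apply: measurable_funM; first apply: measurable_funM.
  - exact: measurable_cst.
  - exact: (measurableT_comp (@measurable_lorI r a0 c0) m1).
  - exact: (measurableT_comp (@measurable_lorI r a1 c1) m2).
  - apply: measurable_funM; last first.
      have mI : measurable_fun setT (\1_(`[- r, r]%classic : set R) : R -> R).
        by apply: measurable_indic; exact: measurable_itv.
      exact: (measurableT_comp mI measurable_snd).
    have ma : measurable_fun setT (fun z : R * R * R => w2 * z.2 + m z.1).
      apply: measurable_funD.
        by apply: measurable_funM; [exact: measurable_cst|exact: measurable_snd].
      exact: (measurableT_comp (continuous_measurable2 cm) measurable_fst).
    exact: (measurableT_comp (continuous_measurable_fun continuous_lor) ma).
have f0 z : (0 <= (f z)%:E)%E.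
  by rewrite lee_fin; exact: (mulr_ge0 (mulr_ge0 (mulr_ge0 D0 (lorI_ge0 _ _ _ _)) (lorI_ge0 _ _ _ _)) (lorI_ge0 _ _ _ _)).
apply: (@le_trans _ _ (\int[mu3]_z (f z)%:E)%E).
  apply: ge0_le_integral => //.
  - by move=> z _; rewrite lee_fin.
  - exact/measurable_EFinP.
  - by move=> z _; rewrite lee_fin; exact: hle.
rewrite (tonelli3_F mf f0).
pose g p : R := D * lorI r a0 c0 p.1 * lorI r a1 c1 p.2 * (pi / `|w2|).
have pw0 : 0 <= pi / `|w2| by rewrite divr_ge0// pi_ge0.
have DL p : 0 <= D * lorI r a0 c0 p by exact: (mulr_ge0 D0 (lorI_ge0 _ _ _ _)).
have DLL p q : 0 <= D * lorI r a0 c0 p * lorI r a1 c1 q by exact: (mulr_ge0 (DL p) (lorI_ge0 _ _ _ _)).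
have g0 p : 0 <= g p by exact: (mulr_ge0 (DLL _ _) pw0).
have mg : measurable_fun setT (fun p => (g p)%:E).
  apply/measurable_EFinP; apply: measurable_funM; last exact: measurable_cst.
  apply: measurable_funM; first apply: measurable_funM.
  - exact: measurable_cst.
  - exact: (measurableT_comp (@measurable_lorI r a0 c0) measurable_fst).
  - exact: (measurableT_comp (@measurable_lorI r a1 c1) measurable_snd).
apply: (@le_trans _ _ (\int[mu2]_p (g p)%:E)%E).
  apply: ge0_le_integral => //.
  - by move=> p _; apply: integral_ge0 => s _; exact: f0.
  - exact: (measurable_integral_last mf f0).
  - move=> p _; rewrite /f /=.
    have [J /andP[J0 hJ] eJ] := lorI_int (m p) r0 w20.
    under eq_integral do rewrite EFinM.
    rewrite ge0_integralZl//; first last.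
    + by rewrite lee_fin; exact: DLL.
    + by move=> s _; rewrite lee_fin lorI_ge0.
    + by apply/measurable_EFinP; exact: measurable_lorI.
    rewrite eJ -EFinM lee_fin /g; apply: ler_wpM2l; [exact: DLL|exact: hJ].
rewrite (tonelli2_F mg (fun p => _)); last by move=> p; rewrite lee_fin.
have [J0 /andP[J00 hJ0] eJ0] := lorI_int c0 r0 a00.
have [J1 /andP[J10 hJ1] eJ1] := lorI_int c1 r0 a10.
have -> : (\int[leb]_x \int[leb]_y (g (x, y))%:E)%E = (D * (pi / `|w2|) * J1 * J0)%:E.
  transitivity (\int[leb]_x ((D * (pi / `|w2|) * J1)%:E * (lorI r a0 c0 x)%:E))%E.
    apply: eq_integral => x _.
    transitivity (\int[leb]_y ((D * lorI r a0 c0 x * (pi / `|w2|))%:E * (lorI r a1 c1 y)%:E))%E.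
      by apply: eq_integral => y _; rewrite -EFinM /g /=; congr EFin; ring.
    rewrite ge0_integralZl//; first last.
    + by rewrite lee_fin; exact: (mulr_ge0 (DL x) pw0).
    + by move=> s _; rewrite lee_fin lorI_ge0.
    + by apply/measurable_EFinP; exact: measurable_lorI.
    by rewrite eJ1 -!EFinM; congr EFin; ring.
  rewrite ge0_integralZl//; first last.
  + by rewrite lee_fin; exact: (mulr_ge0 (mulr_ge0 D0 pw0) J10).
  + by move=> s _; rewrite lee_fin lorI_ge0.
  + by apply/measurable_EFinP; exact: measurable_lorI.
  by rewrite eJ0 -!EFinM.
rewrite lee_fin.
have h1 : J1 * J0 <= (pi / `|a1|) * (pi / `|a0|) by apply: ler_pM.
have h2 : 0 <= D * (pi / `|w2|) by rewrite mulr_ge0.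
rewrite -(mulrA _ J1); apply: (le_trans (ler_wpM2l h2 h1)).
by rewrite le_eqVlt; apply/orP; left; apply/eqP; ring.
Qed.

Definition ball_indic r x : R := (sqn x <= r * r)%R%:R.

Definition ball_wave r w x : R := expR (dot w x) * ball_indic r x.

Lemma ball_wave_ge0 r w x : 0 <= ball_wave r w x.
Proof. by rewrite mulr_ge0 ?expR_ge0 ?ler0n. Qed.

(** Fourth power of 1 + q <= 4 e^{q/4}, since 1 + q^2 <= (1 + q)^2. *)
Lemma exp_quartic (q : R) : 0 <= q -> (1 + q * q) * (1 + q) * (1 + q) <= 256 * expR q.
Proof.
move=> q0; pose e := expR (q / 4).
have eE : expR q = e * e * e * e.
  by rewrite /e -!expRD; congr expR; field.
have h : 1 + q <= 4 * e by have := @expR_ge1Dx R (q / 4); rewrite -/e; lra.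
have h0 : 0 <= 1 + q by lra.
have h1 : 1 + q * q <= (1 + q) * (1 + q) by nra.
have h2 : (1 + q) * (1 + q) <= (4 * e) * (4 * e) by apply: ler_pM.
have h3 : ((1 + q) * (1 + q)) * ((1 + q) * (1 + q)) <= ((4 * e) * (4 * e)) * ((4 * e) * (4 * e)).
  by apply: ler_pM => //; exact: mulr_ge0.
rewrite eE; apply: (@le_trans _ _ (((1 + q) * (1 + q)) * ((1 + q) * (1 + q)))).
  by rewrite -mulrA; apply: ler_wpM2r => //; exact: mulr_ge0.
by move: h3; lra.
Qed.

(** For |x| <= r and |w| = 1 the number q = r - w.x satisfies
    |x - r w|^2 <= 2 r q.  Hence 1 + q dominates 1 + (x_i - r w_i)^2/(2 r) for the first
    two coordinates, while 1 + q^2 is itself a Lorentzian in the last one, and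
    e^{w.x} = e^r e^{-q} is bounded by the product of the three. *)
Lemma ball_wave_le_lor r a w z : 0 < r -> sqn w = 1 -> a = (Num.sqrt (2 * r))^-1 ->
  ball_wave r w (r3 z) <= 256 * expR r * lorI r a (- (a * (r * w 0 i0))) z.1.1 *
    lorI r a (- (a * (r * w 0 i1))) z.1.2 *
    lorI r (- w 0 i2) (r - w 0 i0 * z.1.1 - w 0 i1 * z.1.2) z.2.
Proof.
move=> r0 w1 aE.
have sq (v : R) : 0 <= v * v by rewrite -expr2 sqr_ge0.
have rhs0 : 0 <= 256 * expR r * lorI r a (- (a * (r * w 0 i0))) z.1.1 *
    lorI r a (- (a * (r * w 0 i1))) z.1.2 *
    lorI r (- w 0 i2) (r - w 0 i0 * z.1.1 - w 0 i1 * z.1.2) z.2.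
  have e0 : 0 <= 256 * expR r by have := expR_ge0 r; lra.
  exact: (mulr_ge0 (mulr_ge0 (mulr_ge0 e0 (lorI_ge0 _ _ _ _)) (lorI_ge0 _ _ _ _)) (lorI_ge0 _ _ _ _)).
rewrite /ball_wave /ball_indic; case: (leP (sqn (r3 z)) (r * r)) => [xr|_]; last by rewrite /= mulr0.
rewrite /= mulr1; move: xr; rewrite /sqn /r3 row30 row31 row32.
case: z rhs0 => [[x y] z] /= rhs0 xr.
have inI (v : R) : v * v <= r * r -> \1_(`[- r, r]%classic) v = 1 :> R.
  move=> vr; rewrite indicE mem_set//= in_itv/= -ler_norml.
  by rewrite -ler_sqr ?nnegrE ?(ltW r0)// real_normK ?num_real// !expr2.
have hx := sq x; have hy := sq y; have hz := sq z.
rewrite /lorI !inI; try lra.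
rewrite !mulr1.
have -> : dot w (row3 x y z) = w 0 i0 * x + w 0 i1 * y + w 0 i2 * z.
  by rewrite /dot sum3E row30 row31 row32.
move: w1; rewrite /sqn; move: (w 0 i0) (w 0 i1) (w 0 i2) => w0 w1 w2 hw.
pose q := r - w0 * x - w1 * y - w2 * z.
have y2 : (x - r * w0) * (x - r * w0) + (y - r * w1) * (y - r * w1) + (z - r * w2) * (z - r * w2)
   <= 2 * r * q.
  have -> : (x - r * w0) * (x - r * w0) + (y - r * w1) * (y - r * w1) + (z - r * w2) * (z - r * w2) =
    (x * x + y * y + z * z) + r * r * (w0 * w0 + w1 * w1 + w2 * w2) - 2 * r * (w0 * x + w1 * y + w2 * z) by ring.
  by rewrite hw /q; lra.
have s0 := sq (x - r * w0); have s1 := sq (y - r * w1); have s2 := sq (z - r * w2).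
have q0 : 0 <= q.
  have : 0 <= 2 * r * q by lra.
  by rewrite pmulr_rge0// mulr_gt0.
have aa : a * a = (2 * r)^-1.
  by rewrite aE -invfM -expr2 sqr_sqrtr// mulr_ge0// ltW.
have ay (v c : R) : (v - r * c) * (v - r * c) <= 2 * r * q ->
    1 + (a * v - a * (r * c)) * (a * v - a * (r * c)) <= 1 + q.
  move=> h; rewrite lerD2l.
  have -> : (a * v - a * (r * c)) * (a * v - a * (r * c)) = (a * a) * ((v - r * c) * (v - r * c)) by ring.
  by rewrite aa ler_pdivrMl ?mulr_gt0.
have b0 := ay x w0; have b1 := ay y w1.
have -> : w0 * x + w1 * y + w2 * z = r - q by rewrite /q; ring.
have -> : - w2 * z + (r - w0 * x - w1 * y) = q by rewrite /q; ring.
rewrite expRD expRN -!mulrA; rewrite (mulrCA 256); apply: ler_wpM2l; first exact: expR_ge0.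
have l0 : (1 + q)^-1 <= lor (a * x - a * (r * w0)).
  rewrite /lor lef_pV2 ?posrE ?lor_den//; last by lra.
  by apply: b0; lra.
have l1 : (1 + q)^-1 <= lor (a * y - a * (r * w1)).
  rewrite /lor lef_pV2 ?posrE ?lor_den//; last by lra.
  by apply: b1; lra.
have q1 : 0 < 1 + q by lra.
have iq0 : 0 <= (1 + q)^-1 by rewrite invr_ge0 ltW.
apply: (@le_trans _ _ (256 * ((1 + q)^-1 * ((1 + q)^-1 * lor q)))).
  rewrite /lor -!invfM ler_pdivlMr; last by rewrite !mulr_gt0// lor_den.
  rewrite mulrC ler_pdivrMr ?expR_gt0//.
  by have := exp_quartic q0; lra.
apply: ler_wpM2l; first exact: ler0n.
have lq0 := ltW (lor_gt0 q).
apply: (ler_pM iq0 (mulr_ge0 iq0 lq0) l0).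
exact: ler_wpM2r.
Qed.

Lemma continuous_dot w : continuous (dot w).
Proof.
move=> x; have -> : dot w = (fun x => w 0 i0 * x 0 i0 + w 0 i1 * x 0 i1 + w 0 i2 * x 0 i2).
  by apply/funext => y; rewrite /dot sum3E.
have cc i : {for x, continuous (fun y : V => y 0 i)} by exact: coord_continuous.
have ck i : {for x, continuous (fun _ : V => w 0 i)} by exact: cst_continuous.
have c i : {for x, continuous (fun y : V => w 0 i * y 0 i)}.
  exact: (continuousM (ck i) (cc i)).
exact: (continuousD (continuousD (c i0) (c i1)) (c i2)).
Qed.

Lemma continuous_sqn : continuous (@sqn R).
Proof.
move=> x.
have cc i : {for x, continuous (fun y : V => y 0 i)} by exact: coord_continuous.
have c i : {for x, continuous (fun y : V => y 0 i * y 0 i)}.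
  exact: (continuousM (cc i) (cc i)).
exact: (continuousD (continuousD (c i0) (c i1)) (c i2)).
Qed.

Lemma continuous_exp_dot w : continuous (fun x => expR (dot w x)).
Proof.
move=> x; apply: (@cvg_comp _ _ _ (dot w) expR _ (nbhs (dot w x))).
  exact: continuous_dot.
exact: continuous_expR.
Qed.

Lemma measurable_ball_wave r w : measurable_fun setT (fun z => ball_wave r w (r3 z)).
Proof.
apply: measurable_funM.
  exact: (continuous_measurable3 (@continuous_comp_r3 R _ (@continuous_exp_dot w))).
have ms : measurable_fun setT (fun z : R * R * R => sqn (r3 z)).
  exact: (continuous_measurable3 (@continuous_comp_r3 R _ continuous_sqn)).
pose A := [set z : R * R * R | sqn (r3 z) <= r * r].
have mA : measurable A.
  have -> : A = (fun z => sqn (r3 z)) @^-1` `]-oo, r * r]%classic.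
    by apply/seteqP; split => z /=; rewrite in_itv.
  by rewrite -[X in measurable X]setTI; apply: ms => //; exact: measurable_itv.
have -> : (fun z => ball_indic r (r3 z)) = \1_A.
  by apply/funext => z; rewrite /ball_indic indicE; congr (nat_of_bool _)%:R; apply/idP/idP; rewrite inE.
exact: measurable_indic.
Qed.

(** The first two factors integrate to pi (2 r)^{1/2} each and the last one to
    pi / |w_2|, which is at most 2 pi. *)
Lemma int_ball_wave_bound_last r w : 0 < r -> sqn w = 1 -> 4^-1 <= w 0 i2 * w 0 i2 ->
  (\int[mu3]_z (ball_wave r w (r3 z))%:E <= (1024 * pi ^+ 3 * r * expR r)%:E)%E.
Proof.
move=> r0 w1 w2.
pose a := (Num.sqrt (2 * r))^-1.
have s0 : 0 < Num.sqrt (2 * r) by rewrite sqrtr_gt0 mulr_gt0.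
have a0 : a != 0 by rewrite gt_eqF// /a invr_gt0.
have w20 : - w 0 i2 != 0.
  by rewrite oppr_eq0; apply/eqP => h; move: w2; rewrite h; lra.
have cm : continuous (fun p : R * R => r - w 0 i0 * p.1 - w 0 i1 * p.2).
  move=> p; apply: cvgB; [apply: cvgB; [exact: cvg_cst|]|].
    by apply: cvgM; [exact: cvg_cst|exact: cvg_fst].
  by apply: cvgM; [exact: cvg_cst|exact: cvg_snd].
have D0 : 0 <= 256 * expR r by have := expR_ge0 r; lra.
apply: le_trans (@lorI3_int (fun z => ball_wave r w (r3 z)) r (256 * expR r) (- w 0 i2) a
  (- (a * (r * w 0 i0))) a (- (a * (r * w 0 i1))) _ r0 D0 a0 a0 w20 cm (@measurable_ball_wave r w) _ _) _.
- by move=> z; exact: ball_wave_ge0.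
- by move=> z; exact: ball_wave_le_lor.
rewrite lee_fin normrN /a normfV invrK (gtr0_norm s0).
have p0 : 0 <= pi :> R by exact: pi_ge0.
have h2 : pi / `|w 0 i2| <= 2 * pi.
  rewrite ler_pdivrMr; last by rewrite normr_gt0 -oppr_eq0.
  have : 2^-1 <= `|w 0 i2|.
    rewrite -ler_sqr ?nnegrE// real_normK ?num_real// !expr2; lra.
  by move=> h; nra.
have ss : Num.sqrt (2 * r) * Num.sqrt (2 * r) = 2 * r.
  by rewrite -expr2 sqr_sqrtr// mulr_ge0// ltW.
have -> : 256 * expR r * (pi * Num.sqrt (2 * r)) * (pi * Num.sqrt (2 * r)) =
  256 * expR r * pi * pi * (Num.sqrt (2 * r) * Num.sqrt (2 * r)) by ring.
rewrite ss.
have -> : 1024 * pi ^+ 3 * r * expR r = 256 * expR r * pi * pi * (2 * r) * (2 * pi) by ring.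
have r20 : 0 <= 2 * r by lra.
apply: ler_wpM2l; last exact: h2.
exact: (mulr_ge0 (mulr_ge0 (mulr_ge0 D0 p0) p0) r20).
Qed.

Lemma ball_wave_swap12 r w z : ball_wave r w (r3 (swap12 z)) = ball_wave r (r3 (w 0 i0, w 0 i2, w 0 i1)) (r3 z).
Proof.
case: z => [[x y] z]; rewrite /ball_wave /ball_indic /dot !sum3E /sqn /swap12 /r3 /= !(row30, row31, row32).
by apply: f_equal2; [congr expR; ring|congr (nat_of_bool (_ <= _)%R)%:R; ring].
Qed.

Lemma ball_wave_swap01 r w z : ball_wave r w (r3 (swap01 z)) = ball_wave r (r3 (w 0 i1, w 0 i0, w 0 i2)) (r3 z).
Proof.
case: z => [[x y] z]; rewrite /ball_wave /ball_indic /dot !sum3E /sqn /swap01 /r3 /= !(row30, row31, row32).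
by apply: f_equal2; [congr expR; ring|congr (nat_of_bool (_ <= _)%R)%:R; ring].
Qed.

(** One coordinate of a unit vector has square at least 1/4; a permutation of
    coordinates makes it the last one. *)
Lemma int_ball_wave_bound r w : 0 < r -> sqn w = 1 ->
  (\int[mu3]_z (ball_wave r w (r3 z))%:E <= (1024 * pi ^+ 3 * r * expR r)%:E)%E.
Proof.
move=> r0 w1.
have mb v : measurable_fun setT (fun z => (ball_wave r v (r3 z))%:E).
  by apply/measurable_EFinP; exact: measurable_ball_wave.
have mid v : sqn v = 1 -> 4^-1 <= v 0 i1 * v 0 i1 ->
    (\int[mu3]_z (ball_wave r v (r3 z))%:E <= (1024 * pi ^+ 3 * r * expR r)%:E)%E.
  move=> v1 hv; rewrite -(integral_swap12 (mb v)).
  under eq_integral do rewrite ball_wave_swap12.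
  apply: int_ball_wave_bound_last => //; last by rewrite /r3 /= row32.
  by move: v1; rewrite /sqn /r3 /= !(row30, row31, row32) => <-; ring.
have [h|h2] := leP 4^-1 (w 0 i2 * w 0 i2); first exact: int_ball_wave_bound_last.
have [h|h1] := leP 4^-1 (w 0 i1 * w 0 i1); first exact: mid.
rewrite -(integral_swap01 (mb w)).
under eq_integral do rewrite ball_wave_swap01.
apply: mid; last first.
  by move: w1; rewrite /sqn /r3 /= !(row30, row31, row32); lra.
by move: w1; rewrite /sqn /r3 /= !(row30, row31, row32) => <-; ring.
Qed.

End BallBound.

(** * The plane-wave functionals *)

Section PlaneWave.
Context {R : realType}.
Local Notation leb := (@lebesgue_measure R).
Local Notation mu3 := ((leb \x leb) \x leb)%E.
Local Notation V := 'rV[R]_3.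
Local Notation i0 := (ord0 : 'I_3).
Local Notation i1 := (lift ord0 ord0 : 'I_3).
Local Notation i2 := (ord_max : 'I_3).

Lemma ball_wave_le (r : R) (w x : V) : 0 < r -> sqn w = 1 -> ball_wave r w x <= expR r.
Proof.
move=> r0 w1; rewrite /ball_wave /ball_indic.
case: (leP (sqn x) (r * r)) => [xr|_] /=; last by rewrite mulr0 expR_ge0.
rewrite mulr1 ler_expR /dot sum3E.
have w1' : sqn w <= 1 * 1 by rewrite w1 mulr1.
have := @cauchy3 R _ _ _ _ _ _ 1 r ler01 (ltW r0) w1' xr.
by rewrite ler_norml mul1r => /andP[].
Qed.

Lemma sqn_coord (x : V) i : x 0 i * x 0 i <= sqn x.
Proof.
have h j : 0 <= x 0 j * x 0 j by rewrite -expr2 sqr_ge0.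
by rewrite /sqn; have := h i0; have := h i1; have := h i2; case: (ord3P i) => ->; lra.
Qed.

Lemma sqn_gt (x : V) i r : 0 <= r -> r < `|x 0 i| -> r * r < sqn x.
Proof.
move=> r0 rx; have h : r * r < x 0 i * x 0 i.
  by rewrite -!expr2 -[ltRHS](real_normK (num_real (x 0 i))) ltr_sqr ?nnegrE.
exact: (lt_le_trans h (sqn_coord x i)).
Qed.

Lemma ball_wave_integrable (r : R) (w : V) : 0 < r -> sqn w = 1 ->
  mu3.-integrable setT (EFin \o (ball_wave r w \o r3)).
Proof.
move=> r0 w1; apply: (@integrable_box R (fun z => ball_wave r w (r3 z)) r (expR r)).
- exact: measurable_ball_wave.
- by move=> z; rewrite /= ger0_norm ?ball_wave_ge0// ball_wave_le.
- move=> z; apply: vanish_box => x i xi.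
  rewrite /ball_wave /ball_indic leNgt (sqn_gt (ltW r0) xi) /=; exact: mulr0.
Qed.

(** The bound for the integral of e^{w.x} over the ball of radius r, for any unit
    vector w. *)
Definition ball_wave_bound (r : R) : R := 1024 * pi ^+ 3 * r * expR r.

Lemma ball_wave_bound_gt0 r : 0 < r -> 0 < ball_wave_bound r.
Proof.
move=> r0; have h : 0 < 1024 :> R by rewrite ltr0n.
exact: (mulr_gt0 (mulr_gt0 (mulr_gt0 h (exprn_gt0 3 (pi_gt0 R))) r0) (expR_gt0 r)).
Qed.

Lemma int_ball_wave_le (r : R) (w : V) : 0 < r -> sqn w = 1 -> int_R3 (ball_wave r w) <= ball_wave_bound r.
Proof.
move=> r0 w1; have h := int_ball_wave_bound r0 w1.
have f : (\int[mu3]_z (ball_wave r w (r3 z))%:E)%E \is a fin_num.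
  by apply: integrable_fin_num => //; exact: ball_wave_integrable.
by rewrite -lee_fin /int_R3 /Rintegral fineK.
Qed.

Variables (b R0 : R) (rho rt : R -> V -> R) (rx : 'I_3 -> R -> V -> R)
  (U Ut : 'I_3 -> R -> V -> R) (Ux : 'I_3 -> 'I_3 -> R -> V -> R).
Hypothesis F : flow b rho rt rx U Ut Ux.
Hypotheses (b0 : 0 < b) (R00 : 0 < R0).
Hypothesis rest : forall t x, 0 <= t < b -> (R0 + t) * (R0 + t) < sqn x ->
  at_rest rho U t x.
Variable w : V.
Hypothesis w1 : sqn w = 1.

Definition wU t x : R := w 0 i0 * U i0 t x + w 0 i1 * U i1 t x + w 0 i2 * U i2 t x.
Definition wx (x : V) : R := w 0 i0 * x 0 i0 + w 0 i1 * x 0 i1 + w 0 i2 * x 0 i2.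

Definition wmass t x : R := expR (wx x) * (rho t x + -1).
Definition wmom t x : R := expR (wx x) * (rho t x * wU t x).
Definition wsource t x : R := expR (wx x) *
  (rho t x * (wU t x * wU t x) + 2^-1 * ((rho t x + -1) * (rho t x + -1))).

Lemma wxE x : wx x = dot w x.
Proof. by rewrite /dot sum3E. Qed.

Let L := R0 + b.
Let L0 : 0 < L. Proof. by rewrite /L addr_gt0. Qed.

Lemma vanish_of_rest (g : R -> V -> R) t :
  (forall x, at_rest rho U t x -> g t x = 0) -> 0 <= t < b -> vanish L (g t).
Proof.
move=> g0 tb x i xi; apply: g0; apply: rest => //.
have /andP[t0 tb'] := tb.
apply: (sqn_gt (i := i)); first by rewrite addr_ge0// ltW.
by apply: lt_trans xi; rewrite /L ltrD2l.
Qed.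

Let reg_exp : exists Et Ex, [/\ reg b (fun _ x => expR (wx x)) Et Ex,
  (forall t x, Et t x = 0) & (forall j t x, Ex j t x = w 0 j * expR (wx x))].
Proof.
have hc i := reg_mul (reg_cst b (w 0 i)) (reg_coord b i).
have hs := reg_add (reg_add (hc i0) (hc i1)) (hc i2).
have h := reg_comp hs (@is_derive_expR R) (@continuous_expR R).
do 2 eexists; split; first exact: h.
  by move=> t x /=; ring.
move=> j t x /=; rewrite -/(wx x).
by case: (ord3P j) => ->; rewrite -!val_eqE /=; ring.
Qed.

Let reg_wU : exists Dt Dx, [/\ reg b wU Dt Dx,
  (forall t x, Dt t x = w 0 i0 * Ut i0 t x + w 0 i1 * Ut i1 t x + w 0 i2 * Ut i2 t x) &
  (forall j t x, Dx j t x = w 0 i0 * Ux i0 j t x + w 0 i1 * Ux i1 j t x + w 0 i2 * Ux i2 j t x)].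
Proof.
have hc i := reg_mul (reg_cst b (w 0 i)) (flow_U F i).
have h := reg_add (reg_add (hc i0) (hc i1)) (hc i2).
do 2 eexists; split; first exact: h; by move=> *; rewrite /=; ring.
Qed.

(** The mass equation tested against e^{w.x}: integrating the flux by parts leaves
    the factor w. *)
Lemma wmass_deriv t : 0 < t < b ->
  is_derive t 1 (fun s : R => int_R3 (wmass (Num.max 0 s))) (int_R3 (wmom t)).
Proof.
move=> tb.
have [Et [Ex [hE EtE ExE]]] := reg_exp.
have hr := flow_rho F; have hU := flow_U F.
have hg := reg_mul hE (reg_add hr (reg_cst b (-1))).
have hq j := reg_mul hE (reg_mul hr (hU j)).
have sI s : 0 < s < b -> 0 <= s < b by move=> /andP[/ltW -> ->].
have vg s : 0 < s < b -> vanish L (wmass s).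
  move=> /sI; apply: (vanish_of_rest (g := wmass)) => x [rE uE].
  by rewrite /wmass rE addrN mulr0.
have vq (j : 'I_3) s : 0 < s < b -> vanish L (fun x => expR (wx x) * (rho s x * U j s x)).
  move=> /sI; apply: (vanish_of_rest (g := fun s x => expR (wx x) * (rho s x * U j s x))) => x [rE uE].
  by rewrite uE !mulr0.
have := conservation_law_max L0 hg hq vg vq tb.
congr (is_derive _ _ _ _); congr int_R3; apply/funext => x /=.
have := flow_mass F x tb; rewrite !sum3E => m.
rewrite EtE !ExE /wmom /wU.
set X := (X in X = 0) in m.
transitivity (expR (wx x) * (rho t x * (w 0 i0 * U i0 t x + w 0 i1 * U i1 t x + w 0 i2 * U i2 t x)) +
  expR (wx x) * X); last by rewrite m mulr0 addr0.
by rewrite /X; ring.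
Qed.

(** The momentum equations contracted with w and tested against e^{w.x}.  The
    pressure contributes |w|^2 (rho^2 - 1)/2, and rho^2 - 1 = 2 (rho - 1) + (rho - 1)^2;
    the constant 1/2 is subtracted from the pressure to make the flux vanish at rest. *)
Lemma wmom_deriv t : 0 < t < b ->
  is_derive t 1 (fun s : R => int_R3 (wmom (Num.max 0 s)))
    (int_R3 (fun x => wmass t x + wsource t x)).
Proof.
move=> tb.
have [Et [Ex [hE EtE ExE]]] := reg_exp.
have [Dt [Dx [hD DtE DxE]]] := reg_wU.
have hr := flow_rho F; have hU := flow_U F.
have hg := reg_mul hE (reg_mul hr hD).
(* the flux of the pressure perturbation (rho^2 - 1)/2 *)
have hp j := reg_mul (reg_cst b (2^-1 * w 0 j)) (reg_add (reg_mul hr hr) (reg_cst b (-1))).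
have hq j := reg_mul hE (reg_add (reg_mul (reg_mul hr hD) (hU j)) (hp j)).
have sI s : 0 < s < b -> 0 <= s < b by move=> /andP[/ltW -> ->].
have vg s : 0 < s < b -> vanish L (wmom s).
  move=> /sI; apply: (vanish_of_rest (g := wmom)) => x [rE uE].
  by rewrite /wmom /wU !uE; ring.
have vq (j : 'I_3) s : 0 < s < b -> vanish L (fun x => expR (wx x) *
   (rho s x * wU s x * U j s x + 2^-1 * w 0 j * (rho s x * rho s x + -1))).
  move=> /sI; apply: (vanish_of_rest (g := fun s x => expR (wx x) *
   (rho s x * wU s x * U j s x + 2^-1 * w 0 j * (rho s x * rho s x + -1)))) => x [rE uE].
  by rewrite uE rE; ring.
have := conservation_law_max L0 hg hq vg vq tb.
congr (is_derive _ _ _ _); congr int_R3; apply/funext => x /=.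
have := flow_mom F i0 x tb; have := flow_mom F i1 x tb.
have := flow_mom F i2 x tb; rewrite !sum3E => m2 m1 m0.
have lin (e v0 v1 v2 M0 M1 M2 c S A B : R) : M0 = 0 -> M1 = 0 -> M2 = 0 -> S = 1 ->
  A = B + e * (v0 * M0 + v1 * M1 + v2 * M2) + c * (S - 1) -> A = B.
  by move=> -> -> -> -> ->; ring.
apply: (lin (expR (wx x)) (w 0 i0) (w 0 i1) (w 0 i2) _ _ _
  (expR (wx x) * 2^-1 * (rho t x * rho t x - 1)) _ _ _ m0 m1 m2 w1).
rewrite EtE !ExE DtE !DxE /wmass /wsource /wU /sqn.
by field.
Qed.

Lemma continuous_wmass t : t < b -> {for t, continuous (fun s : R => int_R3 (wmass (Num.max 0 s)))}.
Proof.
move=> tb; have [Et [Ex [hE EtE ExE]]] := reg_exp.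
have hg := reg_mul hE (reg_add (flow_rho F) (reg_cst b (-1))).
apply: (int_R3_continuous (L := L) (g := wmass) b0 tb (reg_c hg)) => s.
by apply: (vanish_of_rest (g := wmass)) => x [rE uE]; rewrite /wmass rE addrN mulr0.
Qed.

Lemma continuous_wmom t : t < b -> {for t, continuous (fun s : R => int_R3 (wmom (Num.max 0 s)))}.
Proof.
move=> tb; have [Et [Ex [hE EtE ExE]]] := reg_exp.
have [Dt [Dx [hD DtE DxE]]] := reg_wU.
have hg := reg_mul hE (reg_mul (flow_rho F) hD).
apply: (int_R3_continuous (L := L) (g := wmom) b0 tb (reg_c hg)) => s.
by apply: (vanish_of_rest (g := wmom)) => x [rE uE]; rewrite /wmom /wU !uE; ring.
Qed.

Let slice_cont (g : R -> V -> R) gt gx t : reg b g gt gx -> 0 <= t < b -> continuous (g t).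
Proof.
move=> hg /andP[t0 tb] x.
have := @continuous_slice R _ (fun t x => g (Num.max 0 t) x) t x (reg_c hg tb).
by rewrite max_r.
Qed.

Let wmass_int t : 0 <= t < b -> mu3.-integrable setT (EFin \o (wmass t \o r3)).
Proof.
move=> tb; have [Et [Ex [hE EtE ExE]]] := reg_exp.
have hg := reg_mul hE (reg_add (flow_rho F) (reg_cst b (-1))).
apply: (@int_R3_integrable R (wmass t) L); first exact: (slice_cont hg tb).
by apply: (vanish_of_rest (g := wmass)) tb => x [rE uE]; rewrite /wmass rE addrN mulr0.
Qed.

Let wsource_int t : 0 <= t < b -> mu3.-integrable setT (EFin \o (wsource t \o r3)).
Proof.
move=> tb; have [Et [Ex [hE EtE ExE]]] := reg_exp.
have [Dt [Dx [hD DtE DxE]]] := reg_wU.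
have hn := reg_add (flow_rho F) (reg_cst b (-1)).
have hg := reg_mul hE (reg_add (reg_mul (flow_rho F) (reg_mul hD hD))
  (reg_mul (reg_cst b (2^-1)) (reg_mul hn hn))).
apply: (@int_R3_integrable R (wsource t) L); first exact: (slice_cont hg tb).
apply: (vanish_of_rest (g := wsource)) tb => x [rE uE].
by rewrite /wsource /wU rE !uE; ring.
Qed.

Lemma wmom_deriv_split t : 0 <= t < b ->
  int_R3 (fun x => wmass t x + wsource t x) = int_R3 (wmass t) + int_R3 (wsource t).
Proof.
by move=> tb; rewrite /int_R3 RintegralD//; [exact: wmass_int|exact: wsource_int].
Qed.

(** Young's inequality (rho - 1)^2/2 >= l (rho - 1) - l^2/2 integrated over the
    ball where the solution is not at rest, with the best constant l = f / V. *)
Lemma wsource_ge t : 0 <= t < b ->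
  (int_R3 (wmass t)) ^+ 2 / (2 * ball_wave_bound (R0 + t)) <= int_R3 (wsource t).
Proof.
move=> tb; have /andP[t0 tb'] := tb.
pose r := R0 + t; have r0 : 0 < r by rewrite /r ltr_pwDl.
have V0 := ball_wave_bound_gt0 r0; set Vb := ball_wave_bound r in V0 *.
set f := int_R3 (wmass t); set p := int_R3 (wsource t).
pose l := f / Vb.
have iM := wmass_int tb; have iS := wsource_int tb; have iB := ball_wave_integrable r0 w1.
have iM' : mu3.-integrable setT (EFin \o (fun z => l * wmass t (r3 z))).
  have := integrableZl measurableT l iM.
  by apply: eq_integrable => // z _; rewrite /= EFinM.
have iB' : mu3.-integrable setT (EFin \o (fun z => 2^-1 * l ^+ 2 * ball_wave r w (r3 z))).
  have := integrableZl measurableT (2^-1 * l ^+ 2) iB.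
  by apply: eq_integrable => // z _; rewrite /= EFinM.
have key : 0 <= \int[mu3]_z (wsource t (r3 z) + 2^-1 * l ^+ 2 * ball_wave r w (r3 z) - l * wmass t (r3 z)).
  apply: Rintegral_ge0 => z _; set x := r3 z.
  have [xr|xr] := leP (sqn x) (r * r); last first.
    have [rE uE] := rest tb xr.
    rewrite /wsource /wmass /wU rE !uE addrN.
    have b0' : 0 <= 2^-1 * l ^+ 2 * ball_wave r w x.
      by rewrite mulr_ge0 ?ball_wave_ge0// mulr_ge0 ?sqr_ge0.
    by lra.
  have -> : ball_wave r w x = expR (wx x).
    by rewrite /ball_wave /ball_indic xr /= mulr1 wxE.
  rewrite /wsource /wmass; have r1 := flow_pos F x tb.
  have sq (v : R) : 0 <= v * v by rewrite -expr2 sqr_ge0.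
  have h1 : 0 <= rho t x * (wU t x * wU t x) by rewrite mulr_ge0// ltW.
  have h2 := sq (rho t x + -1 - l).
  have e0 := expR_gt0 (wx x).
  have -> : expR (wx x) * (rho t x * (wU t x * wU t x) + 2^-1 * ((rho t x + -1) * (rho t x + -1))) +
    2^-1 * l ^+ 2 * expR (wx x) - l * (expR (wx x) * (rho t x + -1)) =
    expR (wx x) * (rho t x * (wU t x * wU t x) + 2^-1 * ((rho t x + -1 - l) * (rho t x + -1 - l))).
    by field.
  apply: mulr_ge0; first exact: ltW.
  by lra.
have iSB : mu3.-integrable setT (EFin \o (fun z => wsource t (r3 z) + 2^-1 * l ^+ 2 * ball_wave r w (r3 z))).
  by have := integrableD measurableT iS iB'; apply: eq_integrable => // z _; rewrite /= EFinD.
move: key; rewrite (RintegralB measurableT iSB iM') (RintegralD measurableT iS iB').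
rewrite (RintegralZl _ measurableT iM) (RintegralZl _ measurableT iB).
rewrite -/(int_R3 (wmass t)) -/(int_R3 (wsource t)) -/(int_R3 (ball_wave r w)) -/f -/p.
have vb : int_R3 (ball_wave r w) <= Vb := int_ball_wave_le r0 w1.
have l2 : 0 <= 2^-1 * l ^+ 2 by rewrite mulr_ge0 ?sqr_ge0.
have := ler_wpM2l l2 vb.
have -> : f ^+ 2 / (2 * Vb) = l * f - 2^-1 * l ^+ 2 * Vb.
  by rewrite /l; field; rewrite gt_eqF.
by lra.
Qed.

(** Since rho > 0, the density perturbation is at least -1 on the ball of radius R0
    and zero outside. *)
Lemma wmass0_ge : - ball_wave_bound R0 <= int_R3 (wmass 0).
Proof.
have tb : 0 <= (0 : R) < b by rewrite lexx.
have iM := wmass_int tb; have iB := ball_wave_integrable R00 w1.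
have : 0 <= \int[mu3]_z (wmass 0 (r3 z) + ball_wave R0 w (r3 z)).
  apply: Rintegral_ge0 => z _; set x := r3 z.
  have [xr|xr] := leP (sqn x) (R0 * R0); last first.
    have [rE uE] : at_rest rho U 0 x by apply: rest => //; rewrite addr0.
    by rewrite /wmass rE addrN mulr0 add0r ball_wave_ge0.
  have -> : ball_wave R0 w x = expR (wx x) by rewrite /ball_wave /ball_indic xr /= mulr1 wxE.
  have -> : wmass 0 x + expR (wx x) = expR (wx x) * rho 0 x by rewrite /wmass; ring.
  by rewrite mulr_ge0 ?expR_ge0// ltW//; exact: (flow_pos F x tb).
rewrite (RintegralD measurableT iM iB) -/(int_R3 (wmass 0)) -/(int_R3 (ball_wave R0 w)).
have := int_ball_wave_le R00 w1; lra.
Qed.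

End PlaneWave.

(** * Comparison with an exploding subsolution *)

Section Subsolution.
Context {R : realType}.
Implicit Types (f g : R -> R) (t : R).

Lemma derive_mul f g (t df dg : R) : is_derive t 1 f df -> is_derive t 1 g dg ->
  is_derive t 1 (fun s => f s * g s) (df * g t + f t * dg).
Proof.
by move=> hf hg; have := is_deriveM hf hg; rewrite /GRing.scale /= addrC [g t * _]mulrC.
Qed.

Lemma derive_add f g (t df dg : R) : is_derive t 1 f df -> is_derive t 1 g dg ->
  is_derive t 1 (fun s => f s + g s) (df + dg).
Proof. by move=> hf hg; exact: (is_deriveD hf hg). Qed.

Lemma derive_exp (k t : R) : is_derive t 1 (fun s => expR (k * s)) (k * expR (k * t)).
Proof.
have h : is_derive t 1 (fun s => k * s) k.
  by have := is_deriveZ k (is_derive_id t 1); rewrite /GRing.scale /= mulr1.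
by have := is_derive_comp_line h (is_derive_expR (k * t)); rewrite mulrC.
Qed.

(** The infimum of the points where [f] is nonpositive. *)
Lemma first_nonpos f (a c : R) : a <= c -> f c <= 0 ->
  (forall s, a <= s <= c -> {for s, continuous f}) ->
  exists S, [/\ a <= S <= c, f S <= 0 & forall s, a <= s < S -> 0 < f s].
Proof.
move=> ac fc cf.
pose E := [set s | a <= s <= c /\ f s <= 0].
have Ec : E c by split => //; rewrite ac lexx.
have hE : has_inf E by split; [exists c|exists a => s [/andP[]]].
pose S := inf E.
have aS : a <= S by apply: lb_le_inf; [exists c|move=> s [/andP[]]].
have Sc : S <= c by apply: ge_inf => //; exact: hE.2.
exists S; split; first by rewrite aS.
  rewrite leNgt; apply/negP => fS.
  have hn : \forall s \near S, 0 < f s.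
    by apply: (cf S _ [set y | 0 < y]); [rewrite aS|apply: lt_nbhsr].
  have [e /= e0 he] := hn.
  have [s [sI fs] sS] := inf_adherent e0 hE.
  have Ss : S <= s by apply: ge_inf => //; exact: hE.2.
  have : 0 < f s by apply: he; rewrite /= ltr_norml; apply/andP; split; rewrite -/S in sS; lra.
  by rewrite ltNge fs.
move=> s /andP[as' sS]; rewrite ltNge; apply/negP => fs.
have : S <= s by apply: ge_inf; [exact: hE.2|split => //; rewrite as' (le_trans (ltW sS))].
by rewrite leNgt sS.
Qed.

Section Comparison.
Variables (H A : R -> R) (R0 k t1 b dl mu : R).
Hypotheses (R00 : 0 < R0) (t10 : 0 <= t1) (dl0 : 0 < dl) (mu0 : 0 < mu).
Hypothesis mu_small : 6 * dl * mu ^+ 2 / R0 + 4 * mu <= k.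
Hypothesis cH : forall t, t < b -> {for t, continuous H}.
Hypothesis cA : forall t, t < b -> {for t, continuous A}.
Hypothesis dH : forall t, 0 < t < b -> is_derive t 1 H (A t - 2 * H t).
Variable dA : R -> R.
Hypothesis dAE : forall t, 0 < t < b -> is_derive t 1 A (dA t).
Hypothesis dA_ge : forall t, 0 < t < b -> k * H t ^+ 2 / (R0 + t) <= dA t.
Hypothesis H1 : dl < H t1.
Hypothesis A1 : 2 * dl + 2 * mu * dl ^+ 2 / R0 < A t1.

Definition theta t := 1 - mu * dl * (ln (R0 + t) - ln (R0 + t1)).
Let iT t := (theta t)^-1.
Let j t := (R0 + t)^-1.
(** Together, [sub_h] and [sub_a] satisfy h' = a - 2 h and a' <= k h^2 / (R0 + t), the
    reverse of the inequality for [H] and [A].  The exponent -2 of theta balances the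
    leading terms: a' contains 4 mu dl^2 theta^{-3} / (R0 + t), while h^2 = dl^2 theta^{-4}. *)
Definition sub_h t := dl * (iT t * iT t).
Definition sub_a t := 2 * mu * dl ^+ 2 * (iT t * iT t * iT t * j t) + 2 * dl * (iT t * iT t).

Let R0t t : 0 <= t -> 0 < R0 + t. Proof. by move=> t0; rewrite ltr_pwDl. Qed.

Lemma derive_shift t : is_derive t 1 (fun s => R0 + s) 1.
Proof. by have := derive_add (is_derive_cst R0 t 1) (is_derive_id t 1); rewrite add0r. Qed.

Lemma derive_theta t : 0 <= t -> is_derive t 1 theta (- (mu * dl * j t)).
Proof.
move=> t0; have h2 := is_derive_comp_line (derive_shift t) (is_derive1_ln (R0t t0)).
have h3 := derive_add h2 (is_derive_cst (- ln (R0 + t1)) t 1).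
have h4 := derive_mul (is_derive_cst (- (mu * dl)) t 1) h3.
have := derive_add (is_derive_cst (1 : R) t 1) h4.
rewrite mul0r !add0r addr0 mulr1 mulNr /cst /theta.
by congr (is_derive _ _ _ _); apply/funext => s; rewrite mulNr.
Qed.

Lemma derive_iT t : 0 <= t -> 0 < theta t -> is_derive t 1 iT (mu * dl * j t * (iT t * iT t)).
Proof.
move=> t0 th0; have th0' : theta t != 0 by rewrite gt_eqF.
have := is_deriveV th0' (derive_theta t0).
by rewrite /GRing.scale /= mulrNN -exprVn expr2 mulrC.
Qed.

Lemma derive_j t : 0 <= t -> is_derive t 1 j (- (j t * j t)).
Proof.
move=> t0; have th0' : R0 + t != 0 by rewrite gt_eqF// R0t.
have := is_deriveV th0' (derive_shift t).
by rewrite /GRing.scale /= mulr1 -exprVn expr2.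
Qed.

Lemma derive_sub_h t : 0 <= t -> 0 < theta t -> is_derive t 1 sub_h (sub_a t - 2 * sub_h t).
Proof.
move=> t0 th0; have dT := derive_iT t0 th0.
have := derive_mul (is_derive_cst dl t 1) (derive_mul dT dT).
by congr (is_derive _ _ _ _); rewrite /sub_a /sub_h /=; ring.
Qed.

Definition sub_a' t := 6 * mu ^+ 2 * dl ^+ 3 * (iT t ^+ 4 * (j t * j t))
  - 2 * mu * dl ^+ 2 * (iT t ^+ 3 * (j t * j t))
  + 4 * mu * dl ^+ 2 * (iT t ^+ 3 * j t).

Lemma derive_sub_a t : 0 <= t -> 0 < theta t -> is_derive t 1 sub_a (sub_a' t).
Proof.
move=> t0 th0; have dT := derive_iT t0 th0; have dj := derive_j t0.
have h1 := derive_mul (is_derive_cst (2 * mu * dl ^+ 2) t 1)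
  (derive_mul (derive_mul (derive_mul dT dT) dT) dj).
have := derive_add h1 (derive_mul (is_derive_cst (2 * dl) t 1) (derive_mul dT dT)).
by congr (is_derive _ _ _ _); rewrite /sub_a' /=; ring.
Qed.

(** Uses theta <= 1 and R0 + t >= R0; the first term of the derivative carries
    mu^2 and is absorbed because mu is small. *)
Lemma sub_a'_le t : 0 <= t -> 0 < theta t <= 1 -> sub_a' t <= k * sub_h t ^+ 2 / (R0 + t).
Proof.
move=> t0 /andP[th0 th1]; have p := R0t t0.
have iT1 : 1 <= iT t by rewrite /iT invf_ge1.
have j0 : 0 < j t by rewrite /j invr_gt0.
have jR : j t <= R0^-1 by rewrite /j lef_pV2 ?posrE// lerDl.
have iT0 : 0 <= iT t by exact: le_trans iT1.
have q4 : 0 <= dl ^+ 2 * (iT t ^+ 4 * j t).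
  by rewrite mulr_ge0 ?sqr_ge0// mulr_ge0 ?exprn_ge0// ltW.
have e1 : 6 * mu ^+ 2 * dl ^+ 3 * (iT t ^+ 4 * (j t * j t)) <=
    6 * dl * mu ^+ 2 / R0 * (dl ^+ 2 * (iT t ^+ 4 * j t)).
  have -> : 6 * mu ^+ 2 * dl ^+ 3 * (iT t ^+ 4 * (j t * j t)) =
    (6 * dl * mu ^+ 2 * j t) * (dl ^+ 2 * (iT t ^+ 4 * j t)) by ring.
  apply: ler_wpM2r => //; apply: ler_wpM2l => //.
  by have := mulr_ge0 (ltW dl0) (sqr_ge0 mu); lra.
have e2 : 0 <= 2 * mu * dl ^+ 2 * (iT t ^+ 3 * (j t * j t)).
  have h1 : 0 <= mu * dl ^+ 2 by rewrite mulr_ge0 ?sqr_ge0// ltW.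
  have h2 : 0 <= iT t ^+ 3 * (j t * j t) by rewrite mulr_ge0 ?exprn_ge0// mulr_ge0// ltW.
  by have := mulr_ge0 h1 h2; lra.
have e3 : 4 * mu * dl ^+ 2 * (iT t ^+ 3 * j t) <= 4 * mu * (dl ^+ 2 * (iT t ^+ 4 * j t)).
  have h1 : 0 <= mu * (dl ^+ 2 * (iT t ^+ 3 * j t)).
    by rewrite !mulr_ge0 ?sqr_ge0 ?exprn_ge0//; exact: ltW.
  have := ler_wpM2l h1 iT1; lra.
have e4 := ler_wpM2r q4 mu_small.
have -> : k * sub_h t ^+ 2 / (R0 + t) = k * (dl ^+ 2 * (iT t ^+ 4 * j t)).
  by rewrite /sub_h /j; ring.
by rewrite /sub_a'; lra.
Qed.

Let tb := (R0 + t1) * expR (1 / (mu * dl)) - R0.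

Lemma theta_gt0 t : t1 <= t -> t < tb -> 0 < theta t <= 1.
Proof.
move=> t1t ttb; have p1 := R0t t10; have p := R0t (le_trans t10 t1t).
have md : 0 < mu * dl by rewrite mulr_gt0.
have l1 : ln (R0 + t1) <= ln (R0 + t) by rewrite ler_ln ?posrE// lerD2l.
have l2 : ln (R0 + t) < ln (R0 + t1) + 1 / (mu * dl).
  rewrite -[X in _ < _ + X]expRK -lnM ?posrE ?expR_gt0// ltr_ln ?posrE ?mulr_gt0 ?expR_gt0//.
  by move: ttb; rewrite /tb; lra.
have : (mu * dl) * (ln (R0 + t) - ln (R0 + t1)) < (mu * dl) * (1 / (mu * dl)).
  by rewrite ltr_pM2l//; lra.
rewrite [ltRHS]mulrA mulr1 divff ?gt_eqF// => l3.
have l4 : 0 <= (mu * dl) * (ln (R0 + t) - ln (R0 + t1)).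
  by rewrite mulr_ge0 ?(ltW md)// subr_ge0.
by rewrite /theta; apply/andP; split; rewrite -?mulrA in l3 l4 *; lra.
Qed.

(** Up to the first time S at which [sub_h] would catch up with [H], the
    differential inequalities keep A - a nondecreasing, hence positive; then
    e^{2 t} (H - h) is nondecreasing too, so it is still positive at S. *)
Lemma sub_h_lt t : t1 <= t -> t < tb -> t < b -> sub_h t < H t.
Proof.
move=> t1t ttb t_b; rewrite ltNge; apply/negP => Hh.
pose D s := expR (2 * s) * (H s + - sub_h s).
have thI s : t1 <= s <= t -> 0 <= s /\ 0 < theta s.
  move=> /andP[h1 h2]; have /andP[] := theta_gt0 h1 (le_lt_trans h2 ttb).
  by split => //; exact: le_trans h1.
have der_cont f (s df : R) : is_derive s 1 f df -> {for s, continuous f}.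
  by move=> [h _]; apply: differentiable_continuous; apply/derivable1_diffP.
have dN f (s df : R) : is_derive s 1 f df -> is_derive s 1 (fun s => - f s) (- df).
  by move=> h; exact: (is_deriveN h).
have cD s : t1 <= s <= t -> {for s, continuous D}.
  move=> sI; have [s0 th0] := thI _ sI; have /andP[_ st] := sI.
  apply: continuousM; first exact: (der_cont _ _ _ (derive_exp 2 s)).
  apply: continuousD; first by apply: cH; exact: le_lt_trans st t_b.
  exact: (der_cont _ _ _ (dN _ _ _ (derive_sub_h s0 th0))).
have Dt : D t <= 0.
  by rewrite /D pmulr_rle0 ?expR_gt0// subr_le0.
have [S [/andP[t1S St] DS Dpos]] := first_nonpos t1t Dt cD.
have SI s : t1 < s < S -> [/\ t1 <= s <= t, 0 < s < b & t1 <= s < S].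
  move=> /andP[h1 h2]; rewrite (ltW h1) (ltW (lt_le_trans h2 St)) h2.
  by rewrite (le_lt_trans t10 h1) (lt_trans (lt_le_trans h2 St)).
have SJ s : t1 <= s <= S -> t1 <= s <= t.
  by move=> /andP[-> h]; exact: le_trans St.
have aA s : t1 <= s <= S -> A t1 + - sub_a t1 <= A s + - sub_a s.
  move=> /andP[t1s sS].
  apply: (@derive_ge0_le R (fun s => A s + - sub_a s) (fun s => dA s + - sub_a' s)) => //.
  - move=> r /andP[h1 h2]; have rI : t1 <= r <= t by rewrite h1 (le_trans h2)// (le_trans sS).
    have [r0 th0] := thI _ rI.
    apply: continuousD; last exact: (der_cont _ _ _ (dN _ _ _ (derive_sub_a r0 th0))).
    by apply: cA; have /andP[_ h] := rI; exact: le_lt_trans h t_b.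
  - move=> r /andP[h1 h2]; have [rI rb _] := SI r (introT andP (conj h1 (lt_le_trans h2 sS))).
    have [r0 th0] := thI _ rI.
    exact: (derive_add (dAE rb) (dN _ _ _ (derive_sub_a r0 th0))).
  - move=> r /andP[h1 h2]; have [rI rb rS] := SI r (introT andP (conj h1 (lt_le_trans h2 sS))).
    have [r0 th0] := thI _ rI; have /andP[_ rt] := rI.
    rewrite subr_ge0; apply: le_trans (dA_ge rb).
    apply: (le_trans (sub_a'_le r0 (theta_gt0 (ltW h1) (le_lt_trans rt ttb)))).
    have hr : sub_h r <= H r.
      by have := Dpos r rS; rewrite /D pmulr_rgt0 ?expR_gt0// subr_gt0 => /ltW.
    have h0 : 0 <= sub_h r by rewrite /sub_h mulr_ge0 ?(ltW dl0)// -expr2 sqr_ge0.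
    have k0 : 0 <= k.
      have i0 : 0 <= R0^-1 by rewrite invr_ge0 ltW.
      have q0 := mulr_ge0 (mulr_ge0 (ltW dl0) (sqr_ge0 mu)) i0.
      apply: le_trans mu_small.
      have -> : 6 * dl * mu ^+ 2 / R0 = 6 * (dl * mu ^+ 2 / R0) by ring.
      by apply: addr_ge0; apply: mulr_ge0 => //; exact: ltW.
    rewrite ler_pM2r ?invr_gt0 ?R0t// ler_wpM2l//.
    by rewrite ler_sqr ?nnegrE// (le_trans h0).
have th1 : theta t1 = 1 by rewrite /theta subrr mulr0 subr0.
have a1 : sub_a t1 < A t1.
  apply: le_lt_trans A1; rewrite /sub_a /iT th1 invr1 !mulr1.
  have jR : j t1 <= R0^-1 by rewrite /j lef_pV2 ?posrE ?R0t// lerDl.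
  have : 2 * mu * dl ^+ 2 * j t1 <= 2 * mu * dl ^+ 2 * R0^-1.
    by apply: ler_wpM2l => //; have := mulr_ge0 (ltW mu0) (sqr_ge0 dl); lra.
  by rewrite mul1r; lra.
have : D t1 <= D S.
  apply: (@derive_ge0_le R D (fun s => 2 * expR (2 * s) * (H s + - sub_h s) +
     expR (2 * s) * ((A s - 2 * H s) + - (sub_a s - 2 * sub_h s)))) => //.
  - by move=> s /SJ; exact: cD.
  - move=> s /SI[sI sb sS]; have [s0 th0] := thI _ sI.
    exact: (derive_mul (derive_exp 2 s) (derive_add (dH sb) (dN _ _ _ (derive_sub_h s0 th0)))).
  - move=> s sS; have [sI sb sS'] := SI s sS.
    have -> : 2 * expR (2 * s) * (H s + - sub_h s) +
     expR (2 * s) * ((A s - 2 * H s) + - (sub_a s - 2 * sub_h s)) = expR (2 * s) * (A s + - sub_a s) by ring.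
    rewrite mulr_ge0 ?expR_ge0//.
    have := aA s; have /andP[h1 h2] := sS; rewrite (ltW h1) (ltW h2) => /(_ isT); lra.
have : 0 < D t1.
  rewrite /D mulr_gt0 ?expR_gt0// subr_gt0 /sub_h /iT th1 invr1 !mulr1; exact: H1.
by move=> h1 h2; have := lt_le_trans h1 h2; rewrite ltNge DS.
Qed.

(** If the slab reached the explosion time of [sub_h], the continuous function [H]
    would be bounded there while exceeding arbitrarily large values of [sub_h]. *)
Lemma lifespan_le : b <= tb.
Proof.
rewrite leNgt; apply/negP => tbb.
have md : 0 < mu * dl by rewrite mulr_gt0.
have p1 := R0t t10.
have e1 : 1 < expR (1 / (mu * dl)) by rewrite expR_gt1 divr_gt0.
have t1tb : t1 <= tb by rewrite /tb; nra.
have cHI : {within `[t1, tb], continuous H}.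
  apply: continuous_in_subspaceT => s; rewrite inE /= in_itv /= => /andP[_ h].
  by apply: cH; exact: le_lt_trans tbb.
have [c _ hc] := EVT_max t1tb cHI.
pose B := Num.max 0 (H c).
have B0 : 0 <= B by rewrite /B le_max lexx.
(* when theta = r the subsolution is dl / r^2 >= dl / r >= B + 1 *)
pose r := Num.min 2^-1 (dl / (B + 1)).
have [r0 r2 rB] : [/\ 0 < r, r <= 2^-1 & r <= dl / (B + 1)].
  have q0 : 0 < dl / (B + 1) by rewrite divr_gt0// ltr_wpDl.
  rewrite /r; move: (dl / (B + 1)) q0 => q q0.
  by case: (leP 2^-1 q) => h; split; lra.
pose t := (R0 + t1) * expR ((1 - r) / (mu * dl)) - R0.
have q0 : 0 <= (1 - r) / (mu * dl) by apply: divr_ge0; [lra|exact: ltW].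
have et1 : 1 <= expR ((1 - r) / (mu * dl)).
  by apply: le_trans (expR_ge1Dx _); rewrite lerDl.
have et2 : expR ((1 - r) / (mu * dl)) < expR (1 / (mu * dl)).
  by rewrite ltr_expR ltr_pM2r ?invr_gt0//; lra.
have tI1 : t1 <= t by rewrite /t; nra.
have tI2 : t < tb by rewrite /t /tb ltrD2r ltr_pM2l.
have thr : theta t = r.
  have e : R0 + t = (R0 + t1) * expR ((1 - r) / (mu * dl)) by rewrite /t; ring.
  rewrite /theta e lnM ?posrE ?expR_gt0// expRK.
  by field; rewrite !gt_eqF.
have hH := sub_h_lt tI1 tI2 (lt_trans tI2 tbb).
have hB : H t <= B.
  by rewrite /B le_max; apply/orP; right; apply: hc; rewrite in_itv /= tI1 ltW.
have := lt_le_trans hH hB; rewrite /sub_h /iT thr.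
apply/negP; rewrite -leNgt.
have B1 : 0 < B + 1 by lra.
have hr : r * (B + 1) <= dl by rewrite -ler_pdivlMr.
rewrite -invfM ler_pdivlMr ?mulr_gt0//.
have : r * r <= r by nra.
by nra.
Qed.

End Comparison.
End Subsolution.

(** * Lifespan of the differential system *)

Section Lifespan.
Context {R : realType}.
Variables (f m s : R -> R) (b R0 V0 e1 : R).
Hypotheses (R00 : 0 < R0) (V00 : 0 < V0) (e10 : 0 < e1) (e11 : e1 <= 1).
Hypothesis cf : forall t, t < b -> {for t, continuous f}.
Hypothesis cm : forall t, t < b -> {for t, continuous m}.
Hypothesis df : forall t, 0 < t < b -> is_derive t 1 f (m t).
Hypothesis dm : forall t, 0 < t < b -> is_derive t 1 m (f t + s t).
Hypothesis s_ge : forall t, 0 < t < b -> f t ^+ 2 / (2 * ball_wave_bound (R0 + t)) <= s t.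
Hypothesis f0 : - V0 <= f 0.
Hypothesis fm0 : e1 <= f 0 + m 0.

(** The constant of the inequality A' >= kappa H^2 / (R0 + t), obtained by writing out
    e^{-t} f^2 / (2 V(R0 + t)) in terms of H = e^{-t} f. *)
Definition kappa : R := (2048 * pi ^+ 3 * expR R0)^-1.
(** Small enough for the subsolution: the bound by kappa/8 controls the leading term
    and the bound by R0 the terms divided by R0. *)
Definition mu : R := Num.min (kappa / 8) R0.
Let t1 := 2^-1 + 2 * V0 / e1.
Let dl := e1 / 8.
Let H t := expR (-1 * t) * f t.
Let A t := expR (-1 * t) * (f t + m t).

Lemma kappa_gt0 : 0 < kappa.
Proof.
have h : 0 < 2048 :> R by rewrite ltr0n.
rewrite /kappa invr_gt0; exact: (mulr_gt0 (mulr_gt0 h (exprn_gt0 3 (pi_gt0 R))) (expR_gt0 R0)).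
Qed.

Lemma mu_gt0 : 0 < mu.
Proof. by rewrite /mu lt_min R00 divr_gt0 ?kappa_gt0. Qed.

Let cE t : {for t, continuous (fun s : R => expR (-1 * s))}.
Proof.
by have [h _] := derive_exp (-1) t; apply: differentiable_continuous; apply/derivable1_diffP.
Qed.

Let cH t : t < b -> {for t, continuous H}.
Proof. by move=> tb; apply: continuousM; [exact: cE|exact: cf]. Qed.

Let cA t : t < b -> {for t, continuous A}.
Proof.
move=> tb; apply: continuousM; first exact: cE.
by apply: continuousD; [exact: cf|exact: cm].
Qed.

Let dH t : 0 < t < b -> is_derive t 1 H (A t - 2 * H t).
Proof.
move=> tb; have := derive_mul (derive_exp (-1) t) (df tb).
by congr (is_derive _ _ _ _); rewrite /A /H; ring.
Qed.

Let dA t : 0 < t < b -> is_derive t 1 A (expR (-1 * t) * s t).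
Proof.
move=> tb; have := derive_mul (derive_exp (-1) t) (derive_add (df tb) (dm tb)).
by congr (is_derive _ _ _ _); rewrite /A; ring.
Qed.

Let dA_ge t : 0 < t < b -> kappa * H t ^+ 2 / (R0 + t) <= expR (-1 * t) * s t.
Proof.
move=> tb; have /andP[t0 _] := tb.
have -> : kappa * H t ^+ 2 / (R0 + t) = expR (-1 * t) * (f t ^+ 2 / (2 * ball_wave_bound (R0 + t))).
  rewrite /kappa /H /ball_wave_bound expRD mulN1r expRN.
  have h0 : R0 + t != 0 by rewrite gt_eqF// addr_gt0.
  have h1 : expR t != 0 by rewrite gt_eqF// expR_gt0.
  have h2 : expR R0 != 0 by rewrite gt_eqF// expR_gt0.
  have h3 : pi != 0 :> R by rewrite gt_eqF// pi_gt0.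
  by move: (@pi R) h3 => p h3; field; rewrite h0 h1 h2 h3.
by apply: ler_wpM2l; [exact: expR_ge0|exact: s_ge].
Qed.

(** Since A is nondecreasing, A >= e1, and e^{2 t} (H - e1/2) is nondecreasing;
    from H(0) >= -V0 this gives H >= e1/4 at the time t1 = 1/2 + 2 V0 / e1, so the
    comparison with the subsolution of size dl = e1/8 can start there. *)
Lemma system_lifespan :
  b <= (R0 + t1) * expR (1 / (mu * dl)) - R0.
Proof.
have md : 0 < mu * dl by rewrite mulr_gt0 ?mu_gt0// divr_gt0.
have V1 : 0 < V0 / e1 by rewrite divr_gt0.
have t10 : 0 < t1 by rewrite /t1 -mulrA; lra.
have e2 : 1 < expR (1 / (mu * dl)) by rewrite expR_gt1 divr_gt0.
have [bt1|t1b] := leP b t1.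
  apply: (le_trans bt1); rewrite lerBrDl ler_peMr ?(ltW e2)//.
  by rewrite addr_ge0 // ltW.
have A0 t : 0 <= t <= t1 -> e1 <= A t.
  move=> /andP[t0 tt1].
  apply: (@le_trans _ _ (A 0)); first by rewrite /A mulr0 expR0 mul1r.
  apply: (@derive_ge0_le _ A (fun t => expR (-1 * t) * s t)) => //.
  - by move=> r /andP[_ rt]; apply: cA; apply: le_lt_trans t1b; exact: le_trans tt1.
  - by move=> r /andP[r0 rt]; apply: dA; rewrite r0 (lt_trans rt)// (le_lt_trans tt1).
  - move=> r /andP[r0 rt].
    have rb : 0 < r < b by rewrite r0 (lt_trans rt)// (le_lt_trans tt1).
    apply: le_trans (dA_ge rb).
    rewrite mulr_ge0 ?invr_ge0 ?addr_ge0 ?(ltW r0) ?(ltW R00)//.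
    by rewrite mulr_ge0 ?sqr_ge0 ?(ltW kappa_gt0).
pose D t := expR (2 * t) * (H t + - (e1 / 2)).
have DD : D 0 <= D t1.
  apply: (@derive_ge0_le _ D (fun t => 2 * expR (2 * t) * (H t + - (e1 / 2)) +
    expR (2 * t) * ((A t - 2 * H t) + 0)) 0 t1 (ltW t10)).
  - move=> r /andP[_ rt]; apply: continuousM.
      by have [h _] := derive_exp 2 r; apply: differentiable_continuous; apply/derivable1_diffP.
    apply: continuousD; last exact: cst_continuous.
    by apply: cH; exact: le_lt_trans t1b.
  - move=> r /andP[r0 rt].
    have rb : 0 < r < b by rewrite r0 (lt_trans rt).
    exact: (derive_mul (derive_exp 2 r) (derive_add (dH rb) (is_derive_cst (- (e1 / 2)) r 1))).
  - move=> r /andP[r0 rt].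
    have -> : 2 * expR (2 * r) * (H r + - (e1 / 2)) +
      expR (2 * r) * ((A r - 2 * H r) + 0) = expR (2 * r) * (A r - e1) by field.
    by rewrite mulr_ge0 ?expR_ge0// subr_ge0 A0// !ltW.
have H1 : e1 / 4 <= H t1.
  have D0 : - V0 - e1 / 2 <= D 0.
    by rewrite /D /H !mulr0 expR0 !mul1r lerD2r.
  have E1 : 2 + 4 * (V0 / e1) <= expR (2 * t1).
    by apply: le_trans (expR_ge1Dx _); rewrite /t1 -mulrA; lra.
  have e3 : (e1 / 4) * (2 + 4 * (V0 / e1)) = V0 + e1 / 2 by field; rewrite gt_eqF.
  have E0 := expR_gt0 (2 * t1).
  have e4 : (e1 / 4) * (2 + 4 * (V0 / e1)) <= (e1 / 4) * expR (2 * t1).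
    by apply: ler_wpM2l => //; rewrite divr_ge0// ltW.
  have : expR (2 * t1) * (e1 / 4) <= expR (2 * t1) * H t1.
    by have := le_trans D0 DD; rewrite /D; lra.
  by rewrite ler_pM2l.
apply: (@lifespan_le R H A R0 kappa t1 b dl mu R00 (ltW t10) _ mu_gt0 _ cH cA dH _ dA dA_ge).
- by rewrite /dl divr_gt0.
- have mk : mu <= kappa / 8 by rewrite /mu ge_min lexx.
  have mR : mu / R0 <= 1 by rewrite ler_pdivrMr// mul1r /mu ge_min lexx orbT.
  have -> : 6 * dl * mu ^+ 2 / R0 = (6 * dl) * (mu * (mu / R0)) by rewrite expr2; ring.
  have h1 : mu * (mu / R0) <= mu by rewrite ler_piMr// ltW// mu_gt0.
  have h2 : 0 <= mu * (mu / R0).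
    by rewrite mulr_ge0 ?divr_ge0 ?(ltW mu_gt0) ?(ltW R00).
  have h3 := mu_gt0; have h4 := kappa_gt0.
  have h5 : 6 * dl <= 1.
    by apply: le_trans e11; rewrite /dl mulrCA ler_piMr ?(ltW e10)//; lra.
  have h6 : 6 * dl * (mu * (mu / R0)) <= mu * (mu / R0) by rewrite ler_piMl.
  by lra.
- by rewrite /dl; have := e10; lra.
- have tt : 0 <= t1 <= t1 by rewrite lexx ltW.
  have mR : mu / R0 <= 1 by rewrite ler_pdivrMr// mul1r /mu ge_min lexx orbT.
  have h := A0 t1 tt; apply: lt_le_trans h.
  have -> : 2 * mu * dl ^+ 2 / R0 = 2 * (mu / R0) * (dl * dl) by rewrite expr2; ring.
  have d0 : 0 <= dl by rewrite /dl divr_ge0// ltW.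
  have h1 : (mu / R0) * (dl * dl) <= dl * dl by rewrite ler_piMl// mulr_ge0.
  have h2 : dl * dl <= dl by rewrite ler_piMl// /dl; have := e10; have := e11; lra.
  have e8 : e1 = 8 * dl by rewrite /dl; field.
  have d1 : 0 < dl by rewrite /dl divr_gt0.
  by rewrite e8; lra.
Qed.

End Lifespan.

(** * Exchanging the integrals over space and over the sphere *)

Section SphereAverage.
Context {R : realType}.
Local Notation leb := (@lebesgue_measure R).
Local Notation mu2 := (leb \x leb)%E.
Local Notation mu3 := ((leb \x leb) \x leb)%E.
Local Notation V := 'rV[R]_3.
Local Notation i0 := (ord0 : 'I_3).
Local Notation i1 := (lift ord0 ord0 : 'I_3).
Local Notation i2 := (ord_max : 'I_3).

(** Alias of the spatial Lebesgue measure on which sigma-finiteness is recorded, for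
    the exchange with the integral over the sphere. *)
Definition leb3 : set (measurableTypeR R * measurableTypeR R * measurableTypeR R)%type -> \bar R := mu3.
HB.instance Definition _ := Measure.on leb3.
Let leb3_sigma_finite : sigma_finite setT leb3.
Proof.
exists (fun n => box n%:R) => [|n].
  apply/esym/seteqP; split => // z _.
  pose m := Num.max (Num.max `|z.1.1| `|z.1.2|) `|z.2|.
  exists (Num.truncn m).+1 => //=.
  have : m < (Num.truncn m).+1%:R := truncnS_gt m.
  rewrite {1}/m !gt_max => /andP[/andP[h1 h2] h3].
  by split; [split|]; rewrite /= in_itv/= -ler_norml ltW.
split; first exact: measurable_box.
exact: box_measure_lty.
Qed.
HB.instance Definition _ := Measure_isSigmaFinite.Build _ _ _ leb3 leb3_sigma_finite.

Definition rect : set (R * R) := `[0, pi] `*` `[0, pi *+ 2].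

Lemma measurable_rect : measurable rect.
Proof. by apply: measurableX; exact: measurable_itv. Qed.

Lemma rect_measure : mu2 rect = (2 * pi ^+ 2)%:E.
Proof.
pose I a : set R := `[0, a]%classic.
have e a : 0 <= a -> leb (I a) = a%:E.
  move=> a0; rewrite /I lebesgue_measure_itv/= lte_fin; case: ltP => h.
    by rewrite -EFinB subr0.
  by congr EFin; lra.
have p0 : 0 <= pi :> R by exact: pi_ge0.
have -> : mu2 rect = (leb (I pi%R) * leb (I (pi *+ 2)%R))%E.
  by apply: product_measure1E; exact: measurable_itv.
rewrite (e _ p0) (e _ (mulrn_wge0 2 p0)) -EFinM; congr EFin.
by rewrite mulr2n expr2; ring.
Qed.

Lemma fubini_space_sphere (h : (R * R) * (R * R * R) -> R) (L M : R) :
  measurable_fun setT h -> (forall y, `|h y| <= M) ->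
  (forall z a, ~ box L z -> h (a, z) = 0) -> (forall z a, ~ rect a -> h (a, z) = 0) ->
  \int[mu3]_z (\int[mu2]_a h (a, z)) = \int[mu2]_a (\int[mu3]_z h (a, z)) /\
  mu2.-integrable setT (EFin \o (fun a => \int[mu3]_z h (a, z))).
Proof.
move=> mh hM hz ha.
have ia z : mu2.-integrable setT (EFin \o (fun a => h (a, z))).
  have -> : EFin \o (fun a => h (a, z)) = (EFin \o (fun a => h (a, z))) \_ rect.
    apply/funext => a; rewrite patchE; case: ifPn => //.
    by rewrite notin_setE => /ha /= ->.
  rewrite -integrable_mkcond; last exact: measurable_rect.
  apply: measurable_bounded_integrable.
  - exact: measurable_rect.
  - by have := rect_measure => /= ->; rewrite ltry.
  - apply: measurable_funTS.
    by apply: (measurableT_comp mh); exact: measurable_fun_pair.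
  - exists M; split; rewrite ?num_real// => x Mx z' _.
    by apply: le_trans (ltW Mx).
have iz a : mu3.-integrable setT (EFin \o (fun z => h (a, z))).
  apply: (@integrable_box _ (fun z => h (a, z)) L M).
  - by apply: (measurableT_comp mh); exact: measurable_fun_pair.
  - by move=> z; exact: hM.
  - by move=> z /hz.
have mhE : measurable_fun setT (EFin \o h) by exact/measurable_EFinP.
have ih : (leb2 \x leb3)%E.-integrable setT (EFin \o h).
  have -> : EFin \o h = (EFin \o h) \_ (rect `*` box L).
    apply/funext => -[a z]; rewrite patchE; case: ifPn => //.
    rewrite notin_setE => nb /=.
    have [bz|/hz ->//] := pselect (box L z).
    by rewrite ha// => ra; apply: nb.
  have mB : measurable (rect `*` box L).
    by apply: measurableX; [exact: measurable_rect|exact: measurable_box].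
  have muB : ((leb2 \x leb3)%E (rect `*` box L) < +oo)%E.
    have -> : (leb2 \x leb3)%E (rect `*` box L) = (leb2 rect * leb3 (box L))%E.
      by apply: product_measure1E; [exact: measurable_rect|exact: measurable_box].
    have -> : leb2 rect = (2 * pi ^+ 2)%:E by exact: rect_measure.
    have h1 : (leb3 (box L) < +oo)%E by exact: box_measure_lty.
    have h0 : (0 <= leb3 (box L))%E by exact: measure_ge0.
    apply: lte_mul_pinfty => //.
    by rewrite lee_fin mulr_ge0// sqr_ge0.
  rewrite -integrable_mkcond//.
  apply: measurable_bounded_integrable => //.
  - exact: measurable_funTS.
  - exists M; split; rewrite ?num_real// => x Mx y _.
    by apply: le_trans (ltW Mx).
have e1 z : (\int[mu2]_a (h (a, z))%:E)%E = (\int[mu2]_a h (a, z))%:E.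
  by rewrite /Rintegral fineK//; apply: integrable_fin_num => //; exact: ia.
have e3 a : (\int[mu3]_z (h (a, z))%:E)%E = (\int[mu3]_z h (a, z))%:E.
  by rewrite /Rintegral fineK//; apply: integrable_fin_num => //; exact: iz.
split.
  rewrite {1}/Rintegral [in RHS]/Rintegral; congr fine.
  under eq_integral do rewrite -e1.
  under [in RHS]eq_integral do rewrite -e3.
  have := @Fubini _ _ _ _ R leb2 leb3 _ ih; exact: esym.
have := @integrable_fubini_F _ _ _ _ R leb2 leb3 _ ih.
rewrite /fubini_F; congr (_.-integrable _ _).
by apply/funext => a /=; rewrite -e3.
Qed.

Lemma sqn_sph a : sqn (@sph R a) = 1.
Proof.
rewrite /sqn /sph row30 row31 row32.
have h1 := cos2Dsin2 a.1; have h2 := cos2Dsin2 a.2.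
have -> : sin a.1 * cos a.2 * (sin a.1 * cos a.2) + sin a.1 * sin a.2 * (sin a.1 * sin a.2) +
  cos a.1 * cos a.1 = sin a.1 ^+ 2 * (cos a.2 ^+ 2 + sin a.2 ^+ 2) + cos a.1 ^+ 2 by ring.
by rewrite h2 mulr1 addrC.
Qed.

Lemma measurable_sph (i : 'I_3) : measurable_fun setT (fun a : R * R => sph a 0 i).
Proof.
have c1 : measurable_fun setT (fun a : R * R => sin a.1).
  exact: (measurableT_comp (continuous_measurable_fun (@continuous_sin R)) measurable_fst).
have c2 : measurable_fun setT (fun a : R * R => cos a.1).
  exact: (measurableT_comp (continuous_measurable_fun (@continuous_cos R)) measurable_fst).
have c3 : measurable_fun setT (fun a : R * R => sin a.2).
  exact: (measurableT_comp (continuous_measurable_fun (@continuous_sin R)) measurable_snd).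
have c4 : measurable_fun setT (fun a : R * R => cos a.2).
  exact: (measurableT_comp (continuous_measurable_fun (@continuous_cos R)) measurable_snd).
case: (ord3P i) => ->; rewrite /sph.
- by under eq_fun do rewrite row30; exact: measurable_funM.
- by under eq_fun do rewrite row31; exact: measurable_funM.
- by under eq_fun do rewrite row32.
Qed.

(** The density of the surface measure in spherical coordinates. *)
Definition sphW (a : R * R) : R := sin a.1 * \1_rect a.

Lemma measurable_sphW : measurable_fun setT sphW.
Proof.
apply: measurable_funM.
  exact: (measurableT_comp (continuous_measurable_fun (@continuous_sin R)) measurable_fst).
by apply: measurable_indic; exact: measurable_rect.
Qed.

Lemma sphW_bounds a : 0 <= sphW a <= \1_rect a.
Proof.
rewrite /sphW indicE; have [ra|na] := pselect (rect a).
  rewrite mem_set// mulr1; apply/andP; split; last exact: sin_le1.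
  by case: ra => + _; rewrite /= in_itv /= => h; exact: sin_ge0_pi.
by rewrite memNset// mulr0 lexx.
Qed.

Section Kernel.
Variables (c0 : V -> R) (c : 'I_3 -> V -> R) (L : R).
Hypotheses (cc0 : continuous c0) (cc : forall i, continuous (c i)).
Hypotheses (vc0 : vanish L c0) (vc : forall i, vanish L (c i)) (L0 : 0 <= L).

(** The common form of the two integrands that define epsilon: a plane wave times
    a function that is affine in its direction. *)
Definition wave_kernel (v x : V) : R := expR (dot v x) *
  (c0 x + (c i0 x * v 0 i0 + c i1 x * v 0 i1 + c i2 x * v 0 i2)).

(** The integrand is bounded and vanishes unless the direction is in a rectangle
    and the point in a cube, so that Fubini's theorem applies. *)
Lemma sphere_swap :
  int_R3 (fun x => int_S2 (fun v => wave_kernel v x)) =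
    \int[mu2]_a (int_R3 (wave_kernel (sph a)) * sphW a) /\
  mu2.-integrable setT (EFin \o (fun a => int_R3 (wave_kernel (sph a)) * sphW a)).
Proof.
have ms i : measurable_fun setT (fun y : (R * R) * (R * R * R) => sph y.1 0 i).
  exact: (measurableT_comp (measurable_sph i) measurable_fst).
have mc (g : V -> R) : continuous g -> measurable_fun setT (fun y : (R * R) * (R * R * R) => g (r3 y.2)).
  move=> cg; exact: (measurableT_comp (continuous_measurable3 (@continuous_comp_r3 R g cg)) measurable_snd).
have mx i : measurable_fun setT (fun y : (R * R) * (R * R * R) => r3 y.2 0 i).
  by apply: (mc (fun x => x 0 i)); exact: coord_continuous.
have mk : measurable_fun setT (fun y : (R * R) * (R * R * R) => wave_kernel (sph y.1) (r3 y.2)).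
  rewrite /wave_kernel; apply: measurable_funM.
    apply: (measurableT_comp (f := expR)).
      exact: continuous_measurable_fun (@continuous_expR R).
    under eq_fun do rewrite /dot sum3E.
    by apply: measurable_funD; [apply: measurable_funD|]; exact: measurable_funM.
  apply: measurable_funD; first exact: mc.
  by apply: measurable_funD; [apply: measurable_funD|];
    (apply: measurable_funM; [exact: mc|exact: ms]).
have vk v (x : V) i : L < `|x 0 i| -> wave_kernel v x = 0.
  by move=> xi; rewrite /wave_kernel (vc0 xi) !(vc _ xi); ring.
have zk a z : ~ box L z -> wave_kernel (sph a) (r3 z) = 0.
  by apply: (@vanish_box R L (wave_kernel (sph a))) => x i; exact: vk.
have bdd (g : V -> R) : continuous g -> exists2 M : R, 0 <= M & forall z, box L z -> `|g (r3 z)| <= M.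
  move=> cg; apply: continuous_box_bounded; apply: continuous_subspaceT.
  exact: continuous_comp_r3.
have [M0 M00 hM0] := bdd _ cc0; have [M1 M10 hM1] := bdd _ (@cc i0).
have [M2 M20 hM2] := bdd _ (@cc i1); have [M3 M30 hM3] := bdd _ (@cc i2).
pose M := expR (2 * L) * (M0 + (M1 + M2 + M3)).
have M0' : 0 <= M by rewrite mulr_ge0 ?expR_ge0// !addr_ge0.
have kM a z : `|wave_kernel (sph a) (r3 z)| <= M.
  have [bz|nb] := pselect (box L z); last by rewrite zk// normr0.
  have s1 := sqn_sph a; set v := sph a in s1 *.
  have vi i : `|v 0 i| <= 1.
    rewrite -ler_sqr ?nnegrE// real_normK ?num_real// expr1n -s1 expr2.
    exact: sqn_coord.
  have ci (C m : R) i : `|C| <= m -> `|C * v 0 i| <= m.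
    by move=> h; rewrite normrM -[m]mulr1 ler_pM.
  rewrite /wave_kernel normrM ger0_norm ?expR_ge0//; apply: ler_pM => //.
    rewrite ler_expR /dot sum3E.
    have w1' : sqn v <= 1 * 1 by rewrite s1 mulr1.
    have L20 : 0 <= 2 * L by rewrite mulr_ge0.
    have hs : sqn (r3 z) <= (2 * L) * (2 * L).
      case: bz => -[]; rewrite /= !in_itv /= => h1 h2 h3.
      have q (t : R) : - L <= t <= L -> t * t <= L * L.
        by rewrite -ler_norml => h; rewrite -[t * t]ger0_norm ?normrM ?ler_pM// -expr2 sqr_ge0.
      rewrite /sqn /r3 row30 row31 row32.
      have := q _ h1; have := q _ h2; have := q _ h3.
      have : 0 <= L * L by rewrite mulr_ge0.
      lra.
    have := @cauchy3 R _ _ _ _ _ _ 1 (2 * L) ler01 L20 w1' hs.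
    by rewrite ler_norml mul1r => /andP[].
  apply: (le_trans (ler_normD _ _)); apply: lerD; first exact: hM0.
  apply: (le_trans (ler_normD _ _)); apply: lerD; last by apply: ci; exact: hM3.
  apply: (le_trans (ler_normD _ _)); apply: lerD; first by apply: ci; exact: hM1.
  by apply: ci; exact: hM2.
pose h (y : (R * R) * (R * R * R)) := wave_kernel (sph y.1) (r3 y.2) * sphW y.1.
have mh : measurable_fun setT h.
  by apply: measurable_funM => //; exact: (measurableT_comp measurable_sphW measurable_fst).
have W1 a : `|sphW a| <= 1.
  have /andP[h1 h2] := sphW_bounds a; rewrite ger0_norm//; apply: (le_trans h2).
  by rewrite indicE; case: (_ \in _); rewrite ?lexx ?ler01.
have hM y : `|h y| <= M.
  by rewrite /h normrM -[M]mulr1; apply: ler_pM.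
have hz z a : ~ box L z -> h (a, z) = 0 by move=> nb; rewrite /h /= zk// mul0r.
have ha z a : ~ rect a -> h (a, z) = 0.
  by move=> na; rewrite /h /= /sphW indicE memNset// !mulr0.
have [e ih] := fubini_space_sphere mh hM hz ha.
have ik a : mu3.-integrable setT (EFin \o (fun z => wave_kernel (sph a) (r3 z))).
  have mka : measurable_fun setT (fun z => wave_kernel (sph a) (r3 z)).
    have mp : measurable_fun setT (fun z : R * R * R => (a, z)) by exact: measurable_fun_pair.
    exact: (measurableT_comp mk mp).
  exact: (@integrable_box R (fun z => wave_kernel (sph a) (r3 z)) L M mka (kM a) (zk a)).
have eJ a : \int[mu3]_z h (a, z) = int_R3 (wave_kernel (sph a)) * sphW a.
  by rewrite /h /= (RintegralZr _ measurableT (ik a)).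
split.
  have -> : \int[mu2]_a (int_R3 (wave_kernel (sph a)) * sphW a) = \int[mu2]_a (\int[mu3]_z h (a, z)).
    by apply: eq_Rintegral => a _; rewrite eJ.
  rewrite -e; apply: eq_Rintegral => z _; rewrite /int_S2 Rintegral_mkcond.
  apply: eq_Rintegral => a _; rewrite /h /sphW /= patchE indicE -/rect.
  by case: (a \in rect); rewrite ?mulr1 ?mulr0.
by move: ih; congr (_.-integrable _ _); apply/funext => a /=; rewrite eJ.
Qed.

End Kernel.

End SphereAverage.

(** * From the Euler system to a single plane wave *)

Section Assembly.
Context {R : realType}.
Local Notation leb := (@lebesgue_measure R).
Local Notation mu2 := (leb \x leb)%E.
Local Notation V := 'rV[R]_3.
Local Notation i0 := (ord0 : 'I_3).
Local Notation i1 := (lift ord0 ord0 : 'I_3).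
Local Notation i2 := (ord_max : 'I_3).

(** Otherwise the integral over the sphere, taken with a density at most 1 on a
    rectangle of area 2 pi^2 <= 32, would be at most eps/2. *)
Lemma exists_direction (c0 c0' : V -> R) (c c' : 'I_3 -> V -> R) (L eps : R) : 0 <= L ->
  continuous c0 -> (forall i, continuous (c i)) -> vanish L c0 -> (forall i, vanish L (c i)) ->
  continuous c0' -> (forall i, continuous (c' i)) -> vanish L c0' -> (forall i, vanish L (c' i)) ->
  eps = int_R3 (fun x => int_S2 (fun v => wave_kernel c0 c v x)) +
        int_R3 (fun x => int_S2 (fun v => wave_kernel c0' c' v x)) ->
  0 < eps ->
  exists v, sqn v = 1 /\ eps / 64 <= int_R3 (wave_kernel c0 c v) + int_R3 (wave_kernel c0' c' v).
Proof.
have four (p : R) : p / 2 < 2 -> p <= 4 by move=> h; lra.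
have contra_up (e P : R) : 0 < e -> e <= P -> P <= e / 64 * (2 * (4 * 4)) -> False.
  by move=> e0 h h'; lra.
move=> L0 h1 h2 h3 h4 h1' h2' h3' h4' epsE eps0.
apply: contrapT => no.
have lt a : int_R3 (wave_kernel c0 c (sph a)) + int_R3 (wave_kernel c0' c' (sph a)) <= eps / 64.
  rewrite leNgt; apply/negP => /ltW h; apply: no; exists (sph a).
  by split; [exact: sqn_sph|].
have [e1 j1] := sphere_swap h1 h2 h3 h4 L0.
have [e2 j2] := sphere_swap h1' h2' h3' h4' L0.
have iI : (\int[mu2]_z (\1_(@rect R) z)%:E)%E = (2 * pi ^+ 2)%:E.
  rewrite integral_indic//; last exact: measurable_rect.
  by rewrite setIT; exact: rect_measure.
have ir : mu2.-integrable setT (EFin \o (fun a => eps / 64 * \1_(@rect R) a)).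
  apply/integrableP; split.
    apply/measurable_EFinP; apply: measurable_funM; first exact: measurable_cst.
    by apply: measurable_indic; exact: measurable_rect.
  rewrite (_ : (\int[mu2]_z _)%E = (\int[mu2]_z ((eps / 64)%:E * (\1_(@rect R) z)%:E))%E).
    rewrite ge0_integralZl//; last by rewrite lee_fin divr_ge0// ltW.
      by rewrite iI -EFinM ltry.
    by apply/measurable_EFinP; apply: measurable_indic; exact: measurable_rect.
  apply: eq_integral => z _; rewrite /= ger0_norm ?EFinM//.
  by rewrite mulr_ge0 ?divr_ge0 ?(ltW eps0)// indicE ler0n.
have ir1 : \int[mu2]_a (eps / 64 * \1_(@rect R) a) = eps / 64 * (2 * pi ^+ 2).
  rewrite /Rintegral; under eq_integral do rewrite EFinM.
  rewrite ge0_integralZl//; last by rewrite lee_fin divr_ge0// ltW.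
    by rewrite iI -EFinM.
  by apply/measurable_EFinP; apply: measurable_indic; exact: measurable_rect.
have j12 : mu2.-integrable setT (EFin \o (fun a => int_R3 (wave_kernel c0 c (sph a)) * sphW a +
    int_R3 (wave_kernel c0' c' (sph a)) * sphW a)).
  by have := integrableD measurableT j1 j2; apply: eq_integrable => // z _; rewrite /= EFinD.
have up : eps <= eps / 64 * (2 * pi ^+ 2).
  rewrite {1}epsE e1 e2 -(RintegralD measurableT j1 j2) -ir1.
  apply: (le_Rintegral measurableT j12 ir) => a _.
  have /andP[w0 w1] := sphW_bounds a.
  rewrite -mulrDl; apply: (@le_trans _ _ (eps / 64 * sphW a)); first by rewrite ler_wpM2r.
  by rewrite ler_wpM2l// divr_ge0// ltW.
have p4 : pi <= 4 :> R by apply: four; exact: pihalf_lt2.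
have p0 : 0 <= pi :> R := pi_ge0 R.
have pp : pi ^+ 2 <= 4 * 4 :> R by rewrite expr2; apply: ler_pM.
apply: (contra_up _ _ eps0 up); apply: ler_wpM2l; first by rewrite divr_ge0// ltW.
by apply: ler_wpM2l; first exact: ler0n.
Qed.

(** The product rule turns the equations for the products into those of [flow]. *)
Lemma classical_flow (T : \bar R) b rho u : 0 < b -> (b%:E <= T)%E ->
  classical_solution T rho u ->
  flow b rho (dt rho) (fun j => dx j rho) (fun i t x => u t x 0 i)
    (fun i => dt (fun t x => u t x 0 i)) (fun i j => dx j (fun t x => u t x 0 i)).
Proof.
move=> b0 bT S.
have lt t : t < b -> (t%:E < T)%E by move=> tb; apply: lt_le_trans bT; rewrite lte_fin.
have hr := classical_regular_reg b0 bT (rho_regular S).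
have hU i := classical_regular_reg b0 bT (u_regular S i).
have dxE f ft fx j t x : reg b f ft fx -> 0 < t < b -> dx j f t x = fx j t x.
  by move=> hf tb; have [_ <-] := reg_x hf j x tb.
have dtE f ft fx t x : reg b f ft fx -> 0 < t < b -> dt f t x = ft t x.
  by move=> hf tb; rewrite /dt derive1E; have [_ <-] := reg_t hf x tb.
split => //.
- by move=> t x /andP[t0 tb]; apply: (rho_gt0 S) => //; exact: lt.
- move=> t x tb; have /andP[t0 tb'] := tb.
  apply: etrans (mass_eq S x t0 (lt _ tb')); congr (_ + _); apply: eq_bigr => j _.
  by apply/esym; exact: (dxE _ _ _ j t x (reg_mul hr (hU j)) tb).
- move=> i t x tb; have /andP[t0 tb'] := tb.
  apply: etrans (momentum_eq S i x t0 (lt _ tb')); congr (_ + _ + _).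
  + by apply/esym; exact: (dtE _ _ _ t x (reg_mul hr (hU i)) tb).
  + apply: eq_bigr => j _; apply/esym.
    exact: (dxE _ _ _ j t x (reg_mul (reg_mul hr (hU i)) (hU j)) tb).
  + have hp := reg_mul (reg_cst b 2^-1) (reg_mul hr hr).
    rewrite (_ : (fun s y => pressure (rho s y)) = (fun s y => 2^-1 * (rho s y * rho s y))).
      by apply/esym; rewrite (dxE _ _ _ i t x hp tb); field.
    by apply/funext => s; apply/funext => y; rewrite /pressure expr2.
Qed.

Lemma supp_outside (W : zmodType) (f : V -> W) (r : R) x : 0 <= r ->
  supp f `<=` [set x | euclid x <= r] -> r * r < sqn x -> f x = 0.
Proof.
move=> r0 sf rx; apply: contrapT => /eqP fx.
have : euclid x <= r by apply: sf; exact: subset_closure.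
apply/negP; rewrite -ltNge /euclid.
have -> : dot x x = sqn x by rewrite /dot sum3E.
have s0 : 0 <= sqn x by apply: le_trans (ltW rx); rewrite mulr_ge0.
by rewrite -ltr_sqr ?nnegrE ?sqrtr_ge0// sqr_sqrtr// expr2.
Qed.

(** 1 + y <= e^y absorbs the polynomial factor R0 + t1 into the exponential, as
    1/eps >= 1. *)
Lemma exponent_bound (r V0 mu eps : R) : 0 < r -> 0 < V0 -> 0 < mu -> 0 < eps -> eps <= 1 ->
  (r + (2^-1 + 2 * V0 / (eps / 64))) * expR (1 / (mu * (eps / 64 / 8))) - r <
  expR ((r + 1 + 128 * V0 + 512 / mu) * eps^-1).
Proof.
move=> r0 V00 mu0 e0 e1.
have -> : 2 * V0 / (eps / 64) = 128 * V0 * eps^-1 by field; rewrite gt_eqF.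
have -> : 1 / (mu * (eps / 64 / 8)) = 512 / mu * eps^-1 by field; rewrite !gt_eqF.
have inv1 : 1 <= eps^-1 by rewrite invf_ge1.
have -> : (r + 1 + 128 * V0 + 512 / mu) * eps^-1 =
  (r * eps^-1 + eps^-1 + 128 * V0 * eps^-1) + 512 / mu * eps^-1 by ring.
rewrite expRD; have := expR_gt0 (512 / mu * eps^-1).
move: (expR (512 / mu * eps^-1)) => E E0.
apply: (@lt_le_trans _ _ ((r + (2^-1 + 128 * V0 * eps^-1)) * E)); first by rewrite ltrBlDr ltrDl.
rewrite ler_pM2r//; apply: le_trans (expR_ge1Dx _).
have : r <= r * eps^-1 by rewrite ler_peMr// ltW.
move: (r * eps^-1) (128 * V0 * eps^-1) eps^-1 inv1 => p q k; clear => k1 pr; lra.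
Qed.

End Assembly.

(** * The lifespan bound *)

Section PlaneWaveLifespan.
Context {R : realType}.
Local Notation V := 'rV[R]_3.
Local Notation i0 := (ord0 : 'I_3).
Local Notation i1 := (lift ord0 ord0 : 'I_3).
Local Notation i2 := (ord_max : 'I_3).

(** The functionals with the time clipped at 0 solve the differential system for
    positive times and are continuous at t = 0, where the data enter. *)
Lemma flow_lifespan (b r e : R) rho rt rx U Ut Ux (w : V) :
  flow b rho rt rx U Ut Ux -> 0 < b -> 0 < r ->
  (forall x, r * r < sqn x -> at_rest rho U 0 x) -> sqn w = 1 ->
  0 < e -> e <= 1 -> e <= int_R3 (wmass rho w 0) + int_R3 (wmom rho U w 0) ->
  b <= (r + (2^-1 + 2 * ball_wave_bound r / e)) * expR (1 / (mu r * (e / 8))) - r.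
Proof.
move=> F b0 r0 rest0 w1 e0 e1 we.
have rest := finite_speed F b0 (ltW r0) rest0.
pose f (s : R) := int_R3 (wmass rho w (Num.max 0 s)).
pose m (s : R) := int_R3 (wmom rho U w (Num.max 0 s)).
pose s t := int_R3 (wsource rho U w t).
have max0 (t : R) : 0 < t < b -> Num.max 0 t = t by move=> /andP[t0 _]; rewrite max_r ?ltW.
have incl (t : R) : 0 < t < b -> 0 <= t < b by move=> /andP[/ltW -> ->].
have V0 := ball_wave_bound_gt0 r0.
apply: (@system_lifespan R f m s b r (ball_wave_bound r) e r0 V0 e0 e1).
- exact: (continuous_wmass F b0 r0 rest).
- exact: (continuous_wmom F b0 r0 rest).
- by move=> t tb; rewrite /m max0//; exact: (wmass_deriv F b0 r0 rest w tb).
- move=> t tb; rewrite /f max0// /s -(wmom_deriv_split F r0 rest w (incl _ tb)).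
  exact: (wmom_deriv F b0 r0 rest w1 tb).
- by move=> t tb; rewrite /f max0//; exact: (wsource_ge F r0 rest w1 (incl _ tb)).
- by rewrite /f maxxx; exact: (wmass0_ge F b0 r0 rest w1).
- by rewrite /f /m maxxx.
Qed.

Lemma exists_growing_direction (u0 : V -> V) (rho0 : V -> R) (r eps : R) : 0 <= r ->
  Cc_infty_vect u0 -> Cc_infty rho0 ->
  supp u0 `<=` [set x | euclid x <= r] -> supp rho0 `<=` [set x | euclid x <= r] ->
  eps = int_R3 (fun x => int_S2 (fun w => expR (dot w x) * rho0 x)) +
        int_R3 (fun x => int_S2 (fun w => expR (dot w x) * (1 + rho0 x) * dot (u0 x) w)) ->
  0 < eps ->
  exists w, sqn w = 1 /\ eps / 64 <= int_R3 (fun x => expR (dot w x) * rho0 x) +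
    int_R3 (fun x => expR (dot w x) * (1 + rho0 x) * dot (u0 x) w).
Proof.
move=> r0 [su _] [srho _] supu suprho epsE eps0.
pose c i x := (1 + rho0 x) * u0 x 0 i.
pose z0 (x : V) : R := 0.
have kE1 v x : wave_kernel rho0 (fun _ => z0) v x = expR (dot v x) * rho0 x.
  by rewrite /wave_kernel /z0; ring.
have kE2 v x : wave_kernel z0 c v x = expR (dot v x) * (1 + rho0 x) * dot (u0 x) v.
  by rewrite /wave_kernel /z0 /c [dot (u0 x) v]sum3E; ring.
have crho : continuous rho0 := (srho [::]).1.
have cu i : continuous (fun x => u0 x 0 i) := (su i [::]).1.
have cz : continuous z0 by move=> x; exact: cst_continuous.
have vz : vanish r z0 by [].
have vrho : vanish r rho0 by move=> x i xi; apply: (supp_outside r0 suprho); exact: (sqn_gt r0 xi).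
have cc i : continuous (c i).
  move=> x; have c1 : {for x, continuous (fun y => 1 + rho0 y)}.
    have c2 : {for x, continuous (fun _ : V => 1 : R)} by exact: cst_continuous.
    exact: (continuousD c2 (crho x)).
  exact: (continuousM c1 (cu i x)).
have vc i : vanish r (c i).
  move=> x j xj; rewrite /c.
  by rewrite (supp_outside r0 supu (sqn_gt r0 xj)) mxE mulr0.
have e : eps = int_R3 (fun x => int_S2 (fun v => wave_kernel rho0 (fun _ => z0) v x)) +
               int_R3 (fun x => int_S2 (fun v => wave_kernel z0 c v x)).
  have f1 x : (fun v => wave_kernel rho0 (fun _ => z0) v x) = (fun v => expR (dot v x) * rho0 x).
    by apply/funext => v; exact: kE1.
  have f2 x : (fun v => wave_kernel z0 c v x) = (fun v => expR (dot v x) * (1 + rho0 x) * dot (u0 x) v).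
    by apply/funext => v; exact: kE2.
  under eq_fun do rewrite f1.
  by under [X in _ + int_R3 X]eq_fun do rewrite f2.
have [w [w1 we]] := exists_direction r0 crho (fun _ => cz) vrho (fun _ => vz) cz cc vz vc e eps0.
exists w; split => //; apply: (le_trans we); rewrite le_eqVlt; apply/orP; left; apply/eqP.
by congr (_ + _); congr int_R3; apply/funext => x.
Qed.

End PlaneWaveLifespan.

Theorem theorem3p1 (R : realType) (R0 : R) (R0_gt0 : 0 < R0) :
  exists eps_star C : R, [/\ 0 < eps_star, 0 < C &
    forall (u0 : 'rV[R]_3 -> 'rV[R]_3) (rho0 : 'rV[R]_3 -> R)
      (T : \bar R) (rho : R -> 'rV[R]_3 -> R) (u : R -> 'rV[R]_3 -> 'rV[R]_3)
      (eps : R),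
    Cc_infty_vect u0 -> Cc_infty rho0 ->
    supp u0 `<=` [set x | euclid x <= R0] ->
    supp rho0 `<=` [set x | euclid x <= R0] ->
    (forall x, 0 < 1 + rho0 x) ->
    (0 < T)%E ->
    classical_solution T rho u ->
    (forall x, u 0 x = u0 x) -> (forall x, rho 0 x = 1 + rho0 x) ->
    eps = int_R3 (fun x => int_S2 (fun w => expR (dot w x) * rho0 x)) +
          int_R3 (fun x => int_S2 (fun w =>
            expR (dot w x) * (1 + rho0 x) * dot (u0 x) w)) ->
    0 < eps -> eps <= eps_star ->
    (T < (expR (C * eps^-1))%:E)%E].
Proof.
have V0 := ball_wave_bound_gt0 R0_gt0; have m0 := mu_gt0 R0_gt0.
(* the exponents collected in [exponent_bound] for the direction with eps/64 *)
exists 1, (R0 + 1 + 128 * ball_wave_bound R0 + 512 / mu R0); split; first exact: ltr01.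
  have h1 : 0 < 128 * ball_wave_bound R0 by apply: mulr_gt0; first exact: ltr0n.
  have h2 : 0 < 512 / mu R0 by apply: divr_gt0; first exact: ltr0n.
  exact: (addr_gt0 (addr_gt0 (addr_gt0 R0_gt0 ltr01) h1) h2).
move=> u0 rho0 T rho u eps hu0 hrho0 su srho _ _ S u0E rho0E epsE e0 e1.
set b := expR _; rewrite ltNge; apply/negP => bT.
have b0 : 0 < b by exact: expR_gt0.
have F := classical_flow b0 bT S.
have rest0 x : R0 * R0 < sqn x -> at_rest rho (fun i t x => u t x 0 i) 0 x.
  move=> hx; rewrite /at_rest rho0E (supp_outside (ltW R0_gt0) srho hx) addr0; split => // j.
  by rewrite u0E (supp_outside (ltW R0_gt0) su hx) mxE.
have [w [w1 we]] := exists_growing_direction (ltW R0_gt0) hu0 hrho0 su srho epsE e0.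
have e64 : 0 < eps / 64 by rewrite divr_gt0.
have e64' : eps / 64 <= 1.
  by rewrite ler_pdivrMr// mul1r (le_trans e1)// ler1n.
suff we' : eps / 64 <= int_R3 (wmass rho w 0) + int_R3 (wmom rho (fun i t x => u t x 0 i) w 0).
  have := flow_lifespan F b0 R0_gt0 rest0 w1 e64 e64' we'.
  by apply/negP; rewrite -ltNge; exact: exponent_bound.
apply: (le_trans we); rewrite le_eqVlt; apply/orP; left; apply/eqP.
congr (_ + _); congr int_R3; apply/funext => x.
  by rewrite /wmass wxE rho0E; ring.
by rewrite /wmom /wU wxE rho0E !u0E [dot (u0 x) w]sum3E; ring.
Qed.
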